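(* For $\mathfrak{g}=sl(n)$ the algebra $$(S\mathfrak{g})_{t,h}=T(\mathfrak{g}_h)[t]/J_t,$$ where $J_t$ is the two-sided ideal generated by the elements $x\otimes y-\sigma_h(x\otimes y)-t[x,y]_h$, $x,y\in\mathfrak{g}_h$, is a double quantization of the Lie bracket on $S\mathfrak{g}$ (the function algebra on $\mathfrak{g}^*$).
   Context: $\mathfrak{g}=sl(n)=sl(n,\mathbb{C})$; $U_h(\mathfrak{g})$ is a quantized universal enveloping algebra of $\mathfrak{g}$ over $\mathbb{C}[[h]]$ in the sense of Drinfeld, with comultiplication $\Delta_h$, antipode $\gamma$ and universal $R$-matrix $R=F_h^{21}e^{\frac h2\mathbf{t}}F_h^{-1}$, where $\mathbf{t}$ is the split Casimir of $\mathfrak{g}$, $\Delta_h=F_h\Delta F_h^{-1}$, $F_h=1\otimes1+\frac h2 r+o(h)$, $r$ a classical $r$-matrix. $U_h(\mathfrak{g})$ acts on itself by $\mathrm{ad}(x)y=x_{(1)}y\gamma(x_{(2)})$. Construction of $\mathfrak{g}_h,\sigma_h,[\cdot,\cdot]_h$. Let $Q=R^{21}R=Q'_i\otimes Q''_i$ (summation implicit), let $V=\mathbb{C}^n[[h]]$ be the deformed basic representation, $\rho:U_h(\mathfrak{g})\to\mathrm{End}(V)$, and let $\mathrm{End}(V)^*$ carry the action $(x\varphi)(a)=\varphi(\gamma(x_{(1)})ax_{(2)})$. The map $f:\mathrm{End}(V)^*\to U_h(\mathfrak{g})$, $\varphi\mapsto\varphi(\rho(Q_i'))Q_i''$, is $U_h(\mathfrak{g})$-equivariant.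 Decompose $\mathrm{End}(V)=I\oplus Z_h$, with $I=\mathbb{C}[[h]]\,\mathrm{id}$ and $Z_h$ the invariant complement (a deformation of the adjoint representation), and dually $\mathrm{End}(V)^*=I^*\oplus Z_h^*$, where $I^*$ is spanned by the invariant element $\mathrm{Tr}$ normalized by $\mathrm{Tr}(\mathrm{id})=1$ and $Z_h^*$ is the set of functionals vanishing on $I$. Put $C=f(\mathrm{Tr})$, a central invertible element of $U_h(\mathfrak{g})$, $L=h^{-1}f(Z_h^* )$ and $\mathfrak{g}_h=C^{-1}L\subset U_h(\mathfrak{g})$. For $x\in L$ one has $\Delta_h(x)=x\otimes C+v\otimes x'$ with $v\in U_h(\mathfrak{g})$, $x'\in L$ (summation implicit). For $x,y\in L$ put $\sigma_h'(x\otimes y)=v_{(1)}y\gamma(v_{(2)})\otimes x'$ and $[x,y]_h'=x_{(1)}y\gamma(x_{(2)})$, and define on $\mathfrak{g}_h$ $$\sigma_h(C^{-1}x\otimes C^{-1}y)=(C^{-1}\otimes C^{-1})\sigma'_h(x\otimes y),\qquad [C^{-1}x,C^{-1}y]_h=C^{-1}[x,y]'_h .$$ At $h=0$, $\mathfrak{g}_h$, $\sigma_h$, $[\cdot,\cdot]_h$ reduce to $\mathfrak{g}$, the flip, and the Lie bracket. $T(\mathfrak{g}_h)=\bigoplus_k\mathfrak{g}_h^{\otimes k}$ is the tensor algebra over $\mathbb{C}[[h]]$ (direct sum not completed). Double quantization of the Lie bracket on $S\mathfrak{g}$: an algebra over $\mathbb{C}[[h]][t]$ with a $U_h(\mathfrak{g})$-action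 for which the multiplication is invariant ($x\,m(a\otimes b)=m(\Delta_h(x)(a\otimes b))$), which is a free $\mathbb{C}[[h]][t]$-module, equals $S\mathfrak{g}$ at $t=h=0$, and at $h=0$ is the standard $U(\mathfrak{g})$-invariant quantization $(S\mathfrak{g})_t=T(\mathfrak{g})[t]/(x\otimes y-y\otimes x-t[x,y])$ of the Lie (linear) Poisson bracket on $\mathfrak{g}^*$. *)

(* Defs.v *)
From HB Require Import structures.
From mathcomp Require Import all_boot all_order all_algebra.
From mathcomp Require Import boolp classical_sets reals.
From mathcomp Require Import complex monalg.

Set Implicit Arguments.
Unset Strict Implicit.
Unset Printing Implicit Defensive.

Import GRing.Theory.
Local Open Scope quotient_scope.
Local Open Scope ring_scope.

(* All the algebras below carry an augmentation killing their defining
   relations; this is what makes the quotients nontrivial rings. *)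
HB.mixin Record hasAug (k : comNzRingType) A of GRing.Algebra k A := {
  aug : A -> k;
  aug_linear : forall c x y, aug (c *: x + y) = c * aug x + aug y;
  aug1 : aug 1 = 1;
  augM : forall x y, aug (x * y) = aug x * aug y
}.

#[short(type="augAlgType")]
HB.structure Definition AugAlgebra (k : comNzRingType) :=
  {A of GRing.Algebra k A & hasAug k A}.

Section AugTheory.
Variables (k : comNzRingType) (A : augAlgType k).

Lemma augD (x y : A) : aug (x + y) = aug x + aug y.
Proof. by rewrite -[x in LHS]scale1r aug_linear mul1r. Qed.

Lemma aug0 : aug (0 : A) = 0.
Proof. by apply: (addrI (aug (0 : A))); rewrite -augD !addr0. Qed.

Lemma augZ c (x : A) : aug (c *: x) = c * aug x.
Proof. by rewrite -[c *: x]addr0 aug_linear aug0 addr0. Qed.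

Lemma augN (x : A) : aug (- x) = - aug x.
Proof. by rewrite -scaleN1r augZ mulN1r. Qed.

Lemma augB (x y : A) : aug (x - y) = aug x - aug y.
Proof. by rewrite augD augN. Qed.

Lemma aug_sum I (r : seq I) (F : I -> A) :
  aug (\sum_(i <- r) F i) = \sum_(i <- r) aug (F i).
Proof. exact: (big_morph _ augD aug0). Qed.

End AugTheory.

Inductive ideal (A : nzRingType) (S : A -> Prop) : A -> Prop :=
| Ideal0 : ideal S 0
| IdealD a s b x : S s -> ideal S x -> ideal S (a * s * b + x).

Section IdealTheory.
Variables (A : nzRingType) (S : A -> Prop).

Lemma ideal_add x y : ideal S x -> ideal S y -> ideal S (x + y).
Proof.
elim=> [|a s b z Ss _ IH] Iy; first by rewrite add0r.
by rewrite -addrA; apply: IdealD => //; apply: IH.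
Qed.

Lemma ideal_mull c x : ideal S x -> ideal S (c * x).
Proof.
elim=> [|a s b z Ss _ IH]; first by rewrite mulr0; apply: Ideal0.
by rewrite mulrDr !mulrA; apply: IdealD.
Qed.

Lemma ideal_mulr c x : ideal S x -> ideal S (x * c).
Proof.
elim=> [|a s b z Ss _ IH]; first by rewrite mul0r; apply: Ideal0.
by rewrite mulrDl -!mulrA mulrA; apply: IdealD.
Qed.

Lemma ideal_opp x : ideal S x -> ideal S (- x).
Proof. by rewrite -mulN1r; apply: ideal_mull. Qed.

Lemma ideal_gen s : S s -> ideal S s.
Proof.
by move=> Ss; rewrite -[s]mul1r -[1 * s]mulr1 -[_ * 1]addr0;
   apply: IdealD => //; apply: Ideal0.
Qed.

Definition ideal_eq : rel A := fun x y => `[< ideal S (x - y) >].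

Lemma ideal_eq_refl : reflexive ideal_eq.
Proof. by move=> x; apply/asboolP; rewrite subrr; apply: Ideal0. Qed.

Lemma ideal_eq_sym : symmetric ideal_eq.
Proof.
by move=> x y; apply/asboolP/asboolP => /ideal_opp; rewrite opprB.
Qed.

Lemma ideal_eq_trans : transitive ideal_eq.
Proof.
move=> y x z /asboolP Ixy /asboolP Iyz; apply/asboolP.
by rewrite -(subrKA y); apply: ideal_add.
Qed.

Canonical ideal_equiv :=
  EquivRel ideal_eq ideal_eq_refl ideal_eq_sym ideal_eq_trans.

End IdealTheory.

Section Quotient.
Variables (k : comNzRingType) (A : augAlgType k) (S : A -> Prop).
Hypothesis augS : forall s, S s -> aug s = 0.

Definition quot of (forall s, S s -> aug s = 0) := {eq_quot (ideal_equiv S)}.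
Local Notation Q := (quot augS).

HB.instance Definition _ := Choice.on Q.
HB.instance Definition _ := EqQuotient.on Q.

(* The operations are locked to keep conversion tractable. *)
Fact qpi_key : unit. Proof. exact: tt. Qed.
Definition qpi : A -> Q := locked_with qpi_key (fun x => \pi x).

Lemma qpiE x : qpi x = \pi x. Proof. by rewrite /qpi unlock. Qed.

Lemma qpiP x y : qpi x = qpi y <-> ideal S (x - y).
Proof.
rewrite !qpiE; split=> [|Ixy]; first by move/eqmodP/asboolP.
by apply/eqmodP/asboolP.
Qed.

Lemma qreprK (x : Q) : qpi (repr x) = x.
Proof. by rewrite qpiE reprK. Qed.

Lemma qind (P : Q -> Prop) : (forall x, P (qpi x)) -> forall x, P x.
Proof. by move=> H x; rewrite -(qreprK x). Qed.

Lemma qrepr x : ideal S (repr (qpi x) - x).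
Proof. by apply/qpiP; rewrite qreprK. Qed.

Fact qadd_key : unit. Proof. exact: tt. Qed.
Definition qadd : Q -> Q -> Q :=
  locked_with qadd_key (fun x y => qpi (repr x + repr y)).
Fact qopp_key : unit. Proof. exact: tt. Qed.
Definition qopp : Q -> Q := locked_with qopp_key (fun x => qpi (- repr x)).
Fact qmul_key : unit. Proof. exact: tt. Qed.
Definition qmul : Q -> Q -> Q :=
  locked_with qmul_key (fun x y => qpi (repr x * repr y)).
Fact qscale_key : unit. Proof. exact: tt. Qed.
Definition qscale : k -> Q -> Q :=
  locked_with qscale_key (fun c x => qpi (c *: repr x)).

Lemma qaddE x y : qadd (qpi x) (qpi y) = qpi (x + y).
Proof.
by rewrite /qadd unlock; apply/qpiP; rewrite opprD addrACA; apply: ideal_add; apply: qrepr.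
Qed.

Lemma qoppE x : qopp (qpi x) = qpi (- x).
Proof. by rewrite /qopp unlock; apply/qpiP; rewrite -opprD; apply/ideal_opp/qrepr. Qed.

Lemma qmulE x y : qmul (qpi x) (qpi y) = qpi (x * y).
Proof.
rewrite /qmul unlock; apply/qpiP; rewrite -(subrKA (x * repr (qpi y))) -mulrBl -mulrBr.
by apply: ideal_add; [apply/ideal_mulr/qrepr | apply/ideal_mull/qrepr].
Qed.

Lemma qscaleE c x : qscale c (qpi x) = qpi (c *: x).
Proof.
by rewrite /qscale unlock; apply/qpiP; rewrite -scalerBr -mulr_algl; apply/ideal_mull/qrepr.
Qed.

Lemma qaddA : associative qadd.
Proof. by do 3!elim/qind=> ?; rewrite !qaddE addrA. Qed.
Lemma qaddC : commutative qadd.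
Proof. by do 2!elim/qind=> ?; rewrite !qaddE addrC. Qed.
Lemma qadd0 : left_id (qpi 0) qadd.
Proof. by elim/qind=> ?; rewrite qaddE add0r. Qed.
Lemma qaddN : left_inverse (qpi 0) qopp qadd.
Proof. by elim/qind=> ?; rewrite qoppE qaddE addNr. Qed.

HB.instance Definition _ := GRing.isZmodule.Build Q qaddA qaddC qadd0 qaddN.

Lemma qpiD x y : qpi (x + y) = qpi x + qpi y. Proof. by rewrite -qaddE. Qed.

Lemma qmulA : associative qmul.
Proof. by do 3!elim/qind=> ?; rewrite !qmulE mulrA. Qed.
Lemma qmul1l : left_id (qpi 1) qmul.
Proof. by elim/qind=> ?; rewrite qmulE mul1r. Qed.
Lemma qmul1r : right_id (qpi 1) qmul.
Proof. by elim/qind=> ?; rewrite qmulE mulr1. Qed.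
Lemma qmulDl : left_distributive qmul +%R.
Proof.
elim/qind=> x; elim/qind=> y; elim/qind=> z.
by rewrite -(qpiD x y) !qmulE -qpiD mulrDl.
Qed.
Lemma qmulDr : right_distributive qmul +%R.
Proof.
elim/qind=> x; elim/qind=> y; elim/qind=> z.
by rewrite -(qpiD y z) !qmulE -qpiD mulrDr.
Qed.

Lemma ideal_aug x : ideal S x -> aug x = 0.
Proof.
elim=> [|a s b z Ss _ IH]; first exact: aug0.
by rewrite augD !augM (augS Ss) mulr0 mul0r IH addr0.
Qed.

Lemma qone_neq0 : qpi 1 != 0.
Proof.
apply/eqP=> /qpiP/ideal_aug/eqP; rewrite augB aug1 aug0 subr0.
by rewrite oner_eq0.
Qed.

HB.instance Definition _ := GRing.Zmodule_isNzRing.Build Q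
  qmulA qmul1l qmul1r qmulDl qmulDr qone_neq0.

Lemma qpiM x y : qpi (x * y) = qpi x * qpi y. Proof. by rewrite -qmulE. Qed.

Lemma qscaleA a b v : qscale a (qscale b v) = qscale (a * b) v.
Proof. by elim/qind: v => v; rewrite !qscaleE scalerA. Qed.
Lemma qscale1 : left_id 1 qscale.
Proof. by elim/qind=> v; rewrite qscaleE scale1r. Qed.
Lemma qscaleDr : right_distributive qscale +%R.
Proof.
move=> c; elim/qind=> x; elim/qind=> y.
by rewrite -(qpiD x y) !qscaleE -qpiD scalerDr.
Qed.
Lemma qscaleDl v : {morph qscale^~ v : a b / a + b}.
Proof. by elim/qind: v => v a b; rewrite !qscaleE -qpiD scalerDl. Qed.

HB.instance Definition _ := GRing.Zmodule_isLmodule.Build k Q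
  qscaleA qscale1 qscaleDr qscaleDl.

Lemma qpiZ c x : qpi (c *: x) = c *: qpi x. Proof. by rewrite -qscaleE. Qed.

Lemma qscalerAl (c : k) (x y : Q) : c *: (x * y) = (c *: x) * y.
Proof.
by elim/qind: x => x; elim/qind: y => y;
   rewrite -(qpiM x y) -(qpiZ c x) -qpiZ -qpiM scalerAl.
Qed.

HB.instance Definition _ := GRing.Lmodule_isLalgebra.Build k Q qscalerAl.

Lemma qscalerAr (c : k) (x y : Q) : c *: (x * y) = x * (c *: y).
Proof.
by elim/qind: x => x; elim/qind: y => y;
   rewrite -(qpiM x y) -(qpiZ c y) -qpiZ -qpiM scalerAr.
Qed.

HB.instance Definition _ := GRing.Lalgebra_isAlgebra.Build k Q qscalerAr.

Definition qaug (x : Q) : k := aug (repr x).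

Lemma qaugE x : qaug (qpi x) = aug x.
Proof. by apply/eqP; rewrite -subr_eq0 -augB ideal_aug //; apply: qrepr. Qed.

Lemma qaug_linear c x y : qaug (c *: x + y) = c * qaug x + qaug y.
Proof.
by elim/qind: x => x; elim/qind: y => y;
   rewrite -(qpiZ c x) -qpiD !qaugE aug_linear.
Qed.
Lemma qaug1 : qaug 1 = 1. Proof. by rewrite qaugE aug1. Qed.
Lemma qaugM x y : qaug (x * y) = qaug x * qaug y.
Proof.
by elim/qind: x => x; elim/qind: y => y; rewrite -qpiM !qaugE augM.
Qed.

HB.instance Definition _ := hasAug.Build k Q qaug_linear qaug1 qaugM.

End Quotient.

Section TensorAlgebra.
Variables (k : comNzRingType) (M : lmodType k).

Definition freealg := {malg k[{fmonom M}]}.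

HB.instance Definition _ := GRing.Lalgebra.on freealg.

Definition fvar (x : M) : freealg := << fmu x >>.

Lemma freealg_scalerAr (c : k) (x y : freealg) : c *: (x * y) = x * (c *: y).
Proof.
rewrite -[c *: y]mul_malgC mulrA scalerAl; congr (_ * _).
rewrite [x in RHS]monalgE mulr_suml [x in LHS]monalgE scaler_sumr.
apply: eq_bigr => m _; rewrite malgM_def fgmulUU mulm1.
by rewrite -mul_malgC malgM_def fgmulUU mul1m mulrC.
Qed.

HB.instance Definition _ := GRing.Lalgebra_isAlgebra.Build k freealg
  freealg_scalerAr.

Definition freealg_aug (x : freealg) : k := mcoeff (@mone {fmonom M}) x.

Lemma freealg_aug_linear c x y :
  freealg_aug (c *: x + y) = c * freealg_aug x + freealg_aug y.
Proof. by rewrite /freealg_aug mcoeffD mcoeffZ. Qed.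
Lemma freealg_aug1 : freealg_aug 1 = 1.
Proof. exact: rmorph1. Qed.
Lemma freealg_augM x y : freealg_aug (x * y) = freealg_aug x * freealg_aug y.
Proof. exact: rmorphM. Qed.

HB.instance Definition _ := hasAug.Build k freealg
  freealg_aug_linear freealg_aug1 freealg_augM.

(* The tensor algebra is the free algebra on the set M modulo the linear
   relations of M. *)
Definition tensrel (z : freealg) : Prop :=
  exists c x y, z = fvar (c *: x + y) - (c *: fvar x + fvar y).

Lemma aug_fvar x : aug (fvar x) = 0.
Proof. by rewrite /aug /= /freealg_aug mcoeffU1 fmuE /mone /= fmoneE. Qed.

Lemma tensrel_aug z : tensrel z -> aug z = 0.
Proof.
by case=> c [x] [y] ->; rewrite augB augD augZ !aug_fvar mulr0 addr0 subr0.
Qed.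

Local Notation tensalg := (quot tensrel_aug).

Fact tensgen_key : unit. Proof. exact: tt. Qed.
Definition tensgen : M -> tensalg :=
  locked_with tensgen_key (fun x => qpi tensrel_aug (fvar x)).

Lemma tensgen_aug x : aug (tensgen x) = 0.
Proof. by rewrite /tensgen unlock /aug /= qaugE aug_fvar. Qed.

(* The algebra morphism on the tensor algebra extending f; it is computed on a
   representative, hence meaningful only for linear f. *)
Definition tensalg_lift (B : algType k) (f : M -> B) (z : tensalg) : B :=
  mmap (fun c => c%:A) (fun w : {fmonom M} => \prod_(x <- w) f x) (repr z).

End TensorAlgebra.

Notation tensalg M := (quot (@tensrel_aug _ M)).

HB.instance Definition _ (k : comNzRingType) (A : augAlgType k) :=
  GRing.isNmodMorphism.Build A k aug (conj (aug0 A) (@augD k A)).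
HB.instance Definition _ (k : comNzRingType) (A : augAlgType k) :=
  GRing.isMonoidMorphism.Build A k aug (conj (@aug1 k A) (@augM k A)).

Section PolyAlg.
Variables (k : comNzRingType) (A : augAlgType k).

Definition polyalg := {poly A}.
HB.instance Definition _ := GRing.NzRing.on polyalg.

Definition polyscale (p : {poly k}) (q : polyalg) : polyalg :=
  map_poly (in_alg A) p * q.

Lemma polyscaleA p q x : polyscale p (polyscale q x) = polyscale (p * q) x.
Proof. by rewrite /polyscale mulrA rmorphM. Qed.
Lemma polyscale1 : left_id 1 polyscale.
Proof. by move=> x; rewrite /polyscale rmorph1 mul1r. Qed.
Lemma polyscaleDr : right_distributive polyscale +%R.
Proof. by move=> p x y; rewrite /polyscale mulrDr. Qed.
Lemma polyscaleDl x : {morph polyscale^~ x : p q / p + q}.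
Proof. by move=> p q; rewrite /polyscale rmorphD mulrDl. Qed.

HB.instance Definition _ := GRing.Zmodule_isLmodule.Build {poly k} polyalg
  polyscaleA polyscale1 polyscaleDr polyscaleDl.

Lemma polyscaleAl (p : {poly k}) (x y : polyalg) : p *: (x * y) = (p *: x) * y.
Proof. exact: mulrA. Qed.

HB.instance Definition _ :=
  GRing.Lmodule_isLalgebra.Build {poly k} polyalg polyscaleAl.

Lemma polyalg_central (p : {poly k}) (x : {poly A}) :
  map_poly (in_alg A) p * x = x * map_poly (in_alg A) p.
Proof.
apply/polyP => i; rewrite coefM coefMr; apply: eq_bigr => j _.
by rewrite coef_map /= -[RHS]scalerAr mulr1 -scalerAl mul1r.
Qed.

Lemma polyscaleAr (p : {poly k}) (x y : polyalg) : p *: (x * y) = x * (p *: y).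
Proof.
by rewrite /GRing.scale /= /polyscale mulrA polyalg_central -mulrA.
Qed.

HB.instance Definition _ :=
  GRing.Lalgebra_isAlgebra.Build {poly k} polyalg polyscaleAr.

Fact polyaug_key : unit. Proof. exact: tt. Qed.
Definition polyaug : polyalg -> {poly k} :=
  locked_with polyaug_key (map_poly aug).

Lemma polyaugE x : polyaug x = map_poly aug x.
Proof. by rewrite /polyaug unlock. Qed.

Lemma polyaug_linear p x y : polyaug (p *: x + y) = p * polyaug x + polyaug y.
Proof.
rewrite !polyaugE rmorphD rmorphM /=; congr (_ * _ + _).
by apply/polyP => i; rewrite !coef_map /= augZ aug1 mulr1.
Qed.
Lemma polyaug1 : polyaug 1 = 1. Proof. by rewrite polyaugE rmorph1. Qed.
Lemma polyaugM x y : polyaug (x * y) = polyaug x * polyaug y.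
Proof. by rewrite !polyaugE rmorphM. Qed.

HB.instance Definition _ := hasAug.Build {poly k} polyalg
  polyaug_linear polyaug1 polyaugM.

Lemma polyaugC (a : A) : aug (a%:P : polyalg) = (aug a)%:P.
Proof. by rewrite [LHS]polyaugE map_polyC. Qed.

End PolyAlg.

Section Tensor.
Variables (k : comNzRingType) (A B : augAlgType k).

(* A list of pairs [:: (a_1, b_1); (a_2, b_2); ...] stands for the sum of the
   a_i (x) b_i. *)
Inductive tens_cong : seq (A * B) -> seq (A * B) -> Prop :=
| TensRefl s : tens_cong s s
| TensSym s1 s2 : tens_cong s1 s2 -> tens_cong s2 s1
| TensTrans s1 s2 s3 : tens_cong s1 s2 -> tens_cong s2 s3 -> tens_cong s1 s3
| TensCat s1 s2 s3 s4 :
    tens_cong s1 s2 -> tens_cong s3 s4 -> tens_cong (s1 ++ s3) (s2 ++ s4)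
| TensC s1 s2 : tens_cong (s1 ++ s2) (s2 ++ s1)
| Tens0 b : tens_cong [:: (0, b)] [::]
| TensDl a1 a2 b : tens_cong [:: (a1 + a2, b)] [:: (a1, b); (a2, b)]
| TensDr a b1 b2 : tens_cong [:: (a, b1 + b2)] [:: (a, b1); (a, b2)]
| TensZ c a b : tens_cong [:: (c *: a, b)] [:: (a, c *: b)].

Definition tens_eq : rel (seq (A * B)) := fun s1 s2 => `[< tens_cong s1 s2 >].

Lemma tens_eq_refl : reflexive tens_eq.
Proof. by move=> s; apply/asboolP; apply: TensRefl. Qed.
Lemma tens_eq_sym : symmetric tens_eq.
Proof. by move=> s1 s2; apply/asboolP/asboolP; apply: TensSym. Qed.
Lemma tens_eq_trans : transitive tens_eq.
Proof.
move=> s2 s1 s3 /asboolP h12 /asboolP h23; apply/asboolP.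
exact: TensTrans h12 h23.
Qed.

Canonical tens_equiv := EquivRel tens_eq tens_eq_refl tens_eq_sym tens_eq_trans.

Definition tens := {eq_quot tens_equiv}.
HB.instance Definition _ := Choice.on tens.
HB.instance Definition _ := EqQuotient.on tens.

Fact tsum_key : unit. Proof. exact: tt. Qed.
Definition tsum : seq (A * B) -> tens := locked_with tsum_key (fun s => \pi s).

Lemma tsum_pi s : tsum s = \pi s. Proof. by rewrite /tsum unlock. Qed.

Definition tpure (a : A) (b : B) : tens := tsum [:: (a, b)].

(* The linear map a (x) b |-> f a b; it is computed on a representative, hence
   meaningful only for bilinear f. *)
Definition tlift (W : zmodType) (f : A -> B -> W) (x : tens) : W :=
  \sum_(p <- repr x) f p.1 p.2.

Lemma tsumP s1 s2 : tsum s1 = tsum s2 <-> tens_cong s1 s2.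
Proof.
rewrite !tsum_pi; split=> [|h]; first by move/eqmodP/asboolP.
by apply/eqmodP/asboolP.
Qed.

Lemma treprK x : tsum (repr x) = x.
Proof. by rewrite tsum_pi reprK. Qed.

Lemma trepr s : tens_cong (repr (tsum s)) s.
Proof. by apply/tsumP; rewrite treprK. Qed.

Lemma tens_ind (P : tens -> Prop) : (forall s, P (tsum s)) -> forall x, P x.
Proof. by move=> H x; rewrite -(treprK x). Qed.

Fact tadd_key : unit. Proof. exact: tt. Qed.
Definition tadd : tens -> tens -> tens :=
  locked_with tadd_key (fun x y => tsum (repr x ++ repr y)).
Fact tscale_key : unit. Proof. exact: tt. Qed.
Definition tscale : k -> tens -> tens :=
  locked_with tscale_key (fun c x => tsum [seq (c *: p.1, p.2) | p <- repr x]).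
Definition topp (x : tens) : tens := tscale (-1) x.

Lemma taddE s1 s2 : tadd (tsum s1) (tsum s2) = tsum (s1 ++ s2).
Proof.
by rewrite /tadd unlock; apply/tsumP; apply: TensCat; apply: trepr.
Qed.

Lemma tscale_cong c s1 s2 : tens_cong s1 s2 ->
  tens_cong [seq (c *: p.1, p.2) | p <- s1] [seq (c *: p.1, p.2) | p <- s2].
Proof.
elim=> {s1 s2} /=.
- by move=> s; apply: TensRefl.
- by move=> s1 s2 _ IH; apply: TensSym.
- by move=> s1 s2 s3 _ IH1 _ IH2; apply: TensTrans IH1 IH2.
- by move=> s1 s2 s3 s4 _ IH1 _ IH2; rewrite !map_cat; apply: TensCat.
- by move=> s1 s2; rewrite !map_cat; apply: TensC.
- by move=> b; rewrite scaler0; apply: Tens0.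
- by move=> a1 a2 b; rewrite scalerDr; apply: TensDl.
- by move=> a b1 b2; apply: TensDr.
- by move=> d a b; rewrite scalerA mulrC -scalerA; apply: TensZ.
Qed.

Lemma tscaleE c s : tscale c (tsum s) = tsum [seq (c *: p.1, p.2) | p <- s].
Proof. by rewrite /tscale unlock; apply/tsumP/tscale_cong/trepr. Qed.

Lemma taddA : associative tadd.
Proof. by do 3!elim/tens_ind=> ?; rewrite !taddE catA. Qed.
Lemma taddC : commutative tadd.
Proof. by do 2!elim/tens_ind=> ?; rewrite !taddE; apply/tsumP/TensC. Qed.
Lemma tadd0 : left_id (tsum [::]) tadd.
Proof. by elim/tens_ind=> s; rewrite taddE. Qed.

Lemma tscaleDl x : {morph tscale^~ x : c d / c + d >-> tadd c d}.
Proof.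
move=> c d; elim/tens_ind: x => s; rewrite !tscaleE taddE; apply/tsumP.
elim: s => [|[a b] s IH] /=; first exact: TensRefl.
rewrite scalerDl -cat1s -[_ :: (_ ++ _)]cat1s.
apply: (TensTrans (TensCat (TensDl _ _ _) IH)) => /=.
apply: (@TensCat [:: _] [:: _] _ _ (TensRefl _)).
set s1 := map _ s; set s2 := map _ s.
rewrite -[_ :: s2]cat1s -[_ :: (s1 ++ s2)]cat1s !catA.
by apply: TensCat; [apply: TensC | apply: TensRefl].
Qed.

Lemma tscale1 : left_id 1 tscale.
Proof.
elim/tens_ind=> s; rewrite tscaleE; congr tsum.
by elim: s => [|[a b] s IH] //=; rewrite scale1r IH.
Qed.

Lemma tscale0 x : tscale 0 x = tsum [::].
Proof.
elim/tens_ind: x => s; rewrite tscaleE; apply/tsumP.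
elim: s => [|[a b] s IH] /=; first exact: TensRefl.
by rewrite scale0r -cat1s -[[::]]cat0s; apply: TensCat => //; apply: Tens0.
Qed.

Lemma taddN : left_inverse (tsum [::]) topp tadd.
Proof.
move=> x; rewrite /topp -[X in tadd _ X]tscale1.
by rewrite -tscaleDl addNr tscale0.
Qed.

HB.instance Definition _ := GRing.isZmodule.Build tens taddA taddC tadd0 taddN.

Lemma tsum_cat s1 s2 : tsum (s1 ++ s2) = tsum s1 + tsum s2.
Proof. by rewrite -taddE. Qed.

Lemma tscaleA c d x : tscale c (tscale d x) = tscale (c * d) x.
Proof.
elim/tens_ind: x => s; rewrite !tscaleE -map_comp; congr tsum.
by apply: eq_map => -[a b] /=; rewrite scalerA.
Qed.
Lemma tscaleDr : right_distributive tscale +%R.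
Proof.
move=> c; elim/tens_ind=> s1; elim/tens_ind=> s2.
by rewrite -tsum_cat !tscaleE map_cat tsum_cat.
Qed.

HB.instance Definition _ := GRing.Zmodule_isLmodule.Build k tens
  tscaleA tscale1 tscaleDr tscaleDl.

Lemma tpureDl a1 a2 b : tpure (a1 + a2) b = tpure a1 b + tpure a2 b.
Proof. by rewrite -tsum_cat; apply/tsumP/TensDl. Qed.
Lemma tpureDr a b1 b2 : tpure a (b1 + b2) = tpure a b1 + tpure a b2.
Proof. by rewrite -tsum_cat; apply/tsumP/TensDr. Qed.
Lemma tpureZl c a b : tpure (c *: a) b = c *: tpure a b.
Proof. by rewrite [RHS]tscaleE. Qed.
Lemma tpureZr c a b : tpure a (c *: b) = c *: tpure a b.
Proof. by rewrite -tpureZl; apply/tsumP/TensSym/TensZ. Qed.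

Lemma tsumE s : tsum s = \sum_(p <- s) tpure p.1 p.2.
Proof.
elim: s => [|[a b] s IH]; first by rewrite big_nil.
by rewrite big_cons -IH -tsum_cat.
Qed.

Definition tbilin (W : lmodType k) (f : A -> B -> W) : Prop :=
  (forall c a1 a2 b, f (c *: a1 + a2) b = c *: f a1 b + f a2 b) /\
  (forall c a b1 b2, f a (c *: b1 + b2) = c *: f a b1 + f a b2).

Section Lift.
Variables (W : lmodType k) (f : A -> B -> W).
Hypothesis bf : tbilin f.

Lemma tbilinDl a1 a2 b : f (a1 + a2) b = f a1 b + f a2 b.
Proof. by have := bf.1 1 a1 a2 b; rewrite !scale1r. Qed.
Lemma tbilinDr a b1 b2 : f a (b1 + b2) = f a b1 + f a b2.
Proof. by have := bf.2 1 a b1 b2; rewrite !scale1r. Qed.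
Lemma tbilin0l b : f 0 b = 0.
Proof. by apply: (addrI (f 0 b)); rewrite -tbilinDl !addr0. Qed.
Lemma tbilin0r a : f a 0 = 0.
Proof. by apply: (addrI (f a 0)); rewrite -tbilinDr !addr0. Qed.
Lemma tbilinZl c a b : f (c *: a) b = c *: f a b.
Proof. by have := bf.1 c a 0 b; rewrite tbilin0l !addr0. Qed.
Lemma tbilinZr c a b : f a (c *: b) = c *: f a b.
Proof. by have := bf.2 c a b 0; rewrite tbilin0r !addr0. Qed.

Lemma tlift_cong s1 s2 : tens_cong s1 s2 ->
  \sum_(p <- s1) f p.1 p.2 = \sum_(p <- s2) f p.1 p.2.
Proof.
elim=> {s1 s2} //=.
- by move=> s1 s2 s3 _ -> _ ->.
- by move=> s1 s2 s3 s4 _ IH1 _ IH2; rewrite !big_cat /= IH1 IH2.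
- by move=> s1 s2; rewrite !big_cat /= addrC.
- by move=> b; rewrite big_seq1 big_nil /= tbilin0l.
- by move=> a1 a2 b; rewrite !big_cons !big_nil /= !addr0 tbilinDl.
- by move=> a b1 b2; rewrite !big_cons !big_nil /= !addr0 tbilinDr.
- by move=> c a b; rewrite !big_seq1 /= tbilinZl tbilinZr.
Qed.

Lemma tlift_sum s : tlift f (tsum s) = \sum_(p <- s) f p.1 p.2.
Proof. exact/tlift_cong/trepr. Qed.

Lemma tlift_pure a b : tlift f (tpure a b) = f a b.
Proof. by rewrite tlift_sum big_seq1. Qed.

Lemma tlift_linear c x y : tlift f (c *: x + y) = c *: tlift f x + tlift f y.
Proof.
elim/tens_ind: x => s; elim/tens_ind: y => t.
rewrite [c *: _]tscaleE -tsum_cat !tlift_sum big_cat big_map scaler_sumr.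
by congr (_ + _); apply: eq_bigr => -[a b] _ /=; rewrite tbilinZl.
Qed.

End Lift.

Fact tmul_key : unit. Proof. exact: tt. Qed.
Definition tmul : tens -> tens -> tens := locked_with tmul_key
  (fun x y => tlift (fun a b => tlift (fun a' b' => tpure (a * a') (b * b')) y) x).

Lemma tmulE x y :
  tmul x y = tlift (fun a b => tlift (fun a' b' => tpure (a * a') (b * b')) y) x.
Proof. by rewrite /tmul unlock. Qed.

Lemma tmul_bilin a b : tbilin (fun a' b' => tpure (a * a') (b * b')).
Proof.
by split=> c *; rewrite mulrDr -scalerAr ?tpureDl ?tpureZl ?tpureDr ?tpureZr.
Qed.

Lemma tmul_bilin2 y :
  tbilin (fun a b => tlift (fun a' b' => tpure (a * a') (b * b')) y).
Proof.
by split=> c *; elim/tens_ind: y => s;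
  rewrite !(tlift_sum (tmul_bilin _ _)) scaler_sumr -big_split; apply: eq_bigr;
  move=> -[a' b'] _ /=; rewrite mulrDl -scalerAl ?tpureDl ?tpureZl ?tpureDr ?tpureZr.
Qed.

Lemma tmul_linl c x x' y : tmul (c *: x + x') y = c *: tmul x y + tmul x' y.
Proof. by rewrite !tmulE; exact: tlift_linear (tmul_bilin2 y) _ _ _. Qed.

Lemma tmul_linr c x y y' : tmul x (c *: y + y') = c *: tmul x y + tmul x y'.
Proof.
elim/tens_ind: x => s; rewrite !tmulE !(tlift_sum (tmul_bilin2 _)).
rewrite scaler_sumr -big_split; apply: eq_bigr => -[a b] _ /=.
exact: tlift_linear (tmul_bilin a b) _ _ _.
Qed.

Lemma tmul_pure a b a' b' :
  tmul (tpure a b) (tpure a' b') = tpure (a * a') (b * b').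
Proof.
by rewrite tmulE (tlift_pure (tmul_bilin2 _)) (tlift_pure (tmul_bilin _ _)).
Qed.

Lemma tmulDl : left_distributive tmul +%R.
Proof. by move=> x y z; have := tmul_linl 1 x y z; rewrite !scale1r. Qed.
Lemma tmulDr : right_distributive tmul +%R.
Proof. by move=> x y z; have := tmul_linr 1 x y z; rewrite !scale1r. Qed.

Lemma tens_pure_ind (P : tens -> Prop) : (forall a b, P (tpure a b)) ->
  P 0 -> (forall x y, P x -> P y -> P (x + y)) -> forall x, P x.
Proof.
move=> Hp H0 HD; elim/tens_ind=> s; rewrite tsumE.
by elim/big_rec: _ => // -[a b] x _ Px; apply: HD.
Qed.

Lemma tmul0l x : tmul 0 x = 0.
Proof. by apply: (addrI (tmul 0 x)); rewrite -tmulDl !addr0. Qed.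
Lemma tmul0r x : tmul x 0 = 0.
Proof. by apply: (addrI (tmul x 0)); rewrite -tmulDr !addr0. Qed.

Lemma tmulA : associative tmul.
Proof.
move=> x y z.
elim/tens_pure_ind: x => [a1 b1||x x' IH IH']; last 2 first.
- by rewrite !tmul0l.
- by rewrite !tmulDl IH IH'.
elim/tens_pure_ind: y => [a2 b2||x x' IH IH']; last 2 first.
- by rewrite tmul0l !tmul0r tmul0l.
- by rewrite !(tmulDl, tmulDr) IH IH'.
elim/tens_pure_ind: z => [a3 b3||x x' IH IH']; last 2 first.
- by rewrite !tmul0r.
- by rewrite !tmulDr IH IH'.
by rewrite !tmul_pure !mulrA.
Qed.

Lemma tmul1l : left_id (tpure 1 1) tmul.
Proof.
apply: tens_pure_ind => [a b||x y IH IH'].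
- by rewrite tmul_pure !mul1r.
- by rewrite tmul0r.
- by rewrite tmulDr IH IH'.
Qed.

Lemma tmul1r : right_id (tpure 1 1) tmul.
Proof.
apply: tens_pure_ind => [a b||x y IH IH'].
- by rewrite tmul_pure !mulr1.
- by rewrite tmul0l.
- by rewrite tmulDl IH IH'.
Qed.

Definition taug (x : tens) : k := tlift (fun a b => aug a * aug b : k^o) x.

Lemma taug_bilin : tbilin (fun a b => aug a * aug b : k^o).
Proof.
split=> c a a' b; rewrite aug_linear /GRing.scale /=.
  by rewrite mulrDl mulrA.
by rewrite mulrDr mulrCA.
Qed.

Lemma taug_linear c x y : taug (c *: x + y) = c * taug x + taug y.
Proof. exact: tlift_linear taug_bilin _ _ _. Qed.

Lemma taug_pure a b : taug (tpure a b) = aug a * aug b.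
Proof. exact: tlift_pure taug_bilin _ _. Qed.

Lemma taugD x y : taug (x + y) = taug x + taug y.
Proof. by have := taug_linear 1 x y; rewrite scale1r mul1r. Qed.
Lemma taug0 : taug 0 = 0.
Proof. by apply: (addrI (taug 0)); rewrite -taugD !addr0. Qed.

Lemma tone_neq0 : tpure 1 1 != 0.
Proof.
apply/eqP=> /(congr1 taug)/eqP.
by rewrite taug_pure !aug1 mulr1 taug0 oner_eq0.
Qed.

HB.instance Definition _ := GRing.Zmodule_isNzRing.Build tens
  tmulA tmul1l tmul1r tmulDl tmulDr tone_neq0.

Lemma tscalerAl (c : k) (x y : tens) : c *: (x * y) = (c *: x) * y.
Proof. by have := tmul_linl c x 0 y; rewrite tmul0l !addr0. Qed.

HB.instance Definition _ := GRing.Lmodule_isLalgebra.Build k tens tscalerAl.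

Lemma tscalerAr (c : k) (x y : tens) : c *: (x * y) = x * (c *: y).
Proof. by have := tmul_linr c x y 0; rewrite tmul0r !addr0. Qed.

HB.instance Definition _ := GRing.Lalgebra_isAlgebra.Build k tens tscalerAr.

Lemma taugM (x y : tens) : taug (x * y) = taug x * taug y.
Proof.
elim/tens_pure_ind: x => [a b||x x' IH IH']; last 2 first.
- by rewrite mul0r taug0 mul0r.
- by rewrite mulrDl !taugD IH IH' mulrDl.
elim/tens_pure_ind: y => [a' b'||y y' IH IH']; last 2 first.
- by rewrite mulr0 taug0 mulr0.
- by rewrite mulrDr !taugD IH IH' mulrDr.
by rewrite [X in taug X]tmul_pure !taug_pure !augM mulrACA.
Qed.

Lemma taug1 : taug 1 = 1. Proof. by rewrite taug_pure !aug1 mulr1. Qed.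

HB.instance Definition _ := hasAug.Build k tens taug_linear taug1 taugM.

End Tensor.

(* A[[h]]; when A is a k-algebra this is a k[[h]]-algebra.  The completed
   tensor product of A[[h]] and B[[h]] is (A (x) B)[[h]]. *)
Record series (A : Type) := Series { scoef : nat -> A }.

HB.instance Definition _ (A : Type) := gen_eqMixin (series A).
HB.instance Definition _ (A : Type) := gen_choiceMixin (series A).

Lemma seriesP A (x y : series A) : (forall n, scoef x n = scoef y n) <-> x = y.
Proof.
split=> [|-> //]; case: x y => [f] [g] /= fg.
by congr Series; apply/funext.
Qed.

Definition smap A B (f : A -> B) (x : series A) : series B :=
  Series (fun n => f (scoef x n)).

Section SeriesRing.
Variable A : nzRingType.
Implicit Types x y z : series A.

Definition scst (a : A) : series A := Series (fun n => if n == 0%N then a else 0).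
Definition sadd x y : series A := Series (fun n => scoef x n + scoef y n).
Definition sopp x : series A := Series (fun n => - scoef x n).
Definition smul x y : series A :=
  Series (fun n => \sum_(i < n.+1) scoef x i * scoef y (n - i)).

Lemma saddA : associative sadd.
Proof. by move=> x y z; apply/seriesP => n /=; rewrite addrA. Qed.
Lemma saddC : commutative sadd.
Proof. by move=> x y; apply/seriesP => n /=; rewrite addrC. Qed.
Lemma sadd0 : left_id (scst 0) sadd.
Proof. by move=> x; apply/seriesP => n /=; rewrite if_same add0r. Qed.
Lemma saddN : left_inverse (scst 0) sopp sadd.
Proof. by move=> x; apply/seriesP => n /=; rewrite if_same addNr. Qed.

HB.instance Definition _ :=
  GRing.isZmodule.Build (series A) saddA saddC sadd0 saddN.

Definition strunc n x : {poly A} := \poly_(i < n.+1) scoef x i.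

Lemma coef_strunc n x i : (i <= n)%N -> (strunc n x)`_i = scoef x i.
Proof. by move=> le_in; rewrite coef_poly ltnS le_in. Qed.

Lemma scoefM n i x y : (i <= n)%N ->
  scoef (smul x y) i = (strunc n x * strunc n y)`_i.
Proof.
move=> le_in; rewrite coefM; apply: eq_bigr => j _.
have le_ji : (j <= i)%N by rewrite -ltnS.
rewrite !coef_strunc ?(leq_trans _ le_in) //; exact: leq_subr.
Qed.

Lemma smulA : associative smul.
Proof.
move=> x y z; apply/seriesP => n.
rewrite 2!(scoefM _ _ (leqnn n)) !coefM -/(strunc n z).
transitivity (strunc n x * (strunc n y * strunc n z))`_n.
  rewrite coefM; apply: eq_bigr => i _; congr (_ * _).
  by rewrite coef_strunc ?leq_subr // (scoefM (n := n)) ?leq_subr.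
rewrite mulrA coefM; apply: eq_bigr => i _; congr (_ * _).
by rewrite coef_strunc -1?ltnS // (scoefM (n := n)) // -ltnS.
Qed.

Lemma smul1l : left_id (scst 1) smul.
Proof.
move=> x; apply/seriesP => n /=; rewrite big_ord_recl /= mul1r subn0.
by rewrite big1 ?addr0 // => i _; rewrite mul0r.
Qed.
Lemma smul1r : right_id (scst 1) smul.
Proof.
move=> x; apply/seriesP => n /=; rewrite big_ord_recr /= subnn /= mulr1.
rewrite big1 ?add0r // => i _.
by rewrite subn_eq0 leqNgt ltn_ord /= mulr0.
Qed.
Lemma smulDl : left_distributive smul +%R.
Proof.
move=> x y z; apply/seriesP => n /=; rewrite -big_split.
by apply: eq_bigr => i _; rewrite mulrDl.
Qed.
Lemma smulDr : right_distributive smul +%R.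
Proof.
move=> x y z; apply/seriesP => n /=; rewrite -big_split.
by apply: eq_bigr => i _; rewrite mulrDr.
Qed.
Lemma sone_neq0 : scst 1 != 0.
Proof.
apply/eqP => /(congr1 (fun x => scoef x 0))/eqP.
by rewrite /= oner_eq0.
Qed.

HB.instance Definition _ := GRing.Zmodule_isNzRing.Build (series A)
  smulA smul1l smul1r smulDl smulDr sone_neq0.

End SeriesRing.

Lemma smulC (k : comNzRingType) : commutative (@smul k).
Proof.
by move=> x y; apply/seriesP => n; rewrite !(scoefM _ _ (leqnn n)) mulrC.
Qed.

HB.instance Definition _ (k : comNzRingType) :=
  GRing.PzRing_hasCommutativeMul.Build (series k) (@smulC k).

Section SeriesAlg.
Variables (k : comNzRingType) (A : algType k).

Definition sscale (c : series k) (x : series A) : series A :=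
  Series (fun n => \sum_(i < n.+1) scoef c i *: scoef x (n - i)).

Lemma sscaleE c x : sscale c x = smap (in_alg A) c * x.
Proof.
by apply/seriesP => n /=; apply: eq_bigr => i _; rewrite mulr_algl.
Qed.

Lemma smap_in_algM c d :
  smap (in_alg A) (c * d) = smap (in_alg A) c * smap (in_alg A) d.
Proof.
apply/seriesP => n /=; rewrite scaler_suml; apply: eq_bigr => i _.
by rewrite mulr_algl scalerA.
Qed.

Lemma sscaleA c d x : sscale c (sscale d x) = sscale (c * d) x.
Proof. by rewrite !sscaleE mulrA smap_in_algM. Qed.
Lemma sscale1 : left_id 1 sscale.
Proof.
move=> x; rewrite sscaleE -[RHS]mul1r; congr (_ * _).
by apply/seriesP => -[|n] /=; rewrite ?scale1r ?scale0r.
Qed.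
Lemma sscaleDr : right_distributive sscale +%R.
Proof. by move=> c x y; rewrite !sscaleE mulrDr. Qed.
Lemma sscaleDl x : {morph sscale^~ x : c d / c + d}.
Proof.
move=> c d; rewrite !sscaleE -mulrDl; congr (_ * _).
by apply/seriesP => n /=; rewrite scalerDl.
Qed.

HB.instance Definition _ := GRing.Zmodule_isLmodule.Build (series k) (series A)
  sscaleA sscale1 sscaleDr sscaleDl.

Lemma sscaleAl (c : series k) (x y : series A) : c *: (x * y) = (c *: x) * y.
Proof. by rewrite ![_ *: _]sscaleE mulrA. Qed.

HB.instance Definition _ :=
  GRing.Lmodule_isLalgebra.Build (series k) (series A) sscaleAl.

Lemma sscaleAr (c : series k) (x y : series A) : c *: (x * y) = x * (c *: y).
Proof.
rewrite ![_ *: _]sscaleE !mulrA; congr (_ * _); apply/seriesP => n.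
rewrite !(scoefM _ _ (leqnn n)).
rewrite coefM coefMr; apply: eq_bigr => i _; rewrite !coef_strunc ?leq_subr -1?ltnS //=.
by rewrite mulr_algl -scalerAr mulr1.
Qed.

HB.instance Definition _ :=
  GRing.Lalgebra_isAlgebra.Build (series k) (series A) sscaleAr.

End SeriesAlg.

Definition hvar (k : comNzRingType) : series k := Series (fun n => (n == 1%N)%:R).

(* The sum of all the h^i *: Y_i, which converges h-adically. *)
Definition hsum (k : comNzRingType) (A : algType k) (Y : nat -> series A) :
  series A :=
  Series (fun n => scoef (\sum_(i < n.+1) hvar k ^+ i *: Y i) n).

Section HSum.
Variables (k : comNzRingType) (A : algType k).
Implicit Types Y Z : nat -> series A.

Lemma scoefD (x y : series A) n : scoef (x + y) n = scoef x n + scoef y n.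
Proof. by []. Qed.

Lemma scoef_hZ (y : series A) n :
  scoef (hvar k *: y) n = if n is m.+1 then scoef y m else 0.
Proof.
rewrite [LHS]/=; case: n => [|n]; first by rewrite big_ord1 scale0r.
rewrite !big_ord_recl /= scale0r add0r scale1r subn1 big1 ?addr0 // => i _.
by rewrite scale0r.
Qed.

Lemma scoef_hvarZ i (y : series A) n : (n < i)%N -> scoef (hvar k ^+ i *: y) n = 0.
Proof.
elim: i n => // i IH [|n] lt_ni; rewrite exprS -scalerA scoef_hZ //.
exact: IH.
Qed.

Lemma hsumE Y m n : (m <= n)%N ->
  scoef (hsum Y) m = scoef (\sum_(i < n.+1) hvar k ^+ i *: Y i) m.
Proof.
move/subnKC <-; elim: (n - m)%N => [|d IH]; first by rewrite addn0.
by rewrite addnS big_ord_recr scoefD scoef_hvarZ ?addr0 // ltnS leq_addr.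
Qed.

Lemma hsum_linear c Y Z :
  hsum (fun i => c *: Y i + Z i) = c *: hsum Y + hsum Z.
Proof.
apply/seriesP => n; rewrite scoefD.
have -> : scoef (c *: hsum Y) n =
    scoef (c *: \sum_(i < n.+1) hvar k ^+ i *: Y i) n.
  by apply: eq_bigr => i _; congr (_ *: _); apply/hsumE/leq_subr.
rewrite /= -[X in X + _]/(scoef (c *: _) n) -scoefD; congr scoef.
rewrite scaler_sumr -big_split; apply: eq_bigr => i _ /=.
by rewrite scalerDr !scalerA [c * _]mulrC.
Qed.

End HSum.

Definition hexp (k : fieldType) (A : algType k) (a : A) : series A :=
  Series (fun n => (n`!%:R)^-1 *: a ^+ n).

(* 0 if x is not invertible *)
Definition ringinv (A : nzRingType) (x : A) : A :=
  xget 0 [set y | x * y = 1 /\ y * x = 1].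

Section SeriesTensor.
Variables (k : comNzRingType) (A B : augAlgType k).

Definition stens (x : series A) (y : series B) : series (tens A B) :=
  Series (fun n => \sum_(i < n.+1) tpure (scoef x i) (scoef y (n - i))).

(* The k[[h]]-linear map on the completed tensor product induced by a
   k[[h]]-bilinear map f; all the expressions in Sweedler notation are instances
   of it, e.g. x_(1) y gamma(x_(2)) is hlift (fun a b => a * y * gamma b)
   applied to Delta(x). *)
Definition hlift (W : algType k) (f : series A -> series B -> series W)
    (x : series (tens A B)) : series W :=
  hsum (fun i => tlift (fun a b => f (scst a) (scst b)) (scoef x i)).

Lemma hlift_linear (W : algType k) (f g : series A -> series B -> series W)
    (c : series k) x :
  hlift (fun a b => c *: f a b + g a b) x = c *: hlift f x + hlift g x.
Proof.
rewrite -hsum_linear; congr hsum; apply/funext => i.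
by rewrite /tlift big_split scaler_sumr.
Qed.

End SeriesTensor.

Section Enveloping.
Variables (k : comNzRingType) (g : lmodType k) (br : g -> g -> g).
Local Notation T := (tensalg g).
Local Notation "\iota x" := (tensgen x) (at level 8, x at level 2).

Definition envrel (z : T) : Prop :=
  exists x y, z = \iota x * \iota y - \iota y * \iota x - \iota (br x y).

Lemma envrel_aug z : envrel z -> aug z = 0.
Proof.
by case=> x [y] ->; rewrite 2!augB 2!augM 3!tensgen_aug mulr0 subrr subr0.
Qed.

Definition uenv := quot envrel_aug.
HB.instance Definition _ := AugAlgebra.on uenv.

Definition ugen (x : g) : uenv := qpi envrel_aug (\iota x).

(* As tensalg_lift; meaningful only when f is a Lie algebra morphism. *)
Definition ulift (B : algType k) (f : g -> B) (u : uenv) : B :=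
  tensalg_lift f (repr u).

Definition symrel (z : T) : Prop :=
  exists x y, z = \iota x * \iota y - \iota y * \iota x.

Lemma symrel_aug z : symrel z -> aug z = 0.
Proof.
by case=> x [y] ->; rewrite augB 2!augM 2!tensgen_aug mulr0 subrr.
Qed.

Definition symalg := quot symrel_aug.
HB.instance Definition _ := AugAlgebra.on symalg.

Definition symgen (x : g) : symalg := qpi symrel_aug (\iota x).

Definition symtrel (z : polyalg T) : Prop :=
  exists x y, z = (\iota x * \iota y - \iota y * \iota x)%:P
                  - ('X : {poly k}) *: ((\iota (br x y))%:P : polyalg T).

Lemma symtrel_aug z : symtrel z -> aug z = 0.
Proof.
case=> x [y] ->; rewrite augB augZ.
rewrite [X in _ - _ * X]polyaugC [X in X - _]polyaugC.
by rewrite augB 2!augM 3!tensgen_aug mulr0 subrr polyC0 mulr0 subrr.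
Qed.

Definition symtalg := quot symtrel_aug.
HB.instance Definition _ := AugAlgebra.on symtalg.

Definition symtgen (x : g) : symtalg := qpi symtrel_aug (\iota x)%:P.

End Enveloping.

Section Sl.
Variables (k : comNzRingType) (n : nat).

Definition sl_pred : {pred 'M[k]_n} := fun A => \tr A == 0.

Lemma sl_submod_closed : submod_closed sl_pred.
Proof.
split=> [|c A B]; rewrite !unfold_in ?linear0 // => /eqP trA /eqP trB.
by rewrite linearP /= trA trB mulr0 addr0.
Qed.

HB.instance Definition _ :=
  GRing.isSubmodClosed.Build k 'M[k]_n sl_pred sl_submod_closed.

Record sl : predArgType := Sl { slval :> 'M[k]_n; _ : slval \in sl_pred }.

HB.instance Definition _ := [isSub for slval].
HB.instance Definition _ := [Choice of sl by <:].
HB.instance Definition _ := [SubChoice_isSubLmodule of sl by <:].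

Lemma slbr_subproof (x y : sl) : (x *m y - y *m x : 'M[k]_n) \in sl_pred.
Proof. by rewrite unfold_in linearB /= mxtrace_mulC subrr. Qed.

Definition slbr (x y : sl) : sl := Sl (slbr_subproof x y).

(* Duality is with respect to the form c tr(xy): up to the choice of c, this is
   the only invariant form on sl(n). *)
Definition dual_bases (c : k) d (e f : 'I_d -> sl) : Prop :=
  (forall i j, c * \tr (e i *m f j) = (i == j)%:R) /\
  (forall x : sl, x = \sum_i (c * \tr (x *m f i)) *: e i).

End Sl.

Section QEA.
Variables (k : fieldType) (n : nat).
Local Notation g := (sl k n).
Local Notation U := (uenv (@slbr k n)).
Local Notation U2 := (tens U U).
Local Notation U3 := (tens U U2).
Local Notation Uh := (series U).
Local Notation "\iota x" := (ugen (@slbr k n) x) (at level 8, x at level 2).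

Definition comul0 : U -> U2 :=
  ulift (fun x : g => tpure \iota x 1 + tpure 1 \iota x).

Definition flip : U2 -> U2 := tlift (fun a b => tpure b a).
Definition leg12 : U2 -> U3 := tlift (fun a b => tpure a (tpure b 1)).
Definition leg13 : U2 -> U3 := tlift (fun a b => tpure a (tpure 1 b)).
Definition leg23 : U2 -> U3 := tlift (fun a b => tpure 1 (tpure a b)).

Definition counith : Uh -> series k := smap aug.

Definition split_casimir (t : U2) : Prop :=
  exists (c : k) d (e f : 'I_d -> g), [/\ c != 0, dual_bases c e f &
    t = \sum_i tpure \iota (e i) \iota (f i)].

Definition cyb (r : U2) : U3 :=
  (leg12 r * leg13 r - leg13 r * leg12 r)
  + (leg12 r * leg23 r - leg23 r * leg12 r)
  + (leg13 r * leg23 r - leg23 r * leg13 r).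

Definition comul3 (x : g) : U3 :=
  tpure \iota x 1 + tpure 1 (tpure \iota x 1) + tpure 1 (tpure 1 \iota x).

(* Skew-symmetric solutions of the modified classical Yang-Baxter equation, i.e.
   r in wedge^2 g with [r12,r13] + [r12,r23] + [r13,r23] g-invariant. *)
Definition classical_rmatrix (r : U2) : Prop :=
  (exists s : seq (g * g), r = \sum_(p <- s)
     (tpure \iota p.1 \iota p.2 - tpure \iota p.2 \iota p.1)) /\
  (forall x : g, comul3 x * cyb r = cyb r * comul3 x).

Definition comulF (F : series U2) (x : Uh) : series U2 :=
  F * smap comul0 x * ringinv F.

Definition comul_id (D : Uh -> series U2) : series U2 -> series U3 :=
  hlift (fun a b => hlift (fun a1 a2 => stens a1 (stens a2 b)) (D a)).
Definition id_comul (D : Uh -> series U2) : series U2 -> series U3 :=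
  hlift (fun a b => stens a (D b)).

(* By Drinfeld's theorem the algebra and the counit of a quantized enveloping
   algebra of sl(n) may be taken to be those of U(g)[[h]]; what is deformed is
   the coproduct, twisted by F, and the antipode.  The last three axioms say that
   F^21 e^(h t / 2) F^-1 is a universal R-matrix. *)
Record qea := Qea {
  twist : series U2;
  casimir : U2;
  rmx : U2;
  antipode : {linear Uh -> Uh};
  comulh := comulF twist;
  Rmx : series U2 :=
    smap flip twist * hexp (2^-1 *: casimir) * ringinv twist;
  casimirP : split_casimir casimir;
  rmxP : classical_rmatrix rmx;
  twist0 : scoef twist 0 = 1;
  twist1 : scoef twist 1 = 2^-1 *: rmx;
  comulh_coassoc : forall x, comul_id comulh (comulh x) = id_comul comulh (comulh x);
  counithl : forall x, hlift (fun a b => counith a *: b) (comulh x) = x;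
  counithr : forall x, hlift (fun a b => counith b *: a) (comulh x) = x;
  antipodel : forall x,
    hlift (fun a b => antipode a * b) (comulh x) = (counith x)%:A;
  antipoder : forall x,
    hlift (fun a b => a * antipode b) (comulh x) = (counith x)%:A;
  Rmx_comul : forall x, Rmx * comulh x = smap flip (comulh x) * Rmx;
  Rmx_comul_id : comul_id comulh Rmx = smap leg13 Rmx * smap leg23 Rmx;
  Rmx_id_comul : id_comul comulh Rmx = smap leg13 Rmx * smap leg12 Rmx
}.

Section Construction.
Variable H : qea.
Local Notation K := (series k).
Local Notation "\Delta" := (comulh H).
Local Notation "\gamma" := (antipode H).

Definition adh (x y : Uh) : Uh := hlift (fun a b => a * y * \gamma b) (\Delta x).

(* The deformed basic representation rho on k^n[[h]], with the invariant
   functional Tr on End(k^n[[h]]), where (x phi)(a) = phi(gamma(x_(1)) a x_(2)). *)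
Record basic_rep := BasicRep {
  rho : {linear Uh -> 'M[K]_n};
  rho_morph : monoid_morphism rho;
  rho0 : forall (x : g) i j, scoef (rho (scst \iota x) i j) 0 = slval x i j;
  qtr : {scalar 'M[K]_n};
  qtr_inv : forall (x : Uh) (m : 'M[K]_n),
    hlift (W := k^o) (fun a b => qtr (rho (\gamma a) *m m *m rho b)) (\Delta x)
    = counith x * qtr m;
  qtr1 : qtr 1%:M = 1
}.

Variable V : basic_rep.

(* Q = R^21 R *)
Definition Qmx : series U2 := smap flip (Rmx H) * Rmx H.

(* f : phi |-> phi(rho(Q')) Q'' *)
Definition reflmap (phi : 'M[K]_n -> K) : Uh :=
  hlift (fun a b => phi (rho V a) *: b) Qmx.

Lemma reflmap_linear c phi psi :
  reflmap (fun m => c * phi m + psi m) = c *: reflmap phi + reflmap psi.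
Proof.
rewrite -hlift_linear; congr hlift; apply/funext => a; apply/funext => b.
by rewrite scalerDl scalerA.
Qed.

(* C = f(Tr) *)
Definition Cel : Uh := reflmap (qtr V).

(* x in L = h^-1 f(Z_h^* ), where phi ranges over the functionals vanishing on
   the identity; multiplication by h is injective. *)
Definition inL (x : Uh) : Prop :=
  exists phi : 'M[K]_n -> K,
    [/\ scalar phi, phi 1%:M = 0 & hvar k *: x = reflmap phi].

(* g_h = C^-1 L *)
Definition gh_pred : {pred Uh} :=
  fun y => `[< exists2 x, inL x & y = ringinv Cel * x >].

Lemma inL_linear c x y : inL x -> inL y -> inL (c *: x + y).
Proof.
case=> phi [lphi phi1 fphi] [psi [lpsi psi1 fpsi]].
exists (fun m => c * phi m + psi m); split.
- move=> a u v; rewrite lphi lpsi !mulrDr.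
  by rewrite !mulrA [c * a]mulrC -!addrA [_ + (_ + psi v)]addrCA.
- by rewrite phi1 psi1 mulr0 addr0.
- by rewrite reflmap_linear -fphi -fpsi scalerDr !scalerA mulrC.
Qed.

Lemma inL0 : inL 0.
Proof.
exists (fun=> 0); split=> // [a u v|]; first by rewrite mulr0 addr0.
rewrite scaler0; apply: (addrI (reflmap (fun=> 0))).
have := reflmap_linear 1 (fun=> 0) (fun=> 0); by rewrite mulr0 !addr0 scale1r.
Qed.

Lemma gh_submod_closed : submod_closed gh_pred.
Proof.
split=> [|c x y].
  by rewrite unfold_in; apply/asboolP; exists 0; rewrite ?mulr0 //; apply: inL0.
rewrite !unfold_in => /asboolP[x' Lx ->] /asboolP[y' Ly ->]; apply/asboolP.
exists (c *: x' + y'); first exact: inL_linear.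
by rewrite mulrDr scalerAr.
Qed.

HB.instance Definition _ :=
  GRing.isSubmodClosed.Build K Uh gh_pred gh_submod_closed.

Record gh : predArgType := Gh { ghval :> Uh; _ : ghval \in gh_pred }.

HB.instance Definition _ := [isSub for ghval].
HB.instance Definition _ := [Choice of gh by <:].
HB.instance Definition _ := [SubChoice_isSubLmodule of gh by <:].

(* 0 if u is not in g_h *)
Definition ghof (u : Uh) : gh := insubd (0 : gh) u.

Definition brh (x y : gh) : gh :=
  ghof (ringinv Cel * adh (Cel * x) (Cel * y)).

(* A decomposition Delta_h(x) = x (x) C + sum v (x) x', with x' in L.  Since L
   is free of finite rank, nothing below depends on the choice. *)
Definition ldecomp (x : Uh) : seq (Uh * Uh) :=
  xget [::] [set s : seq (Uh * Uh) | (forall p, p \in s -> inL p.2) /\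
    \Delta x = stens x Cel + \sum_(p <- s) stens p.1 p.2].

(* sigma_h (x (x) y), in the degree 2 part of T(g_h) *)
Definition sigmah (x y : gh) : tensalg gh :=
  \sum_(p <- ldecomp (Cel * x))
    tensgen (ghof (ringinv Cel * adh p.1 (Cel * y)))
    * tensgen (ghof (ringinv Cel * p.2)).

Definition Jt (z : polyalg (tensalg gh)) : Prop :=
  exists x y : gh, z = (tensgen x * tensgen y - sigmah x y)%:P
    - ('X : {poly K}) *: ((tensgen (brh x y))%:P : polyalg (tensalg gh)).

Lemma Jt_aug z : Jt z -> aug z = 0.
Proof.
case=> x [y] ->; rewrite augB augZ.
rewrite [X in _ - _ * X]polyaugC [X in X - _]polyaugC augB augM 3!tensgen_aug.
rewrite aug_sum big1 => [|p _]; last by rewrite augM tensgen_aug mul0r.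
by rewrite mulr0 subr0 polyC0 mulr0 subr0.
Qed.

Definition Sth := quot Jt_aug.
HB.instance Definition _ := AugAlgebra.on Sth.

Definition sthgen (x : gh) : Sth := qpi Jt_aug (tensgen x)%:P.

End Construction.
Definition standard_action (l : comNzRingType) (B : algType l) (gen : g -> B)
    (D : g -> B -> B) : Prop :=
  [/\ forall x, linear (D x),
      forall x a b, D x (a * b) = D x a * b + a * D x b
    & forall x y, D x (gen y) = gen (slbr x y)].

Definition free_module (l : comNzRingType) (M : lmodType l) : Prop :=
  exists (I : choiceType) (e : I -> M),
    (forall m, exists s : seq (l * I), m = \sum_(p <- s) p.1 *: e p.2) /\
    (forall (s : seq I) (c : I -> l), uniq s -> \sum_(i <- s) c i *: e i = 0 ->
       forall i, i \in s -> c i = 0).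

Local Notation K := (series k).

(* Delta_h(x) = sum_i h^i X_i with X_i in U(g) (x) U(g), so dq_inv says that
   x (a b) is the h-adic sum of the h^i m(X_i (a (x) b)), that is,
   x m(a (x) b) = m(Delta_h(x) (a (x) b)).  The maps dq_h0 and dq_th0 identify
   A / h A with (Sg)_t and A / (t, h) A with Sg. *)
Record double_quantization (H : qea) (A : algType {poly K}) := DoubleQuantization {
  dq_act : Uh -> A -> A;
  dq_act_linear : forall x, linear (dq_act x);
  dq_act_linearl : forall (c : K) x y a,
    dq_act (c *: x + y) a = c%:P *: dq_act x a + dq_act y a;
  dq_act1 : forall a, dq_act 1 a = a;
  dq_actM : forall x y a, dq_act (x * y) a = dq_act x (dq_act y a);
  dq_inv : forall x a b N, exists d,
    dq_act x (a * b) =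
      \sum_(i < N) (hvar k ^+ i)%:P *:
        tlift (fun u v => dq_act (scst u) a * dq_act (scst v) b)
              (scoef (comulh H x) i)
      + (hvar k ^+ N)%:P *: d;
  dq_free : free_module A;
  dq_h0 : {rmorphism A -> symtalg (@slbr k n)};
  dq_h0Z : forall (p : {poly K}) a,
    dq_h0 (p *: a) = map_poly (fun c : K => scoef c 0) p *: dq_h0 a;
  dq_h0_surj : forall b, exists a, dq_h0 a = b;
  dq_h0_ker : forall a, dq_h0 a = 0 <-> exists b, a = (hvar k)%:P *: b;
  dq_h0_act : exists2 D, standard_action (@symtgen k g (@slbr k n)) D &
    forall (x : g) a, dq_h0 (dq_act (scst \iota x) a) = D x (dq_h0 a);
  dq_th0 : {rmorphism A -> symalg g};
  dq_th0Z : forall (p : {poly K}) a, dq_th0 (p *: a) = scoef p.[0] 0 *: dq_th0 a;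
  dq_th0_surj : forall b, exists a, dq_th0 a = b;
  dq_th0_ker : forall a,
    dq_th0 a = 0 <-> exists b c, a = 'X *: b + (hvar k)%:P *: c
}.

End QEA.

(* Main.v *)
(** Since C is central, for x in L with Delta_h(x) = x (x) C + v (x) x' one has
    x y = x_(1) y gamma(x_(2)) x_(3) = ad(x)(y) C + ad(v)(y) x' in U_h(g), so on
    g_h = C^-1 L the defining relations with t = 1 hold inside U_h(g), and
    x |-> t x extends to a morphism from (Sg)_{t,h} to U_h(g)[t].  Fix a basis of
    g_h deforming one of sl(n).  Its sorted monomials reduce modulo h to the
    sorted monomials of U(sl(n)), which are independent by the
    Poincare-Birkhoff-Witt theorem, hence the sorted monomials are independent
    over C[[h]][t]; since sigma_h is the flip modulo h, they also span modulo h,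
    and Nakayama's lemma in each (finitely generated) degree, t having degree 1,
    shows that they span.  So (Sg)_{t,h} is free and embeds in U_h(g)[t] as the
    Rees algebra of the filtration generated by g_h, and the action, the
    reductions modulo h and modulo (t, h), and their kernels can all be read off
    in U_h(g)[t].  The independence part of the Poincare-Birkhoff-Witt theorem
    comes from evaluating convolution products of matrix coefficients of the
    basic representation of sl(n) on monomials. *)

Require Import Defs.
From HB Require Import structures.
From mathcomp Require Import all_boot all_order all_algebra.
From mathcomp Require Import boolp classical_sets.
From mathcomp Require Import reals complex monalg.

Set Implicit Arguments.
Unset Strict Implicit.
Unset Printing Implicit Defensive.

Import GRing.Theory.
Local Open Scope ring_scope.

(** * Morphisms out of quotients of tensor algebras *)

(** Completeness is the obstacle. The algebra (Sg)_{t,h} is not h-adically complete, whereas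
    Delta_h(x) is an infinite h-adic sum of pure tensors, so it is not evident that ad(x) preserves
    the image of (Sg)_{t,h} in U_h(g)[t]. What saves the argument is that each filtration piece is
    spanned by finitely many monomials that stay independent modulo h: such a span is closed under
    h-adic limits and saturated for division by h. Closedness lets the action restrict; saturation
    gives the kernels of the reductions and the remainder in the invariance of the product.
    Everything about g_h comes from Q. It commutes with every Delta_h(x), which makes f equivariant
    and C central. The formula (id (x) Delta_h)(Q) = R^21_12 Q_13 R_12 gives the shape of Delta_h on
    L. Modulo h^2 one has Q = 1 + (h/2)(t + t^21), the terms in r cancelling, so g_h reduces to g
    whatever r is. Characteristic zero serves to halve this symmetrised Casimir, to divide traces by
    n, and to invert the positive integers on the diagonal of the pairing behind the
    Poincare-Birkhoff-Witt theorem. *)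

Section QuotientLift.
Variables (k : comNzRingType) (A : augAlgType k) (S : A -> Prop).
Hypothesis augS : forall s, S s -> aug s = 0.
Local Notation Q := (quot augS).
Local Notation pi := (qpi augS).

Lemma qpi_is_nmod_morphism : nmod_morphism pi.
Proof. by split=> // x y; rewrite qpiD. Qed.
HB.instance Definition _ := GRing.isNmodMorphism.Build A Q pi qpi_is_nmod_morphism.
Lemma qpi_is_monoid_morphism : monoid_morphism pi.
Proof. by split=> // x y; rewrite qpiM. Qed.
HB.instance Definition _ := GRing.isMonoidMorphism.Build A Q pi qpi_is_monoid_morphism.
HB.instance Definition _ := GRing.isScalable.Build k A Q *:%R pi (qpiZ augS).

Lemma qpiB x y : pi (x - y) = pi x - pi y.
Proof. exact: raddfB. Qed.

Lemma qpi_gen s : S s -> pi s = 0.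
Proof. by move=> Ss; rewrite -(raddf0 pi); apply/qpiP; rewrite subr0; apply: ideal_gen. Qed.

Variables (B : nzRingType) (F : {rmorphism A -> B}).
Hypothesis FS : forall s, S s -> F s = 0.

Lemma ideal_kernel x : ideal S x -> F x = 0.
Proof.
elim=> [|a s b z Ss _ IH]; first exact: raddf0.
by rewrite rmorphD !rmorphM /= (FS Ss) mulr0 mul0r IH addr0.
Qed.

Lemma quot_liftP (x y : A) : pi x = pi y -> F x = F y.
Proof. by move/qpiP/ideal_kernel/eqP; rewrite rmorphB subr_eq0 => /eqP. Qed.

(** The vanishing proof is an argument so that it is visible in the term: the ring morphism
    structures declared below are attached to [quot_lift FS] for each given [FS]. *)
Definition quot_lift of (forall s, S s -> F s = 0) := fun x : Q => F (repr x).
Local Notation G := (quot_lift FS).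

Lemma quot_liftE x : G (pi x) = F x.
Proof. by apply: quot_liftP; rewrite qreprK. Qed.

Lemma quot_lift_nmod_morphism : nmod_morphism G.
Proof.
split=> [|x y]; first by rewrite -(raddf0 pi) quot_liftE raddf0.
by elim/qind: x => x; elim/qind: y => y; rewrite -rmorphD !quot_liftE rmorphD.
Qed.
HB.instance Definition _ := GRing.isNmodMorphism.Build Q B G quot_lift_nmod_morphism.

Lemma quot_lift_monoid_morphism : monoid_morphism G.
Proof.
split=> [|x y]; first by rewrite -(rmorph1 pi) quot_liftE rmorph1.
by elim/qind: x => x; elim/qind: y => y; rewrite -rmorphM !quot_liftE rmorphM.
Qed.
HB.instance Definition _ := GRing.isMonoidMorphism.Build Q B G quot_lift_monoid_morphism.

End QuotientLift.

Section TensorAlgebraLift.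
Variables (k : comNzRingType) (M : lmodType k).
Local Notation T := (tensalg M).

Lemma tensgen_linear : linear (@tensgen k M).
Proof.
move=> c x y; rewrite /tensgen unlock.
rewrite -(linearP (qpi (@tensrel_aug k M))); apply/qpiP/ideal_gen.
by exists c, x, y.
Qed.
HB.instance Definition _ :=
  GRing.isLinear.Build k M T _ (@tensgen k M) tensgen_linear.

Lemma freealg_ind (P : freealg M -> Prop) :
    P 1 -> (forall c x y, P x -> P y -> P (c *: x + y)) ->
    (forall m x, P x -> P (fvar m * x)) ->
  forall x, P x.
Proof.
move=> P1 PL PM.
have P0 : P 0 by have := PL (-1) 1 1 P1 P1; rewrite scaleN1r addNr.
have Pw (w : {fmonom M}) : P << w >>.
  case: w => s; elim: s => [|m s IH].
    have e : FMonom [::] = mone :> {fmonom M} by apply/eqP; rewrite fmP fm1.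
    by rewrite e.
  have -> : << FMonom (m :: s) >> = fvar m * << FMonom s >> :> freealg M.
    rewrite malgM_def fgmulUU mulr1; congr << _ >>.
    by apply/eqP; rewrite fmP fmM fmuE.
  exact: PM.
move=> x; rewrite [x]monalgE; elim/big_rec: _ => // w y _ Py.
have -> : << x@_w *g w >> = x@_w *: << w >> :> freealg M.
  by rewrite -mul_malgC malgM_def fgmulUU mul1m mulr1.
exact: PL.
Qed.

Lemma tensalg_ind (P : T -> Prop) :
    P 1 -> (forall c x y, P x -> P y -> P (c *: x + y)) ->
    (forall m x, P x -> P (tensgen m * x)) ->
  forall x, P x.
Proof.
move=> P1 PL PM; apply: qind; apply: freealg_ind.
- by rewrite rmorph1.
- by move=> c x y Px Py; rewrite linearP; apply: PL.
- by move=> m x Px; rewrite rmorphM /=; move: (PM m _ Px); rewrite /tensgen unlock.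
Qed.

Variables (B : nzRingType) (kap : {rmorphism k -> B}) (f : M -> B).
Hypothesis kapC : forall c b, GRing.comm (kap c) b.
Hypothesis f_lin : forall c x y, f (c *: x + y) = kap c * f x + f y.

Let fw (w : {fmonom M}) : B := \prod_(x <- w) f x.
(** Scalars reach [B] through a central ring morphism [kap] instead of an algebra structure, because
    one of the targets below is a polynomial ring on which k acts through the constants. *)
Definition free_lift : freealg M -> B := mmap kap fw.

Let fw_morph : mmorphism fw.
Proof.
split=> [a b|]; first by rewrite /fw fmM big_cat.
by rewrite /fw fm1 big_nil.
Qed.

Lemma free_lift_nmod_morphism : nmod_morphism free_lift.
Proof. by split; [apply: mmap0 | apply: mmapD]. Qed.
HB.instance Definition _ :=
  GRing.isNmodMorphism.Build (freealg M) B free_lift free_lift_nmod_morphism.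

Lemma free_lift_monoid_morphism : monoid_morphism free_lift.
Proof.
pose m := @isMultiplicative.Build _ _ fw fw_morph.
pose h : MMorphism.type {fmonom M} B := MMorphism.Pack (MMorphism.Class m).
have [h1 h2] := @commr_mmap_is_multiplicative _ _ _ kap h (fun _ _ _ => kapC _ _).
by split.
Qed.
HB.instance Definition _ :=
  GRing.isMonoidMorphism.Build (freealg M) B free_lift free_lift_monoid_morphism.

Lemma free_liftZ c x : free_lift (c *: x) = kap c * free_lift x.
Proof.
rewrite /free_lift (mmapEw (msuppZ_le _ _)) mmapE big_distrr /=.
by apply/eq_bigr=> w _; rewrite linearZ /= rmorphM mulrA.
Qed.

Lemma free_lift_var x : free_lift (fvar x) = f x.
Proof.
transitivity (kap 1 * fw (fmu x)); first exact: mmapU.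
by rewrite rmorph1 mul1r /fw fmuE big_seq1. Qed.

Lemma free_lift_rel z : tensrel z -> free_lift z = 0.
Proof.
case=> c [x] [y] ->; rewrite rmorphB rmorphD /= free_liftZ !free_lift_var f_lin.
by rewrite subrr.
Qed.

Definition tens_lift : T -> B := quot_lift (F := free_lift) free_lift_rel.
HB.instance Definition _ := GRing.RMorphism.on tens_lift.

Lemma tens_lift_gen x : tens_lift (tensgen x) = f x.
Proof. by rewrite /tens_lift /tensgen unlock quot_liftE /= free_lift_var. Qed.

Lemma tens_liftZ c x : tens_lift (c *: x) = kap c * tens_lift x.
Proof. by elim/qind: x => x; rewrite -linearZ /= /tens_lift !quot_liftE /= free_liftZ. Qed.

End TensorAlgebraLift.

(** * Power series and completed tensor products *)

Section SeriesLinear.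
Variable k : comNzRingType.
Local Notation h := (hvar k).
Implicit Types A B : algType k.

Definition sdrop (T : Type) (x : series T) : series T := Series (fun n => scoef x n.+1).

Lemma scst_is_linear A c (a b : A) : scst (c *: a + b) = scst c *: scst a + scst b.
Proof.
apply/seriesP => n; rewrite scoefD /= big_ord_recl /= subn0 big1 => [|i _].
  by rewrite addr0; case: eqP => // _; rewrite scaler0 addr0.
by rewrite scale0r.
Qed.

Lemma scst0 A : scst (0 : A) = 0. Proof. by []. Qed.
Lemma scst1 A : scst (1 : A) = 1. Proof. by []. Qed.
Lemma scstD A (a b : A) : scst (a + b) = scst a + scst b.
Proof. by apply/seriesP => n; rewrite scoefD /=; case: eqP; rewrite ?addr0. Qed.
Lemma scstZ A c (a : A) : scst (c *: a) = scst c *: scst a.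
Proof. by have := scst_is_linear c a 0; rewrite !addr0. Qed.
Lemma scst_sum A I (r : seq I) (F : I -> A) :
  scst (\sum_(i <- r) F i) = \sum_(i <- r) scst (F i).
Proof. exact: (big_morph _ (@scstD A) (scst0 A)). Qed.
Lemma scstM A (a b : A) : scst (a * b) = scst a * scst b.
Proof.
apply/seriesP => n /=; rewrite big_ord_recl /= subn0 big1 => [|i _].
  by rewrite addr0; case: eqP; rewrite ?mulr0.
by rewrite mul0r.
Qed.

Lemma scoefN A (x : series A) n : scoef (- x) n = - scoef x n. Proof. by []. Qed.
Lemma scoef0 A n : scoef (0 : series A) n = 0.
Proof. by rewrite /=; case: eqP. Qed.
Lemma scoef_sum A I (r : seq I) (P : pred I) (F : I -> series A) n :
  scoef (\sum_(i <- r | P i) F i) n = \sum_(i <- r | P i) scoef (F i) n.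
Proof. exact: (big_morph (fun x => scoef x n) (fun x y => scoefD x y n) (scoef0 A n)). Qed.
Lemma scoefZ_cst A c (x : series A) n : scoef (scst c *: x) n = c *: scoef x n.
Proof.
rewrite /= big_ord_recl /= subn0 big1 ?addr0 // => i _; by rewrite scale0r.
Qed.
Lemma scoef0M A (x y : series A) : scoef (x * y) 0 = scoef x 0 * scoef y 0.
Proof. by rewrite /= big_ord1. Qed.
Lemma scoef0Z A c (x : series A) : scoef (c *: x) 0 = scoef c 0 *: scoef x 0.
Proof. by rewrite /= big_ord1. Qed.

Lemma sdropE A (x : series A) : x = scst (scoef x 0) + h *: sdrop x.
Proof.
by apply/seriesP => -[|n]; rewrite scoefD scoef_hZ /= ?addr0 // add0r.
Qed.

Lemma hZ_inj A (x y : series A) : h *: x = h *: y -> x = y.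
Proof.
move=> e; apply/seriesP => n.
by have /seriesP/(_ n.+1) := e; rewrite !scoef_hZ.
Qed.

Lemma scoef_hvarXZ A N (x : series A) n : scoef (h ^+ N *: x) (N + n) = scoef x n.
Proof.
elim: N => [|N IH]; first by rewrite expr0 scale1r.
by rewrite exprS -scalerA addSn scoef_hZ IH.
Qed.

Lemma hvarXZP A N (x : series A) :
  (forall i, (i < N)%N -> scoef x i = 0) -> exists y, x = h ^+ N *: y.
Proof.
move=> x0; exists (Series (fun n => scoef x (N + n))); apply/seriesP => n.
have [lt_nN|le_Nn] := ltnP n N; first by rewrite scoef_hvarZ // x0.
by rewrite -(subnKC le_Nn) scoef_hvarXZ.
Qed.

Lemma h_separated A (x : series A) :
  (forall N, exists y, x = h ^+ N *: y) -> x = 0.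
Proof.
move=> xN; apply/seriesP => n; have [y ->] := xN n.+1.
by rewrite scoef_hvarZ // scoef0.
Qed.

Lemma hmod0P A (x : series A) : scoef x 0 = 0 -> exists y, x = h *: y.
Proof. by move=> x0; exists (sdrop x); rewrite {1}[x]sdropE x0 add0r. Qed.

Section Extension.
Variables (A B : algType k).

(** Peeling off constant terms: coefficient n + 1 of F x involves only F at the constant term of x
    and coefficient n of F at [sdrop x]. Additivity and commutation with h thus replace any
    continuity assumption. *)
Lemma hadd_eq (F G : series A -> series B) :
    (forall x y, F (x + y) = F x + F y) -> (forall x y, G (x + y) = G x + G y) ->
    (forall x, F (h *: x) = h *: F x) -> (forall x, G (h *: x) = h *: G x) ->
    (forall a, F (scst a) = G (scst a)) -> forall x, F x = G x.
Proof.
move=> FD GD Fh Gh FG x; apply/seriesP => n.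
elim: n x => [|n IH] x; rewrite [x]sdropE FD GD FG Fh Gh !scoefD !scoef_hZ //.
by rewrite IH.
Qed.

Lemma linear_eq (F G : series A -> series B) : linear F -> linear G ->
  (forall a, F (scst a) = G (scst a)) -> forall x, F x = G x.
Proof.
move=> lF lG; have lin0 (L : series A -> series B) : linear L -> L 0 = 0.
  move=> lL; have := lL (-1) 0 0; by rewrite scaler0 addr0 scaleN1r addNr.
apply: hadd_eq => [x y|x y|x|x].
- by have := lF 1 x y; rewrite !scale1r.
- by have := lG 1 x y; rewrite !scale1r.
- by have := lF h x 0; rewrite lin0 // !addr0.
- by have := lG h x 0; rewrite lin0 // !addr0.
Qed.

End Extension.

(** For fixed x both sides are additive in the scalar c and commute with h, so [hadd_eq] over the
    base k reduces c to a constant. *)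
Lemma linear_of_h A B (F : series A -> series B) :
    (forall x y, F (x + y) = F x + F y) ->
    (forall x, F (h *: x) = h *: F x) ->
    (forall c x, F (scst c *: x) = scst c *: F x) -> linear F.
Proof.
move=> FD Fh Fc c x y; rewrite FD; congr (_ + _).
apply: (@hadd_eq k^o B (fun c => F (c *: x)) (fun c => c *: F x)) => [a b|a b|a|a|a].
- by rewrite scalerDl FD.
- by rewrite scalerDl.
- by rewrite -[h *: a]/(h * a) -scalerA Fh.
- by rewrite -[h *: a]/(h * a) -scalerA.
- exact: Fc.
Qed.

Section SeriesLift.
Variables (A B : algType k) (G : A -> series B).
Hypothesis G_lin : forall c a b n,
  scoef (G (c *: a + b)) n = c *: scoef (G a) n + scoef (G b) n.

(** Linearity of [G] is assumed one coefficient at a time, since [series B] is a module over k[[h]]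
    and not over k. With a tensor product as source this gives [hlift]. *)
Definition slift (x : series A) : series B := hsum (fun i => G (scoef x i)).

Lemma GD a b : G (a + b) = G a + G b.
Proof. by apply/seriesP => n; have := G_lin 1 a b n; rewrite !scale1r. Qed.
Lemma G0 : G 0 = 0.
Proof. by apply: (addrI (G 0)); rewrite -GD !addr0. Qed.
Lemma GZ c a : G (c *: a) = scst c *: G a.
Proof.
apply/seriesP => n; have := G_lin c a 0 n.
by rewrite G0 scoef0 !addr0 scoefZ_cst.
Qed.

Lemma hsum_recl (Y : nat -> series B) : hsum Y = Y 0%N + h *: hsum (fun i => Y i.+1).
Proof.
apply/seriesP => n; rewrite scoefD scoef_hZ /hsum [LHS]/=.
rewrite -/(scoef _ n) big_ord_recl expr0 scale1r scoefD; congr (_ + _).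
have -> : \sum_(i < n) h ^+ lift ord0 i *: Y (lift ord0 i)
        = h *: \sum_(i < n) h ^+ i *: Y i.+1.
  by rewrite scaler_sumr; apply: eq_bigr => i _; rewrite scalerA -exprS.
by rewrite scoef_hZ; case: n.
Qed.

Lemma hsum0 : hsum (fun=> 0 : series B) = 0.
Proof.
apply/seriesP => n; rewrite scoef0 [LHS]/= big1 ?scoef0 // => i _.
by rewrite scaler0.
Qed.

Lemma slift_linear : linear slift.
Proof.
apply: linear_of_h => [x y|x|c x].
- rewrite /slift -[X in _ = X + _]scale1r -hsum_linear; congr hsum.
  by apply/funext => i; rewrite scoefD GD scale1r.
- rewrite /slift hsum_recl scoef_hZ G0 add0r; congr (_ *: hsum _).
  by apply/funext => i; rewrite scoef_hZ.
- rewrite /slift -[RHS]addr0.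
  rewrite -hsum0.
  rewrite -hsum_linear; congr hsum; apply/funext => i.
  by rewrite scoefZ_cst GZ addr0.
Qed.

Lemma slift_cst a : slift (scst a) = G a.
Proof.
rewrite /slift hsum_recl -[RHS]addr0; congr (_ + _).
have -> : (fun i => G (scoef (scst a) i.+1)) = (fun=> 0).
  by apply/funext => i; rewrite [scoef _ _]/= G0.
by rewrite hsum0 scaler0.
Qed.

Lemma slift_trunc x N : exists d,
  slift x = \sum_(i < N) h ^+ i *: G (scoef x i) + h ^+ N *: d.
Proof.
elim: N x => [|N IH] x.
  by exists (slift x); rewrite big_ord0 add0r expr0 scale1r.
have [d e] := IH (sdrop x); exists d.
rewrite /slift hsum_recl -/(slift (sdrop x)) e big_ord_recl expr0 scale1r -addrA.
rewrite scalerDr scalerA -exprS scaler_sumr; congr (_ + (_ + _)).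
by apply: eq_bigr => i _; rewrite scalerA -exprS.
Qed.

End SeriesLift.

Lemma smap_linear A B (f : A -> B) : linear f -> linear (smap f).
Proof.
move=> lf; have fD x y : f (x + y) = f x + f y.
  by have := lf 1 x y; rewrite !scale1r.
have f0 : f 0 = 0 by apply: (addrI (f 0)); rewrite -fD !addr0.
apply: linear_of_h => [x y|x|c x]; apply/seriesP => n.
- exact: fD.
- by transitivity (f (scoef (h *: x) n)) => //; rewrite !scoef_hZ; case: n.
- transitivity (f (scoef (scst c *: x) n)) => //; rewrite !scoefZ_cst.
  by have := lf c (scoef x n) 0; rewrite f0 !addr0.
Qed.

End SeriesLinear.

Section KLinear.
Variable K : comNzRingType.
Implicit Types U V W : lmodType K.

(** A bare predicate rather than a bundled map: Sweedler expressions are anonymous functions of each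
    of their variables, and the tactic [klin] proves their linearity from their syntax. *)
Definition klin U V (F : U -> V) : Prop := linear F.

Lemma klinD U V (F : U -> V) : klin F -> forall x y, F (x + y) = F x + F y.
Proof. by move=> lF x y; have := lF 1 x y; rewrite !scale1r. Qed.
Lemma klin0 U V (F : U -> V) : klin F -> F 0 = 0.
Proof. by move=> lF; have := lF (-1) 0 0; rewrite scaler0 addr0 scaleN1r addNr. Qed.
Lemma klinZ U V (F : U -> V) : klin F -> forall c x, F (c *: x) = c *: F x.
Proof. by move=> lF c x; have := lF c x 0; rewrite (klin0 lF) !addr0. Qed.
Lemma klin_sum U V (F : U -> V) : klin F -> forall I (r : seq I) (P : pred I) G,
  F (\sum_(i <- r | P i) G i) = \sum_(i <- r | P i) F (G i).
Proof. by move=> lF I r P G; apply: big_morph; [apply: klinD | apply: klin0]. Qed.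

Lemma klin_id U : klin (fun x : U => x).
Proof. by move=> c x y. Qed.
Lemma klin_comp U V W (L : V -> W) (F : U -> V) :
  klin L -> klin F -> klin (fun x => L (F x)).
Proof. by move=> lL lF c x y; rewrite lF lL. Qed.
Lemma klin_lfun U V W (L : {linear V -> W}) (F : U -> V) :
  klin F -> klin (fun x => L (F x)).
Proof. by apply: klin_comp => c x y; rewrite linearP. Qed.
Lemma klin_add U V (F G : U -> V) : klin F -> klin G -> klin (fun x => F x + G x).
Proof. by move=> lF lG c x y; rewrite lF lG scalerDr addrACA. Qed.
Lemma klin_opp U V (F : U -> V) : klin F -> klin (fun x => - F x).
Proof. by move=> lF c x y; rewrite lF opprD scalerN. Qed.
Lemma klin_scale U V c (F : U -> V) : klin F -> klin (fun x => c *: F x).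
Proof. by move=> lF d x y; rewrite lF scalerDr !scalerA mulrC. Qed.
Lemma klin_scalev U V (f : U -> K^o) (v : V) : klin f -> klin (fun x => f x *: v).
Proof. by move=> lf c x y; rewrite lf scalerDl -scalerA. Qed.
Lemma klin_mulr U (A : algType K) (a : A) (F : U -> A) : klin F -> klin (fun x => a * F x).
Proof. by move=> lF c x y; rewrite lF mulrDr scalerAr. Qed.
Lemma klin_mull U (A : algType K) (a : A) (F : U -> A) : klin F -> klin (fun x => F x * a).
Proof. by move=> lF c x y; rewrite lF mulrDl scalerAl. Qed.

Lemma klin_mulmxr U m n p (A : 'M[K]_(m, n)) (F : U -> 'M[K]_(n, p)) :
  klin F -> klin (fun x => A *m F x).
Proof. by move=> lF c x y; rewrite lF mulmxDr scalemxAr. Qed.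
Lemma klin_mulmxl U m n p (A : 'M[K]_(n, p)) (F : U -> 'M[K]_(m, n)) :
  klin F -> klin (fun x => F x *m A).
Proof. by move=> lF c x y; rewrite lF mulmxDl scalemxAl. Qed.

End KLinear.

Section CompletedTensor.
Variable k : comNzRingType.
Local Notation K := (series k).
Local Notation h := (hvar k).
Implicit Types (A B C D : augAlgType k) (W : algType k).

Lemma stens_cst A B (a : A) (b : B) : stens (scst a) (scst b) = scst (tpure a b).
Proof.
apply/seriesP => n /=; rewrite big_ord_recl /= subn0 big1 => [|i _].
  by rewrite addr0; case: eqP => // _; rewrite -(scale0r 0) tpureZr scale0r.
by rewrite -(scale0r 0) tpureZl scale0r.
Qed.

Lemma scoef_stens A B (x : series A) (y : series B) n :
  scoef (stens x y) n = \sum_(i < n.+1) tpure (scoef x i) (scoef y (n - i)).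
Proof. by []. Qed.

Lemma tpure0l A B (b : B) : tpure (0 : A) b = 0.
Proof. by rewrite -(scale0r 0) tpureZl scale0r. Qed.
Lemma tpure0r A B (a : A) : tpure a (0 : B) = 0.
Proof. by rewrite -(scale0r 0) tpureZr scale0r. Qed.

Lemma klin_stensl A B (U : lmodType K) (b : series B) (F : U -> series A) :
  klin F -> klin (fun x => stens (F x) b).
Proof.
apply: (klin_comp (L := fun a => stens a b)).
apply: linear_of_h => [x y|x|c x]; apply/seriesP => n.
- rewrite scoefD !scoef_stens -big_split; apply: eq_bigr => i _.
  by rewrite scoefD tpureDl.
- rewrite scoef_hZ scoef_stens big_ord_recl scoef_hZ tpure0l add0r.
  case: n => [|n]; first by rewrite big_ord0.
  by rewrite scoef_stens; apply: eq_bigr => i _; rewrite scoef_hZ.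
- rewrite scoefZ_cst !scoef_stens scaler_sumr; apply: eq_bigr => i _.
  by rewrite scoefZ_cst tpureZl.
Qed.

Lemma klin_stensr A B (U : lmodType K) (a : series A) (F : U -> series B) :
  klin F -> klin (fun x => stens a (F x)).
Proof.
apply: (klin_comp (L := stens a)).
apply: linear_of_h => [x y|x|c x]; apply/seriesP => n.
- rewrite scoefD !scoef_stens -big_split; apply: eq_bigr => i _.
  by rewrite scoefD tpureDr.
- rewrite scoef_hZ scoef_stens big_ord_recr subnn scoef_hZ tpure0r.
  apply: (etrans (addr0 _)).
  case: n => [|n]; first by rewrite big_ord0.
  rewrite scoef_stens; apply: eq_bigr => i _.
  have e : (n.+1 - i = (n - i).+1)%N by rewrite subSn // -ltnS.
  transitivity (tpure (scoef a i) (scoef (h *: x) (n.+1 - i)%N)) => //.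
  by rewrite e scoef_hZ.
- rewrite scoefZ_cst !scoef_stens scaler_sumr; apply: eq_bigr => i _.
  by rewrite scoefZ_cst tpureZr.
Qed.

(** Constants determine a linear map on series, and pure tensors span the constants. Identities in
    Sweedler notation are reduced through this to tensors a (x) b, without any convergence
    argument. *)
Lemma tens_eq_lin A B W (F G : series (tens A B) -> series W) :
  klin F -> klin G -> (forall a b, F (stens a b) = G (stens a b)) -> forall X, F X = G X.
Proof.
move=> lF lG FG; apply: linear_eq => // X.
elim/tens_pure_ind: X => [a b||X Y IX IY]; first by rewrite -stens_cst.
  by rewrite scst0 (klin0 lF) (klin0 lG).
by rewrite scstD (klinD lF) (klinD lG) IX IY.
Qed.

Lemma series_eq_lin W W' (F G : series W -> series W') :
  klin F -> klin G -> (forall a, F (scst a) = G (scst a)) -> forall X, F X = G X.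
Proof. by move=> lF lG FG; apply: linear_eq. Qed.

Lemma stensM A B (a c : series A) (b d : series B) :
  stens a b * stens c d = stens (a * c) (b * d).
Proof.
move: a; apply: series_eq_lin => [||a].
- by apply/klin_mull/klin_stensl/klin_id.
- by apply/klin_stensl/klin_mull/klin_id.
move: b; apply: series_eq_lin => [||b].
- by apply/klin_mull/klin_stensr/klin_id.
- by apply/klin_stensr/klin_mull/klin_id.
move: c; apply: series_eq_lin => [||c].
- by apply/klin_mulr/klin_stensl/klin_id.
- by apply/klin_stensl/klin_mulr/klin_id.
move: d; apply: series_eq_lin => [||d].
- by apply/klin_mulr/klin_stensr/klin_id.
- by apply/klin_stensr/klin_mulr/klin_id.
by rewrite -!scstM !stens_cst -scstM [X in scst X]tmul_pure.
Qed.

Lemma stens1 A B : stens 1 1 = 1 :> series (tens A B).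
Proof. by rewrite -!scst1 stens_cst. Qed.

Definition hbilin A B W (f : series A -> series B -> series W) :=
  (forall b, klin (f^~ b)) /\ (forall a, klin (f a)).

Section HLift.
Variables (A B : augAlgType k) (W : algType k).
Variable f : series A -> series B -> series W.
Hypothesis bf : hbilin f.

Let G (X : tens A B) : series W := tlift (fun a b => f (scst a) (scst b)) X.

Let G_lin c X Y n : scoef (G (c *: X + Y)) n = c *: scoef (G X) n + scoef (G Y) n.
Proof.
have e Z : scoef (G Z) n = tlift (fun a b => scoef (f (scst a) (scst b)) n) Z.
  by rewrite /G /tlift scoef_sum.
rewrite !e; apply: tlift_linear; split=> d a b x; rewrite scst_is_linear.
  by rewrite (bf.1 _) scoefD scoefZ_cst.
by rewrite (bf.2 _) scoefD scoefZ_cst.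
Qed.

Lemma hlift_klin : klin (hlift f).
Proof. exact: slift_linear G_lin. Qed.

Lemma hlift_stens a b : hlift f (stens a b) = f a b.
Proof.
have bl := hlift_klin.
move: a; apply: series_eq_lin => [||a]; last 1 first.
- move: b; apply: series_eq_lin => [||b]; last 1 first.
  + rewrite stens_cst; transitivity (G (tpure a b)); first exact: (slift_cst G_lin).
    apply/seriesP => n; rewrite /G /tlift scoef_sum.
    have := @tlift_pure _ _ _ W (fun a b => scoef (f (scst a) (scst b)) n).
    rewrite /tlift => -> //; split=> d x y z; rewrite scst_is_linear.
      by rewrite (bf.1 _) scoefD scoefZ_cst.
    by rewrite (bf.2 _) scoefD scoefZ_cst.
  + by apply: klin_comp bl _; apply/klin_stensr/klin_id.
  + exact: bf.2.
- by apply: klin_comp bl _; apply/klin_stensl/klin_id.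
- exact: bf.1.
Qed.

Lemma hlift_trunc X N : exists d, hlift f X =
  \sum_(i < N) h ^+ i *: tlift (fun a b => f (scst a) (scst b)) (scoef X i) + h ^+ N *: d.
Proof. exact: slift_trunc. Qed.

End HLift.

Lemma klin_hlift A B W (U : lmodType K) (f : series A -> series B -> series W) F :
  hbilin f -> klin F -> klin (fun x : U => hlift f (F x)).
Proof. by move=> bf; apply: klin_comp; apply: hlift_klin. Qed.

Lemma klin_hliftp A B W (U : lmodType K) (g : U -> series A -> series B -> series W) X :
  (forall a b, klin (fun x => g x a b)) -> klin (fun x : U => hlift (g x) X).
Proof.
move=> lg c x y; rewrite -hlift_linear; congr hlift.
by apply/funext => a; apply/funext => b; rewrite lg.
Qed.

Lemma klin_smap W W' (U : lmodType K) (L : {linear W -> W'}) (F : U -> series W) :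
  klin F -> klin (fun x => smap L (F x)).
Proof. by apply: klin_comp; apply: smap_linear => c x y; rewrite linearP. Qed.

Lemma eq_hlift A B W (f g : series A -> series B -> series W) X :
  (forall a b, f a b = g a b) -> hlift f X = hlift g X.
Proof. by move=> fg; congr hlift; apply/funext => a; apply/funext => b. Qed.

End CompletedTensor.

(* The atoms are looked up among the [klin] hypotheses of the context, hence the local
   [Let] facts on Delta, counit, legs and flip in the sections below. *)
Ltac klin := lazymatch goal with
  | |- hbilin _ => split=> ?; cbv beta; klin
  | |- forall _, _ => move=> ?; cbv beta; klin
  | |- klin (fun x => x) => exact: klin_id
  | lL : klin ?L |- klin ?L => exact: lL
  | lL : klin ?L |- klin (fun x => ?L (@?F x)) => refine (klin_comp (F := F) lL _); klin
  | |- klin (fun x => hlift (@?f x) (@?F x)) =>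
      first [ refine (klin_hliftp (g := f) _ _)
            | refine (klin_hlift (f := _) (F := F) _ _) ]; klin
  | |- klin (fun x => stens _ _) => first [apply: klin_stensr | apply: klin_stensl]; klin
  | |- klin (fun x => _ * _) => first [apply: klin_mulr | apply: klin_mull]; klin
  | |- klin (fun x => _ *m _) => first [apply: klin_mulmxr | apply: klin_mulmxl]; klin
  | |- klin (fun x => _ + _) => apply: klin_add; klin
  | |- klin (fun x => - _) => apply: klin_opp; klin
  | |- klin (fun x => _ *: _) => first [apply: klin_scale | apply: klin_scalev]; klin
  | |- klin (fun x => smap _ (@?F x)) => apply: klin_smap; klin
  | |- klin (fun x => GRing.Linear.sort _ (@?F x)) => apply: klin_lfun; klin
  | bf : hbilin ?f |- klin (fun x => ?f (@?F x) (@?G x)) =>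
      first [ refine (klin_comp (L := fun y => f y _) (F := F) (bf.1 _) _)
            | refine (klin_comp (L := f _) (F := G) (bf.2 _) _) ]; klin
  | |- klin (fun x => _) => idtac
  | |- @klin ?R ?U ?V ?F => change (@klin R U V (fun x => F x)); klin
  | |- _ => idtac
  end.

Section CompletedTensorTheory.
Variable k : comNzRingType.
Local Notation K := (series k).
Implicit Types (A B C D : augAlgType k) (W : algType k).

Lemma hlift_comp A B W W' (L : series W -> series W')
    (f : series A -> series B -> series W) X :
  klin L -> hbilin f -> L (hlift f X) = hlift (fun a b => L (f a b)) X.
Proof.
move=> lL bf; have bLf : hbilin (fun a b => L (f a b)).
  by split=> c; apply: klin_comp => //; [apply: bf.1 | apply: bf.2].
move: X; apply: tens_eq_lin => [||a b].
- by apply: klin_comp => //; apply: hlift_klin.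
- exact: hlift_klin.
- by rewrite !hlift_stens.
Qed.

(** Fubini for Sweedler sums: both sides are linear in [X], and for a pure tensor [X] they are the
    same single sum over [Y]. *)
Lemma hlift_swap A B C D W
    (T : series A -> series B -> series C -> series D -> series W) X Y :
  (forall c d, hbilin (fun a b => T a b c d)) -> (forall a b, hbilin (T a b)) ->
  hlift (fun a b => hlift (T a b) Y) X =
  hlift (fun c d => hlift (fun a b => T a b c d) X) Y.
Proof.
move=> b1 b2.
have b3 : hbilin (fun a b => hlift (T a b) Y).
  by split=> z; apply: klin_hliftp => c d; [apply: (b1 c d).1 | apply: (b1 c d).2].
pose F Z := hlift (fun a b => hlift (T a b) Y) Z.
pose G Z := hlift (fun c d => hlift (fun a b => T a b c d) Z) Y.
apply: (@tens_eq_lin _ _ _ _ F G) X => [||a b].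
- exact: (hlift_klin b3).
- by apply: klin_hliftp => c d; apply: (hlift_klin (b1 c d)).
- by rewrite /F /G hlift_stens //; apply: eq_hlift => c d; rewrite hlift_stens.
Qed.

Lemma hliftM A B W (f : series A -> series B -> series W) X Y : hbilin f ->
  hlift f (X * Y) = hlift (fun a b => hlift (fun c d => f (a * c) (b * d)) Y) X.
Proof.
move=> bf; have bf' a b : hbilin (fun c d => f (a * c) (b * d)).
  by klin.
have bf'' : hbilin (fun a b => hlift (fun c d => f (a * c) (b * d)) Y).
  by klin.
pose F Z := hlift f (Z * Y).
pose G Z := hlift (fun a b => hlift (fun c d => f (a * c) (b * d)) Y) Z.
apply: (@tens_eq_lin _ _ _ _ F G) X => [||a b].
- by rewrite /F; klin.
- by rewrite /G; klin.
rewrite /F /G hlift_stens // {F G bf''}.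
apply: (@tens_eq_lin _ _ _ _ (fun Z => hlift f (stens a b * Z))
  (hlift (fun c d => f (a * c) (b * d)))) Y => [||c d].
- by klin.
- by klin.
- by rewrite stensM !hlift_stens.
Qed.

Lemma hlift_cst0 A B W (f : series A -> series B -> series W) X : hbilin f ->
  scoef (hlift f X) 0 = tlift (fun a b => scoef (f (scst a) (scst b)) 0) (scoef X 0).
Proof.
move=> bf; have [d ->] := hlift_trunc f X 1.
rewrite big_ord1 expr0 scale1r scoefD scoef_hvarZ // addr0 /tlift.
by rewrite scoef_sum.
Qed.

Section Inverse.
Variable W : algType k.
Implicit Types x y : series W.

Lemma ringinvP (R : nzRingType) (x y : R) :
  x * y = 1 -> y * x = 1 -> x * ringinv x = 1 /\ ringinv x * x = 1.
Proof.
move=> xy yx; rewrite /ringinv; case: xgetP => [z _ []|] //.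
by move/(_ y)/(_ (conj xy yx)).
Qed.

(** The coefficients solve y_n = [n = 0] - sum over i < n of x_(n-i) y_i; [step] appends the next
    one to the list of those already found, so that the recursion runs on the length of that
    list. *)
Lemma series_rinv x : scoef x 0 = 1 -> exists y, x * y = 1.
Proof.
move=> x0.
pose step (s : seq W) := rcons s ((size s == 0)%:R - \sum_(i < size s) scoef x (size s - i) * s`_i).
pose y := Series (fun n => (iter n.+1 step [::])`_n).
have sz n : size (iter n step [::]) = n by elim: n => //= n IH; rewrite size_rcons IH.
have stab n m i : (i < n)%N -> (n <= m)%N -> (iter m step [::])`_i = (iter n step [::])`_i.
  move=> lt_in /subnKC <-; elim: (m - n)%N => [|d IH]; first by rewrite addn0.
  by rewrite addnS /= {1}/step nth_rcons sz ltn_addr.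
exists y; apply/seriesP => n; rewrite [LHS]/= (reindex_inj rev_ord_inj) /= big_ord_recr /=.
rewrite subSS subnn x0 mul1r subn0 {1}/step nth_rcons sz ltnn eqxx.
rewrite addrC -[RHS]addr0 -[X in X = _]addrA.
have -> : (if n == 0%N then 1 else 0) = (n == 0)%:R :> W by case: eqP.
congr (_ + _); apply/eqP; rewrite addrC subr_eq0; apply/eqP; apply: eq_bigr => i _.
transitivity (scoef x (n - i) * scoef y (n - (n - i))); first by rewrite -subSS.
have -> m : scoef y m = (iter m.+1 step [::])`_m by [].
by rewrite subKn 1?ltnW // (stab i.+1 n).
Qed.

(** A right inverse y also has constant term 1, so it has a right inverse z in turn; then z = x, and
    y is two-sided although the ring is not commutative. *)
Lemma series_inv x : scoef x 0 = 1 -> x * ringinv x = 1 /\ ringinv x * x = 1.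
Proof.
move=> x0; have [y xy] := series_rinv x0.
have y0 : scoef y 0 = 1.
  by have := congr1 (fun z => scoef z 0) xy; rewrite scoef0M x0 mul1r.
have [z yz] := series_rinv y0; have zx : z = x by rewrite -[z]mul1r -xy -mulrA yz mulr1.
by apply: (ringinvP xy); rewrite -zx.
Qed.

Lemma ringinv_0 x : scoef x 0 = 1 -> scoef (ringinv x) 0 = 1.
Proof.
move=> x0; have [/(congr1 (fun z => scoef z 0)) + _] := series_inv x0.
by rewrite scoef0M x0 mul1r.
Qed.

End Inverse.

Lemma smap_rmorphM W W' (f : {rmorphism W -> W'}) (x y : series W) :
  smap f (x * y) = smap f x * smap f y.
Proof.
apply/seriesP => n /=; rewrite rmorph_sum; apply: eq_bigr => i _.
by rewrite rmorphM.
Qed.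

Lemma smap_rmorph1 W W' (f : {rmorphism W -> W'}) : smap f (1 : series W) = 1.
Proof. by apply/seriesP => n /=; case: eqP; rewrite ?rmorph1 ?raddf0. Qed.

End CompletedTensorTheory.

(** * Enveloping algebras and the Poincare-Birkhoff-Witt theorem *)

Section EnvelopingLift.
Variables (k : comNzRingType) (g : lmodType k) (br : g -> g -> g).
Local Notation U := (uenv br).
Local Notation iota := (ugen br).

Lemma ugen_linear : linear iota.
Proof. by move=> c x y; rewrite /ugen !linearP. Qed.
HB.instance Definition _ := GRing.isLinear.Build k g U _ iota ugen_linear.

Lemma ugen_br x y : iota (br x y) = iota x * iota y - iota y * iota x.
Proof.
apply/esym/eqP; rewrite -subr_eq0 /ugen -!rmorphM -!rmorphB /=; apply/eqP.
by apply: qpi_gen; exists x, y.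
Qed.

Variables (B : algType k) (f : g -> B).
Hypothesis f_lin : linear f.
Hypothesis f_br : forall x y, f (br x y) = f x * f y - f y * f x.

Let kapC (c : k) (b : B) : GRing.comm (in_alg B c) b.
Proof. by rewrite /GRing.comm /= mulr_algl mulr_algr. Qed.
Let f_kap c x y : f (c *: x + y) = in_alg B c * f x + f y.
Proof. by rewrite f_lin mulr_algl. Qed.

Local Notation tl := (tens_lift kapC f_kap).

Let tl_rel z : envrel br z -> tl z = 0.
Proof.
case=> x [y] ->; rewrite !rmorphB !rmorphM /= !tens_lift_gen f_br.
by rewrite subrr.
Qed.

(** Convertible to [ulift] for the same [f], but equipped with morphism structures; this is why
    [comulhE] replaces [comul0] by [comul0r] by computation alone. *)
Definition uliftr : U -> B := quot_lift (F := tl) tl_rel.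
HB.instance Definition _ := GRing.RMorphism.on uliftr.

Lemma uliftr_gen x : uliftr (iota x) = f x.
Proof. by rewrite /uliftr /ugen quot_liftE /= tens_lift_gen. Qed.

Lemma uliftr_scalable : scalable uliftr.
Proof.
move=> c; elim/qind => x; rewrite -linearZ /uliftr !quot_liftE /= tens_liftZ.
by rewrite /= mulr_algl.
Qed.
HB.instance Definition _ := GRing.isScalable.Build k U B *:%R uliftr uliftr_scalable.

End EnvelopingLift.

Section Comul0.
Variables (k : fieldType) (n : nat).
Local Notation g := (sl k n).
Local Notation U := (uenv (@slbr k n)).
Local Notation U2 := (tens U U).
Local Notation iota := (ugen (@slbr k n)).

Let f (x : g) : U2 := tpure (iota x) 1 + tpure 1 (iota x).

Let f_lin : linear f.
Proof.
move=> c x y; rewrite /f linearP /= tpureDl tpureZl tpureDr tpureZr.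
by rewrite addrACA scalerDr.
Qed.

Let f_br x y : f (slbr x y) = f x * f y - f y * f x.
Proof.
rewrite /f !mulrDl !mulrDr.
have m (a b c d : U) : tpure a b * tpure c d = tpure (a * c) (b * d) := tmul_pure a b c d.
rewrite !m !mul1r !mulr1 ugen_br -!scaleN1r tpureDl tpureDr tpureZl tpureZr !scaleN1r.
set a := tpure (iota x * iota y) 1; set b := tpure (iota y * iota x) 1.
set c := tpure 1 (iota x * iota y); set d := tpure 1 (iota y * iota x).
set u := tpure (iota x) (iota y); set v := tpure (iota y) (iota x).
rewrite [in RHS]opprD [RHS]addrACA ![in RHS]opprD.
rewrite [X in _ = X + _]addrACA [X in _ = _ + X]addrACA -[RHS]addrA; congr (_ + _).
by rewrite [RHS]addrA -[v - u]opprB addrN add0r.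
Qed.

Definition comul0r : U -> U2 := uliftr f_lin f_br.
HB.instance Definition _ := GRing.RMorphism.on comul0r.
HB.instance Definition _ := GRing.Linear.on comul0r.

Lemma comul0_gen x : comul0r (iota x) = tpure (iota x) 1 + tpure 1 (iota x).
Proof. by rewrite /comul0r uliftr_gen. Qed.

End Comul0.

Section Splits.
Variable T : eqType.
Implicit Types (w s : seq T) (p : seq T * seq T).

(** These are the terms, with repetitions, of the coproduct of a product of primitive elements: each
    letter goes to the left or to the right factor, in order. *)
Fixpoint splits w : seq (seq T * seq T) :=
  if w is a :: w' then
    [seq (a :: p.1, p.2) | p <- splits w'] ++ [seq (p.1, a :: p.2) | p <- splits w']
  else [:: ([::], [::])].

Lemma splits_perm w p : p \in splits w -> perm_eq (p.1 ++ p.2) w.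
Proof.
elim: w p => [|a w IH] p /=; first by rewrite inE => /eqP ->.
rewrite mem_cat => /orP[] /mapP[q /IH pq ->] /=; first by rewrite perm_cons.
by rewrite -cat1s perm_catCA /= perm_cons.
Qed.

Lemma splits_nil w : ([::], w) \in splits w.
Proof.
elim: w => [|a w IH] //=; rewrite mem_cat; apply/orP; right.
by apply/mapP; exists ([::], w).
Qed.

Lemma splits_rem w i : i \in w -> ([:: i], rem i w) \in splits w.
Proof.
elim: w => // a w IH; rewrite inE /= mem_cat eq_sym.
have [->|ne] := eqVneq a i => iw; apply/orP.
  by left; apply/mapP; exists ([::], w) => //; apply: splits_nil.
by right; apply/mapP; exists ([:: i], rem i w) => //; apply: IH.
Qed.

End Splits.

Section PBW.
Variables (k : fieldType) (n d : nat).
Hypothesis char0 : forall m, m.+1%:R != 0 :> k.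
Local Notation g := (sl k n).
Local Notation U := (uenv (@slbr k n)).
Local Notation iota := (ugen (@slbr k n)).

Variables (e : 'I_d -> g) (phi : 'I_d -> U -> k^o).
Hypothesis phi_lin : forall i, linear (phi i).
Hypothesis phi1 : forall i, phi i 1 = 0.
Hypothesis phi_gen : forall i j, phi i (iota (e j)) = (i == j)%:R.

Definition umon (w : seq 'I_d) : U := \prod_(i <- w) iota (e i).

Lemma umon_cons i w : umon (i :: w) = iota (e i) * umon w.
Proof. by rewrite /umon big_cons. Qed.

Lemma comul0_umon w :
  comul0r (umon w) = \sum_(p <- splits w) tpure (umon p.1) (umon p.2).
Proof.
elim: w => [|i w IH].
  by rewrite /umon !big_nil rmorph1 /= big_seq1 /= !big_nil.
rewrite umon_cons rmorphM /= comul0_gen IH mulrDl big_cat !big_map !mulr_sumr /=.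
congr (_ + _); apply: eq_bigr => p _; rewrite umon_cons.
  by rewrite [LHS]tmul_pure mul1r.
by rewrite [LHS]tmul_pure mul1r.
Qed.

(* The convolution product of the functionals [phi i], i in s, with respect to [comul0r]. *)
Fixpoint uconv (s : seq 'I_d) : U -> k^o :=
  if s is i :: s' then fun u => tlift (fun a b => phi i a * uconv s' b : k^o) (comul0r u)
  else fun u => aug u.

Lemma uconv_linear s : linear (uconv s).
Proof.
elim: s => [|i s IH] /=; first by move=> c x y; rewrite aug_linear.
move=> c x y; rewrite linearP; apply: tlift_linear; split=> a b u v.
  by rewrite phi_lin /GRing.scale /= mulrDl mulrA.
by rewrite IH /GRing.scale /= mulrDr mulrCA.
Qed.

Lemma uconv_cons i s w : uconv (i :: s) (umon w) =
  \sum_(p <- splits w) phi i (umon p.1) * uconv s (umon p.2).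
Proof.
have b : tbilin (fun a b => phi i a * uconv s b : k^o).
  split=> a x u v; first by rewrite phi_lin /GRing.scale /= mulrDl mulrA.
  by rewrite uconv_linear /GRing.scale /= mulrDr mulrCA.
pose F := tlift (fun a b => phi i a * uconv s b : k^o).
have FD x y : F (x + y) = F x + F y by have := tlift_linear b 1 x y; rewrite !scale1r.
have F0 : F 0 = 0 by apply: (addrI (F 0)); rewrite -FD !addr0.
rewrite /= comul0_umon -/F (big_morph F FD F0).
by apply: eq_bigr => p _; rewrite /F (tlift_pure b).
Qed.

Lemma uconv_nil w : uconv [::] (umon w) = (w == [::])%:R.
Proof.
case: w => [|i w] /=; first by rewrite /umon big_nil aug1.
rewrite umon_cons augM; suff -> : aug (iota (e i)) = 0 by rewrite mul0r.
by rewrite /ugen [LHS]qaugE tensgen_aug.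
Qed.

(** Every [phi i] vanishes at 1, so each factor of the convolution product uses up at least one
    letter of w. *)
Lemma uconv_small s w : (size w < size s)%N -> uconv s (umon w) = 0.
Proof.
elim: s w => [|i s IH] // w lt_w; rewrite uconv_cons big_seq big1 // => p.
move/splits_perm/perm_size; rewrite size_cat => szp.
case e1 : p.1 => [|j p1]; first by rewrite /umon big_nil phi1 mul0r.
rewrite IH ?mulr0 //; move: lt_w; rewrite -szp e1 /= addSn !ltnS.
by apply: leq_ltn_trans; apply: leq_addl.
Qed.

(* With [uconv_small]: against sorted monomials the functionals [uconv s] are triangular,
   with nonzero diagonal entries in characteristic 0. *)
Lemma uconv_perm s w : size w = size s ->
  exists2 m : nat, uconv s (umon w) = m%:R & (0 < m)%N = perm_eq s w.
Proof.
elim: s w => [|i s IH] w szw.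
  exists (w == [::] : nat); first exact: uconv_nil.
  by case: w szw.
rewrite uconv_cons.
(* A split contributes only if its left part is the single letter i: an empty left part is killed by
   [phi1], and a left part of two letters or more leaves too short a word for [s]. *)
have /choice[F FE] : forall p, exists Fp : nat, p \in splits w ->
   phi i (umon p.1) * uconv s (umon p.2) = Fp%:R /\
   (0 < Fp)%N = (p.1 == [:: i]) && perm_eq s p.2.
  move=> p; have [/splits_perm/perm_size|//] := boolP (p \in splits w).
    rewrite size_cat szw => szp.
    case e1 : p.1 szp => [|j [|j' p1]] szp.
    - by exists 0%N => _; rewrite /umon big_nil phi1 mul0r.
    - have [|m um m0] := IH p.2; first by case: szp.
      exists ((i == j) * m)%N => _; rewrite um /umon big_seq1 phi_gen natrM.
      by split=> //; rewrite muln_gt0 m0 eqseq_cons andbT eq_sym lt0b.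
    - exists 0%N => _; split; last by rewrite eqseq_cons andbF.
      rewrite uconv_small ?mulr0 //; case: szp => /= <-.
      by rewrite addSn ltnS leq_addl.
  by exists 0%N.
exists (\sum_(p <- splits w) F p)%N.
  by rewrite natr_sum; apply: eq_big_seq => p /FE[].
rewrite lt0n sum_nat_seq_neq0; apply/hasP/idP.
  move=> [p pw] /=; rewrite -lt0n (FE _ pw).2 => /andP[/eqP p1 sp].
  by rewrite -(permPr (splits_perm pw)) p1 /= perm_cons.
move=> isw; have iw : i \in w by rewrite -(perm_mem isw) mem_head.
exists ([:: i], rem i w); first exact: splits_rem.
rewrite /= -lt0n (FE _ (splits_rem iw)).2 eqxx /=.
by rewrite -(perm_cons i) (permPl isw) perm_to_rem.
Qed.

Definition ole (i j : 'I_d) := (i <= j)%N.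

Lemma ole_perm_eq s t : sorted ole s -> sorted ole t -> perm_eq s t -> s = t.
Proof.
apply: sorted_eq; first by move=> i j l; apply: leq_trans.
by move=> i j /anti_leq/val_inj.
Qed.

(** Descending induction on length: once the coefficients of all longer words vanish, [uconv s]
    kills the shorter words and the other sorted words of the length of s, and what is left is [c s]
    times a positive integer. *)
Theorem pbw_free (S : seq (seq 'I_d)) (c : seq 'I_d -> k) :
    uniq S -> all (sorted ole) S -> \sum_(s <- S) c s *: umon s = 0 ->
  forall s, s \in S -> c s = 0.
Proof.
move=> uS /allP sS c0; pose M := \max_(s <- S) size s.
(* [M] is the maximal length in [S]: stage 0 concerns no word, and stage M + 1 concerns them all. *)
suff H m s : s \in S -> (M < size s + m)%N -> c s = 0.
  by move=> s Ss; apply: (H M.+1) => //; rewrite addnS ltnS leq_addl.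
elim: m s => [|m IH] s Ss.
  by rewrite addn0 ltnNge /M (big_rem _ Ss) /= leq_maxl.
rewrite addnS ltnS leq_eqVlt => /orP[/eqP Mm|]; last exact: IH.
have [a ua a0] := uconv_perm (erefl (size s)).
have := congr1 (uconv s) c0.
have ul := uconv_linear s; have u0 : uconv s 0 = 0.
  by have := ul (-1) 0 0; rewrite scaler0 addr0 scaleN1r addNr.
have uD x y : uconv s (x + y) = uconv s x + uconv s y.
  by have := ul 1 x y; rewrite !scale1r.
rewrite (big_morph _ uD u0) u0 (bigD1_seq s) //= big_seq_cond big1 => [|t].
  have := ul (c s) (umon s) 0; rewrite u0 !addr0 => ->; rewrite ua => /eqP.
  rewrite mulf_eq0 => /orP[/eqP //|].
  by move: a0; rewrite perm_refl; case: a {ua} => // a _; rewrite (negPf (char0 a)).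
case/andP => St ts; have := ul (c t) (umon t) 0; rewrite u0 !addr0 => ->.
case: (ltngtP (size t) (size s)) => [lt|gt|eq].
- by rewrite uconv_small // scaler0.
- by rewrite (IH t) ?scale0r // Mm ltn_add2r.
- have [b -> b0] := uconv_perm eq; move: b0; case: b => [|b]; first by rewrite scaler0.
  by move/esym/(ole_perm_eq (sS _ Ss) (sS _ St)) => est; rewrite est eqxx in ts.
Qed.

End PBW.

(** * Sweedler calculus and the adjoint action *)

Section Sweedler.
Variables (k : fieldType) (n : nat) (H : qea k n).
Local Notation g := (sl k n).
Local Notation U := (uenv (@slbr k n)).
Local Notation U2 := (tens U U).
Local Notation Uh := (series U).
Local Notation K := (series k).
Local Notation iota := (ugen (@slbr k n)).
Local Notation Delta := (comulh H).
Local Notation gam := (antipode H).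
Local Notation F := (twist H).

Lemma twist_inv : F * ringinv F = 1 /\ ringinv F * F = 1.
Proof. by apply: series_inv; apply: twist0. Qed.

Lemma comulhE x : Delta x = F * smap (@comul0r k n) x * ringinv F.
Proof. by []. Qed.

Lemma comulh_klin : klin Delta.
Proof.
rewrite (_ : Delta = fun x => F * smap (@comul0r k n) x * ringinv F) //.
by klin.
Qed.

Lemma comulhM x y : Delta (x * y) = Delta x * Delta y.
Proof.
have conjM (R : nzRingType) (f f' a b : R) : f' * f = 1 ->
    f * (a * b) * f' = f * a * f' * (f * b * f').
  by move=> ff; rewrite !mulrA -[_ * f' * f]mulrA ff mulr1.
by rewrite !comulhE smap_rmorphM; apply: conjM; apply: twist_inv.2.
Qed.

Lemma comulh1 : Delta 1 = 1.
Proof. by rewrite comulhE smap_rmorph1 mulr1 twist_inv.1. Qed.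

Lemma comulh_0 x : scoef (Delta x) 0 = comul0r (scoef x 0).
Proof.
have F0 := twist0 H.
by rewrite comulhE !scoef0M F0 ringinv_0 // mul1r mulr1.
Qed.

Lemma counith_klin : klin (@counith k n : Uh -> K^o).
Proof.
by apply: (@smap_linear k U k^o aug) => c x y; rewrite aug_linear.
Qed.

Lemma counithM (x y : Uh) : counith (x * y) = counith x * counith y.
Proof.
apply/seriesP => i; rewrite /= rmorph_sum; apply: eq_bigr => j _.
by rewrite rmorphM.
Qed.

Lemma counith1 : counith (1 : Uh) = 1 :> K.
Proof. by apply/seriesP => i; rewrite /=; case: eqP; rewrite ?aug1 ?aug0. Qed.

Local Opaque comulh hlift stens.

Let lD : klin Delta := comulh_klin.
Let le : klin (@counith k n : Uh -> K^o) := counith_klin.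

Implicit Types W : algType k.

Section Trilinear.
Variables (W : algType k) (T : Uh -> Uh -> Uh -> series W).
Hypothesis T1 : forall b c, klin (fun a => T a b c).
Hypothesis T2 : forall a c, klin (fun b => T a b c).
Hypothesis T3 : forall a b, klin (fun c => T a b c).

(** The trilinear [T] factors through a linear map [L] on the triple completed tensor product; [L]
    applied to the two sides of [comulh_coassoc] gives the two iterated sums. *)
Lemma comulhA x :
  hlift (fun u c => hlift (fun a b => T a b c) (Delta u)) (Delta x) =
  hlift (fun a u => hlift (fun b c => T a b c) (Delta u)) (Delta x).
Proof.
have b12 c : hbilin (fun a b => T a b c) by split=> *; [apply: T1|apply: T2].
have b23 a : hbilin (fun b c => T a b c) by split=> *; [apply: T2|apply: T3].
have [L [lL L3]] : exists L : series (tens U U2) -> series W,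
    klin L /\ forall a b c, L (stens a (stens b c)) = T a b c.
  have bL : hbilin (fun a bc => hlift (fun b c => T a b c) bc).
    by split=> z; [apply: klin_hliftp => b c; apply: T1 | apply: hlift_klin].
  by exists (hlift (fun a bc => hlift (fun b c => T a b c) bc)); split;
     [apply: hlift_klin | move=> a b c; rewrite !hlift_stens].
transitivity (L (comul_id Delta (Delta x))).
  rewrite /comul_id (hlift_comp (L := L)) //; last by klin.
  apply: eq_hlift => a b; rewrite (hlift_comp (L := L)) //; last by klin.
  by apply: eq_hlift => a1 a2.
rewrite (comulh_coassoc H x) /id_comul (hlift_comp (L := L)) //; last by klin.
apply: eq_hlift => a b.
apply: (tens_eq_lin (F := fun X => L (stens a X)) (G := hlift (T a))).
- by klin.
- exact: hlift_klin.
- by move=> b1 b2; rewrite L3 hlift_stens.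
Qed.

End Trilinear.

Lemma counit_l (W : algType k) (L : Uh -> series W) x : klin L ->
  hlift (fun a b => counith a *: L b) (Delta x) = L x.
Proof.
move=> lL; rewrite -[in RHS](counithl H x) (hlift_comp (L := L)) //; last by klin.
by apply: eq_hlift => a b; rewrite (klinZ lL).
Qed.

Lemma counit_r (W : algType k) (L : Uh -> series W) x : klin L ->
  hlift (fun a b => counith b *: L a) (Delta x) = L x.
Proof.
move=> lL; rewrite -[in RHS](counithr H x) (hlift_comp (L := L)) //; last by klin.
by apply: eq_hlift => a b; rewrite (klinZ lL).
Qed.

Lemma antipode1 : gam 1 = 1.
Proof.
have := antipodel H 1; rewrite comulh1 -stens1 hlift_stens; last by klin.
by rewrite mulr1 counith1 scale1r.
Qed.

Lemma adh_klinl y : klin (fun x => adh H x y).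
Proof. by rewrite /adh; klin. Qed.
Lemma adh_klinr x : klin (adh H x).
Proof. by rewrite /adh; klin. Qed.

Lemma antipode_mull (L : Uh -> Uh) u : klin L ->
  hlift (fun a b => L (gam a * b)) (Delta u) = counith u *: L 1.
Proof.
move=> lL; rewrite -(hlift_comp (L := L) (f := fun a b => gam a * b)) //; last by klin.
by rewrite antipodel (klinZ lL).
Qed.

Lemma antipode_mulr (L : Uh -> Uh) u : klin L ->
  hlift (fun a b => L (a * gam b)) (Delta u) = counith u *: L 1.
Proof.
move=> lL; rewrite -(hlift_comp (L := L) (f := fun a b => a * gam b)) //; last by klin.
by rewrite antipoder (klinZ lL).
Qed.

(* gam is the inverse, for the convolution product, of the identity; both gam \o mul
   and its opposite are then convolution inverses of the multiplication. *)
Lemma antipodeM x y : gam (x * y) = gam y * gam x.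
Proof.
(* In Sweedler notation this is gamma(x1 y1) x2 y2 gamma(y3) gamma(x3), with a, b1, b2 from x and c,
   d1, d2 from y. Contracting from the right end gives gamma(xy), contracting from the left end
   gives gamma(y) gamma(x). *)
pose G (a b1 b2 c d1 d2 : Uh) : Uh := gam (a * c) * b1 * d1 * gam d2 * gam b2.
transitivity (hlift (fun a b => hlift (fun c d => hlift (fun b1 b2 =>
    hlift (fun d1 d2 => G a b1 b2 c d1 d2) (Delta d)) (Delta b)) (Delta y)) (Delta x)).
  rewrite -[in LHS](counit_r (L := fun z => gam (z * y)) x); last by klin.
  apply: eq_hlift => a b.
  rewrite -[in LHS](counit_r (L := fun z => gam (a * z)) y); last by klin.
  rewrite (hlift_comp (L := fun z => counith b *: z)); [|by klin|by klin].
  apply: eq_hlift => c d.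
  rewrite (eq_hlift _ (g := fun b1 b2 => counith d *: (gam (a * c) * (b1 * gam b2)))); last first.
    move=> b1 b2; rewrite /G; under eq_hlift => d1 d2 do rewrite -[_ * d1 * _]mulrA.
    rewrite (antipode_mulr (L := fun z => gam (a * c) * b1 * z * gam b2)); last by klin.
    by rewrite mulr1 mulrA.
  rewrite (antipode_mulr (L := fun z => counith d *: (gam (a * c) * z))); last by klin.
  by rewrite mulr1.
transitivity (hlift (fun a b => hlift (fun b1 b2 => hlift (fun v d2 =>
    hlift (fun c d1 => G a b1 b2 c d1 d2) (Delta v)) (Delta y)) (Delta b)) (Delta x)).
  apply: eq_hlift => a b.
  refine (etrans (hlift_swap (T := fun c d b1 b2 : Uh =>
    hlift (fun d1 d2 => G a b1 b2 c d1 d2) (Delta d)) (Delta y) (Delta b) _ _) _).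
  - by rewrite /G; klin.
  - by rewrite /G; klin.
  apply: eq_hlift => b1 b2.
  apply/esym.
  refine (comulhA (T := fun c d1 d2 : Uh => G a b1 b2 c d1 d2) _ _ _ _).
  - by rewrite /G; klin.
  - by rewrite /G; klin.
  - by rewrite /G; klin.
rewrite -(comulhA (T := fun a b1 b2 : Uh => hlift (fun v d2 =>
    hlift (fun c d1 => G a b1 b2 c d1 d2) (Delta v)) (Delta y)));
  try by move=> *; rewrite /G; klin.
rewrite -[RHS](counit_l (L := fun z => gam y * gam z) x); last by klin.
apply: eq_hlift => u b2.
refine (etrans (hlift_swap (T := fun a b1 v d2 : Uh =>
  hlift (fun c d1 => G a b1 b2 c d1 d2) (Delta v)) (Delta u) (Delta y) _ _) _).
- by rewrite /G; klin.
- by rewrite /G; klin.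
rewrite -[in RHS](counit_l (L := fun z => gam z * gam b2) y); last by klin.
rewrite (hlift_comp (L := fun z => counith u *: z)); [|by klin|by klin].
apply: eq_hlift => v d2.
transitivity (hlift (fun p q => gam p * q * (gam d2 * gam b2)) (Delta (u * v))).
  rewrite comulhM (hliftM (f := fun p q => gam p * q * (gam d2 * gam b2))); last by klin.
  by apply: eq_hlift => a b1; apply: eq_hlift => c d1; rewrite /G !mulrA.
rewrite (antipode_mull (L := fun z => z * (gam d2 * gam b2))); last by klin.
by rewrite counithM mul1r scalerA.
Qed.

Lemma adhM x y z : adh H (x * y) z = adh H x (adh H y z).
Proof.
rewrite /adh comulhM (hliftM (f := fun a b => a * z * gam b)); last by klin.
apply: eq_hlift => a b.
rewrite (hlift_comp (L := fun w => a * w * gam b)); [|by klin|by klin].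
by apply: eq_hlift => c d; rewrite antipodeM !mulrA.
Qed.

Lemma adh1 z : adh H 1 z = z.
Proof.
rewrite /adh comulh1 -stens1 hlift_stens; last by klin.
by rewrite antipode1 mul1r mulr1.
Qed.

Lemma adh_mul_swap x y : hlift (fun a b => adh H a y * b) (Delta x) = x * y.
Proof.
transitivity (hlift (fun u b => hlift (fun a1 a2 => a1 * y * (gam a2 * b)) (Delta u)) (Delta x)).
  apply: eq_hlift => u b.
  rewrite /adh (hlift_comp (L := fun w => w * b)); [|by klin|by klin].
  by apply: eq_hlift => a1 a2; rewrite !mulrA.
rewrite (comulhA (T := fun a1 a2 b => a1 * y * (gam a2 * b))); try by move=> *; klin.
rewrite -[RHS](counit_r (L := fun z => z * y) x); last by klin.
apply: eq_hlift => a1 w.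
by rewrite (antipode_mull (L := fun z => a1 * y * z)) ?mulr1 //; klin.
Qed.

(** In x1 y gamma(x2) x3 z gamma(x4) the inner pair gamma(x2) x3 cancels. So U_h(g) is a module
    algebra over itself, which is where the invariance of the multiplication comes from. *)
Lemma adh_mul x y z :
  adh H x (y * z) = hlift (fun a b => adh H a y * adh H b z) (Delta x).
Proof.
transitivity (hlift (fun a w => hlift (fun b1 b2 => adh H a y * b1 * (z * gam b2)) (Delta w))
   (Delta x)); last first.
  apply: eq_hlift => a b.
  rewrite /(adh H b z) (hlift_comp (L := fun w => adh H a y * w)); [|by klin|by klin].
  by apply: eq_hlift => b1 b2; rewrite !mulrA.
have la := adh_klinl y.
rewrite -(comulhA (T := fun a b1 b2 => adh H a y * b1 * (z * gam b2)));
  try by move=> *; klin.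
apply: eq_hlift => w b2.
rewrite -(hlift_comp (L := fun v => v * (z * gam b2)) (f := fun a b1 => adh H a y * b1));
  [|by klin|by klin].
by rewrite adh_mul_swap !mulrA.
Qed.

End Sweedler.

(** * The element Q and the reflection map *)

Section Legs.
Variables (k : fieldType) (n : nat).
Local Notation U := (uenv (@slbr k n)).
Local Notation U2 := (tens U U).
Local Notation U3 := (tens U U2).
Local Notation Uh := (series U).

Lemma smap_tlift_klin (W : algType k) (f : U -> U -> W) : tbilin f ->
  klin (smap (tlift f) : series U2 -> series W).
Proof. by move=> bf; apply: smap_linear => c x y; apply: tlift_linear. Qed.

Lemma smap_tlift_cst (W : algType k) (f : U -> U -> W) : tbilin f ->
  forall a b, smap (tlift f) (stens (scst a) (scst b)) = scst (f a b).
Proof.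
move=> bf a b; rewrite stens_cst; apply/seriesP => i /=; case: eqP => _.
  by rewrite tlift_pure.
by have := tlift_linear bf (-1) 0 0; rewrite scaler0 addr0 scaleN1r addNr.
Qed.

Lemma smap_tlift_stens (W : algType k) (f : U -> U -> W) (F : Uh -> Uh -> series W) :
    tbilin f -> hbilin F -> (forall a b, F (scst a) (scst b) = scst (f a b)) ->
  forall a b, smap (tlift f) (stens a b) = F a b.
Proof.
move=> bf bF fF a b; have lf := smap_tlift_klin bf.
apply: (series_eq_lin (F := fun a => smap (tlift f) (stens a b)) (G := fun a => F a b)) => [||{}a].
- by klin.
- by klin.
apply: (series_eq_lin (F := fun b => smap (tlift f) (stens (scst a) b)) (G := F (scst a))) => [||{}b].
- by klin.
- by klin.
by rewrite smap_tlift_cst // fF.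
Qed.

Let bflip : tbilin (fun a b : U => tpure b a).
Proof. by split=> *; rewrite ?tpureDl ?tpureDr ?tpureZl ?tpureZr. Qed.
Let b12 : tbilin (fun a b : U => tpure a (tpure b (1 : U))).
Proof. by split=> *; rewrite !(tpureDl, tpureDr, tpureZl, tpureZr). Qed.
Let b13 : tbilin (fun a b : U => tpure a (tpure (1 : U) b)).
Proof. by split=> *; rewrite !(tpureDl, tpureDr, tpureZl, tpureZr). Qed.
Let b23 : tbilin (fun a b : U => tpure (1 : U) (tpure a b)).
Proof. by split=> *; rewrite !(tpureDl, tpureDr, tpureZl, tpureZr). Qed.

Lemma sflip_klin : klin (smap (@flip k n)). Proof. exact: smap_tlift_klin. Qed.
Lemma leg12_klin : klin (smap (@leg12 k n)). Proof. exact: smap_tlift_klin. Qed.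
Lemma leg13_klin : klin (smap (@leg13 k n)). Proof. exact: smap_tlift_klin. Qed.
Lemma leg23_klin : klin (smap (@leg23 k n)). Proof. exact: smap_tlift_klin. Qed.

Lemma sflip_stens (a b : Uh) : smap (@flip k n) (stens a b) = stens b a.
Proof.
apply: (smap_tlift_stens (F := fun a b => stens b a)) => //; first by klin.
by move=> *; rewrite stens_cst.
Qed.
Lemma leg12_stens (a b : Uh) : smap (@leg12 k n) (stens a b) = stens a (stens b 1).
Proof.
apply: (smap_tlift_stens (F := fun a b => stens a (stens b 1))) => //; first by klin.
by move=> *; rewrite -scst1 !stens_cst.
Qed.
Lemma leg13_stens (a b : Uh) : smap (@leg13 k n) (stens a b) = stens a (stens 1 b).
Proof.
apply: (smap_tlift_stens (F := fun a b => stens a (stens 1 b))) => //; first by klin.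
by move=> *; rewrite -scst1 !stens_cst.
Qed.
Lemma leg23_stens (a b : Uh) : smap (@leg23 k n) (stens a b) = stens 1 (stens a b).
Proof.
apply: (smap_tlift_stens (F := fun a b => stens 1 (stens a b))) => //; first by klin.
by move=> *; rewrite -scst1 !stens_cst.
Qed.

Lemma klin_mult (W : algType k) (L : series U2 -> series W) : klin L ->
    (forall a b c d, L (stens a b * stens c d) = L (stens a b) * L (stens c d)) ->
  forall X Y, L (X * Y) = L X * L Y.
Proof.
move=> lL LM X Y.
apply: (tens_eq_lin (F := fun X => L (X * Y)) (G := fun X => L X * L Y)) => [||a b].
- by klin.
- by klin.
apply: (tens_eq_lin (F := fun Y => L (_ * Y)) (G := fun Y => _ * L Y)) => [||c d].
- by klin.
- by klin.
exact: LM.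
Qed.

Lemma sflipM (X Y : series U2) :
  smap (@flip k n) (X * Y) = smap (@flip k n) X * smap (@flip k n) Y.
Proof.
by apply: (klin_mult sflip_klin) => *; rewrite !sflip_stens !stensM sflip_stens.
Qed.
Lemma leg13M (X Y : series U2) :
  smap (@leg13 k n) (X * Y) = smap (@leg13 k n) X * smap (@leg13 k n) Y.
Proof.
by apply: (klin_mult leg13_klin) => *; rewrite stensM !leg13_stens !stensM mul1r.
Qed.

Lemma sflipK (X : series U2) : smap (@flip k n) (smap (@flip k n) X) = X.
Proof.
have lf := sflip_klin.
apply: (tens_eq_lin (F := fun X => smap (@flip k n) (smap (@flip k n) X)) (G := fun X => X)).
- by klin.
- by klin.
by move=> a b; rewrite !sflip_stens.
Qed.

Lemma hlift_stens_id (X : series U2) : hlift (fun a b => stens a b) X = X.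
Proof.
apply: (tens_eq_lin (G := fun X => X)) => [||a b]; [by klin|by klin|].
by rewrite hlift_stens //; klin.
Qed.

End Legs.

Section Reflection.
Variables (k : fieldType) (n : nat) (H : qea k n) (V : basic_rep H).
Local Notation g := (sl k n).
Local Notation U := (uenv (@slbr k n)).
Local Notation U2 := (tens U U).
Local Notation U3 := (tens U U2).
Local Notation Uh := (series U).
Local Notation K := (series k).
Local Notation iota := (ugen (@slbr k n)).
Local Notation Delta := (comulh H).
Local Notation gam := (antipode H).
Local Notation R := (Rmx H).
Local Notation R21 := (smap (@flip k n) R).
Local Notation Q := (Qmx H).
Local Notation rho := (rho V).

Let lD : klin Delta := comulh_klin H.
Let le : klin (@counith k n : Uh -> K^o) := @counith_klin k n.
Let lflip := @sflip_klin k n.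
Let l12 := @leg12_klin k n.
Let l13 := @leg13_klin k n.
Let l23 := @leg23_klin k n.
Local Opaque comulh hlift stens flip leg12 leg13 leg23.

Lemma R21_comul x : R21 * smap (@flip k n) (Delta x) = Delta x * R21.
Proof. by rewrite -!sflipM Rmx_comul sflipM sflipK. Qed.

(** R carries Delta to its flip and R^21 carries the flip back to Delta. *)
Lemma Q_comul x : Q * Delta x = Delta x * Q.
Proof.
transitivity (R21 * (smap (@flip k n) (Delta x) * R)); first by rewrite -Rmx_comul mulrA.
by rewrite mulrA R21_comul -mulrA.
Qed.

Lemma id_comul_klin : klin (id_comul Delta : series U2 -> series U3).
Proof. by rewrite /id_comul; klin. Qed.

Lemma id_comulM (X Y : series U2) :
  id_comul Delta (X * Y) = id_comul Delta X * id_comul Delta Y.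
Proof.
apply: (klin_mult id_comul_klin) => a b c d; rewrite stensM /id_comul.
have bs : hbilin (fun a b => stens a (Delta b)) by klin.
by rewrite !hlift_stens // comulhM stensM.
Qed.

(** The cyclic shift of the three legs. It turns the hexagon axiom for (Delta (x) id)(R) into a
    formula for (id (x) Delta)(R^21). *)
Let cyc (Z : series U3) : series U3 :=
  hlift (fun a bc => hlift (fun b c => stens c (stens a b)) bc) Z.
Let cyc_klin : klin cyc. Proof. by rewrite /cyc; klin. Qed.
Let cyc_stens a b c : cyc (stens a (stens b c)) = stens c (stens a b).
Proof. by rewrite /cyc !hlift_stens //; klin. Qed.

Let cycM (X Y : series U3) : cyc (X * Y) = cyc X * cyc Y.
Proof.
have lc := cyc_klin.
have e3 (W : algType k) (L M : series U3 -> series W) : klin L -> klin M ->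
    (forall a b c, L (stens a (stens b c)) = M (stens a (stens b c))) -> forall Z, L Z = M Z.
  move=> lL lM LM; apply: tens_eq_lin => // a Z.
  by apply: (tens_eq_lin (F := fun Z => L (stens a Z)) (G := fun Z => M (stens a Z))) => //; klin.
apply: (e3 _ (fun X => cyc (X * Y)) (fun X => cyc X * cyc Y)) => [||a b c]; [by klin|by klin|].
apply: (e3 _ (fun Y => cyc (_ * Y)) (fun Y => _ * cyc Y)) => [||a' b' c']; [by klin|by klin|].
by rewrite !stensM !cyc_stens !stensM.
Qed.

Let cyc_comul (X : series U2) : cyc (comul_id Delta X) = id_comul Delta (smap (@flip k n) X).
Proof.
have lc := cyc_klin; have li := id_comul_klin.
have lcm : klin (comul_id Delta) by rewrite /comul_id; klin.
apply: (tens_eq_lin (F := fun X => cyc (comul_id Delta X))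
  (G := fun X => id_comul Delta (smap (@flip k n) X))) => [||a b]; [by klin|by klin|].
rewrite sflip_stens /id_comul /comul_id !hlift_stens; [|by klin|by klin].
rewrite (hlift_comp (L := cyc)); [|by klin|by klin].
under eq_hlift => a1 a2 do rewrite cyc_stens.
rewrite -(hlift_comp (L := fun X => stens b X) (f := fun a b => stens a b)); [|by klin|by klin].
by rewrite hlift_stens_id.
Qed.

Let cyc13 (X : series U2) : cyc (smap (@leg13 k n) X) = smap (@leg12 k n) (smap (@flip k n) X).
Proof.
have lc := cyc_klin.
apply: (tens_eq_lin (F := fun X => cyc (smap (@leg13 k n) X))
  (G := fun X => smap (@leg12 k n) (smap (@flip k n) X))) => [||a b]; [by klin|by klin|].
by rewrite sflip_stens leg13_stens leg12_stens cyc_stens.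
Qed.
Let cyc23 (X : series U2) : cyc (smap (@leg23 k n) X) = smap (@leg13 k n) (smap (@flip k n) X).
Proof.
have lc := cyc_klin.
apply: (tens_eq_lin (F := fun X => cyc (smap (@leg23 k n) X))
  (G := fun X => smap (@leg13 k n) (smap (@flip k n) X))) => [||a b]; [by klin|by klin|].
by rewrite sflip_stens leg23_stens leg13_stens cyc_stens.
Qed.

(** The hexagons for R^21 and R give (R^21_12 R^21_13)(R_13 R_12), whose two middle factors multiply
    to Q_13. *)
Lemma id_comul_Q :
  id_comul Delta Q = smap (@leg12 k n) R21 * smap (@leg13 k n) Q * smap (@leg12 k n) R.
Proof.
rewrite {1}/Qmx id_comulM -cyc_comul Rmx_comul_id cycM cyc13 cyc23 Rmx_id_comul.
by rewrite [in RHS]/Qmx leg13M !mulrA.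
Qed.

Lemma stens_antipoder b : hlift (fun u v => Delta u * stens 1 (gam v)) (Delta b) = stens b 1.
Proof.
transitivity (hlift (fun u v => hlift (fun b1 b2 => stens b1 (b2 * gam v)) (Delta u)) (Delta b)).
  apply: eq_hlift => u v; rewrite -{1}[Delta u]hlift_stens_id.
  rewrite (hlift_comp (L := fun X => X * stens 1 (gam v))); [|by klin|by klin].
  by apply: eq_hlift => b1 b2; rewrite stensM mulr1.
refine (etrans (comulhA H (T := fun b1 b2 v : Uh => stens b1 (b2 * gam v)) _ _ _ _) _).
- by klin.
- by klin.
- by klin.
rewrite -[RHS](counit_r H (L := fun z => stens z 1)); last by klin.
apply: eq_hlift => b1 w.
rewrite -(hlift_comp (L := fun z => stens b1 z) (f := fun b2 v => b2 * gam v)); [|by klin|by klin].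
rewrite antipoder; have ls : klin (fun z : Uh => stens b1 z) by klin.
exact: (klinZ ls).
Qed.

Lemma stens_antipodel x : hlift (fun a b => stens (gam a) 1 * Delta b) (Delta x) = stens 1 x.
Proof.
transitivity (hlift (fun a b => hlift (fun b1 b2 => stens (gam a * b1) b2) (Delta b)) (Delta x)).
  apply: eq_hlift => a b; rewrite -{1}[Delta b]hlift_stens_id.
  rewrite (hlift_comp (L := fun X => stens (gam a) 1 * X)); [|by klin|by klin].
  by apply: eq_hlift => b1 b2; rewrite stensM mul1r.
refine (etrans (esym (comulhA H (T := fun a b1 b2 : Uh => stens (gam a * b1) b2) _ _ _ _)) _).
- by klin.
- by klin.
- by klin.
rewrite -[RHS](counit_l H (L := fun z => stens 1 z)); last by klin.
apply: eq_hlift => u b2.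
rewrite -(hlift_comp (L := fun z => stens z b2) (f := fun a b1 => gam a * b1)); [|by klin|by klin].
rewrite antipodel; have ls : klin (fun z : Uh => stens z b2) by klin.
exact: (klinZ ls).
Qed.

(** Both sides equal (gamma(x1) (x) 1) Q Delta(x2) (1 (x) gamma(x3)). For the left side, Delta(x2)
    (1 (x) gamma(x3)) contracts to x2 (x) 1; for the right side, Q is moved across Delta(x2) and the
    antipode cancels in the first leg. Sliced by a functional this is the equivariance of f. *)
Lemma Q_ad x : hlift (fun a b => stens (gam a) 1 * Q * stens b 1) (Delta x) =
  hlift (fun w v => stens 1 w * Q * stens 1 (gam v)) (Delta x).
Proof.
pose T (a u v : Uh) := stens (gam a) 1 * (Q * Delta u) * stens 1 (gam v).
transitivity (hlift (fun a b => hlift (fun u v => T a u v) (Delta b)) (Delta x)).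
  apply: eq_hlift => a b; rewrite -(stens_antipoder b).
  rewrite (hlift_comp (L := fun X => stens (gam a) 1 * Q * X)); [|by klin|by klin].
  apply: eq_hlift => u v; rewrite /T.
  have m4 (S : nzRingType) (p q r s : S) : p * q * (r * s) = p * (q * r) * s.
    by rewrite !mulrA.
  exact: m4.
refine (etrans (esym (comulhA H (T := T) _ _ _ _)) _).
- by rewrite /T; klin.
- by rewrite /T; klin.
- by rewrite /T; klin.
apply: eq_hlift => w v; rewrite -(stens_antipodel w).
rewrite -mulrA (hlift_comp (L := fun X => X * (Q * stens 1 (gam v)))); [|by klin|by klin].
by apply: eq_hlift => a u; rewrite /T Q_comul !mulrA.
Qed.

End Reflection.

(** * The elements R and Q to first order in h *)

Section RmxCoef.
Variables (k : fieldType) (n : nat) (H : qea k n).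
Local Notation U := (uenv (@slbr k n)).
Local Notation U2 := (tens U U).
Local Notation Uh := (series U).
Local Notation flip := (@flip k n).

Let bflip : tbilin (fun a b : U => tpure b a).
Proof. by split=> *; rewrite ?tpureDl ?tpureDr ?tpureZl ?tpureZr. Qed.

Lemma flip_linear : linear flip.
Proof. by move=> c x y; apply: tlift_linear. Qed.
Lemma flip_pure a b : flip (tpure a b) = tpure b a.
Proof. exact: tlift_pure. Qed.
Lemma flipD x y : flip (x + y) = flip x + flip y.
Proof. by have := flip_linear 1 x y; rewrite !scale1r. Qed.
Lemma flip0 : flip 0 = 0.
Proof. by apply: (addrI (flip 0)); rewrite -flipD !addr0. Qed.
Lemma flipZ c x : flip (c *: x) = c *: flip x.
Proof. by have := flip_linear c x 0; rewrite flip0 !addr0. Qed.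
Lemma flipN x : flip (- x) = - flip x.
Proof. by rewrite -scaleN1r flipZ scaleN1r. Qed.
Lemma flipK : involutive flip.
Proof.
apply: tens_pure_ind => [a b||x y IHx IHy]; first by rewrite !flip_pure.
  by rewrite !flip0.
by rewrite !flipD IHx IHy.
Qed.

Lemma scoef_smap (A B : Type) (f : A -> B) x i : scoef (smap f x) i = f (scoef x i).
Proof. by []. Qed.

Lemma scoef1M (W : algType k) (x y : series W) :
  scoef (x * y) 1 = scoef x 0 * scoef y 1 + scoef x 1 * scoef y 0.
Proof. by rewrite /= 2!big_ord_recl big_ord0 addr0. Qed.

Lemma ringinv_1 (W : algType k) (x : series W) :
  scoef x 0 = 1 -> scoef (ringinv x) 1 = - scoef x 1.
Proof.
move=> x0; have [xx _] := series_inv x0.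
have := congr1 (fun z => scoef z 1) xx.
by rewrite scoef1M x0 mul1r ringinv_0 // mulr1 => /eqP; rewrite addr_eq0 => /eqP.
Qed.

Let F0 := twist0 H.
Let f0 : scoef (smap flip (twist H)) 0 = 1.
Proof. by rewrite scoef_smap F0 [LHS]flip_pure. Qed.
Let e0 (t : U2) : scoef (hexp (2^-1 *: t)) 0 = 1.
Proof. by rewrite [LHS]/= fact0 invr1 scale1r expr0. Qed.
Let e1 (t : U2) : scoef (hexp (2^-1 *: t)) 1 = 2^-1 *: t.
Proof. by rewrite [LHS]/= -[1`!]/1%N invr1 scale1r expr1. Qed.

Lemma Rmx_0 : scoef (Rmx H) 0 = 1.
Proof. by rewrite /Rmx 2!scoef0M f0 e0 (ringinv_0 F0) !mul1r. Qed.

Lemma Rmx_1 : scoef (Rmx H) 1 =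
  flip (scoef (twist H) 1) + 2^-1 *: casimir H - scoef (twist H) 1.
Proof.
rewrite /Rmx scoef1M scoef0M f0 e0 (ringinv_0 F0) (ringinv_1 F0) !mul1r mulr1.
rewrite scoef1M f0 e0 e1 mul1r mulr1 scoef_smap.
by rewrite addrC [_ *: _ + _]addrC.
Qed.

Lemma Qmx_0 : scoef (Qmx H) 0 = 1.
Proof. by rewrite /Qmx scoef0M scoef_smap Rmx_0 mulr1 [LHS]flip_pure. Qed.

(** Let F_1 be the first-order term of the twist. R and R^21 contribute F_1^21 - F_1 with opposite
    signs, so the classical r-matrix disappears and only the Casimir and its flip remain. *)
Lemma Qmx_1 : scoef (Qmx H) 1 = 2^-1 *: (casimir H + flip (casimir H)).
Proof.
rewrite /Qmx scoef1M !scoef_smap Rmx_0 [flip 1]flip_pure mulr1 mul1r Rmx_1.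
rewrite !flipD flipN flipZ flipK scalerDr.
set f := scoef _ 1; set ff := flip f; set c := 2^-1 *: _; set d := 2^-1 *: _.
by rewrite [ff + c - f]addrAC [f + d - ff]addrAC addrACA -[f - ff]opprB subrr add0r.
Qed.

End RmxCoef.

(** * Equivariance of the reflection map and centrality of C *)

Section ReflectionMap.
Variables (k : fieldType) (n : nat) (H : qea k n) (V : basic_rep H).
Local Notation g := (sl k n).
Local Notation U := (uenv (@slbr k n)).
Local Notation U2 := (tens U U).
Local Notation U3 := (tens U U2).
Local Notation Uh := (series U).
Local Notation K := (series k).
Local Notation iota := (ugen (@slbr k n)).
Local Notation Delta := (comulh H).
Local Notation gam := (antipode H).
Local Notation R := (Rmx H).
Local Notation R21 := (smap (@flip k n) R).
Local Notation Q := (Qmx H).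
Local Notation rho := (rho V).
Local Notation C := (Cel V).
Local Notation h := (hvar k).

Let lD : klin Delta := comulh_klin H.
Let le : klin (@counith k n : Uh -> K^o) := @counith_klin k n.
Let l12 := @leg12_klin k n.
Let l13 := @leg13_klin k n.

Lemma rho_klin : klin rho. Proof. by move=> c x y; rewrite linearP. Qed.
Let lr : klin rho := rho_klin.
Lemma rhoM x y : rho (x * y) = rho x *m rho y.
Proof. exact: (rho_morph V).2. Qed.
Lemma rho1 : rho 1 = 1%:M.
Proof. exact: (rho_morph V).1. Qed.

Local Opaque comulh hlift stens flip leg12 leg13 leg23 Qmx Rmx.

Section Functional.
Variable phi : 'M[K]_n -> K.
Hypothesis lphi : klin (phi : 'M[K]_n -> K^o).

(** This is [reflmap] with a free tensor in place of Q: it is also applied to [sdrop Q] and to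
    tensors occurring in (id (x) Delta)(Q). *)
Definition slice (X : series U2) : Uh := hlift (fun a b => phi (rho a) *: b) X.

Lemma reflmapE : reflmap V phi = slice Q. Proof. by []. Qed.

Lemma slice_klin : klin slice. Proof. by rewrite /slice; klin. Qed.

Lemma slice_stens a b : slice (stens a b) = phi (rho a) *: b.
Proof. by rewrite /slice hlift_stens //; klin. Qed.

Lemma slice_mul u v X : slice (stens 1 u * X * stens 1 v) = u * slice X * v.
Proof.
have ls := slice_klin.
apply: (tens_eq_lin (F := fun X => slice (stens 1 u * X * stens 1 v))
  (G := fun X => u * slice X * v)) => [||a b]; [by klin|by klin|].
by rewrite !stensM !slice_stens mul1r mulr1 -scalerAr -scalerAl.
Qed.

End Functional.

Lemma slice_mull phi u v X : klin (phi : 'M[K]_n -> K^o) ->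
  slice phi (stens u 1 * X * stens v 1) = slice (fun m => phi (rho u *m m *m rho v)) X.
Proof.
move=> lphi; have ls := slice_klin lphi.
have lphi' : klin ((fun m => phi (rho u *m m *m rho v)) : _ -> K^o) by klin.
have ls' := slice_klin lphi'.
apply: (tens_eq_lin (F := fun X => slice phi (stens u 1 * X * stens v 1))) => [||a b].
- by klin.
- by [].
by rewrite !stensM !slice_stens // mul1r mulr1 !rhoM.
Qed.

Definition coad (x : Uh) (phi : 'M[K]_n -> K) (m : 'M[K]_n) : K :=
  hlift (W := k^o) (fun a b => phi (rho (gam a) *m m *m rho b)) (Delta x).

(** [Q_ad] is sliced by [phi]: what surrounds Q in the second leg is the adjoint action, and what
    surrounds it in the first leg is absorbed into the action on [phi]. *)
Lemma adh_reflmap x phi : klin (phi : 'M[K]_n -> K^o) ->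
  adh H x (reflmap V phi) = reflmap V (coad x phi).
Proof.
move=> lphi; have ls := slice_klin lphi.
rewrite !reflmapE.
transitivity (slice phi (hlift (fun w v => stens 1 w * Q * stens 1 (gam v)) (Delta x))).
  rewrite (hlift_comp (L := slice phi)) //; last by klin.
  by apply: eq_hlift => w v; rewrite slice_mul.
rewrite -Q_ad (hlift_comp (L := slice phi)) //; last by klin.
transitivity (hlift (fun a b => slice (fun m => phi (rho (gam a) *m m *m rho b)) Q) (Delta x)).
  by apply: eq_hlift => a b; rewrite slice_mull.
rewrite /slice.
refine (etrans (hlift_swap (T := fun a b q q' : Uh =>
   (phi (rho (gam a) *m rho q *m rho b) : K) *: q' : Uh) (Delta x) Q _ _) _).
- by klin.
- by klin.
apply: eq_hlift => q q'; apply/esym.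
(* Scalars are read as [series k^o], that is, series over the algebra k, because [hlift_comp]
   compares maps between series over algebras. *)
have lc : @klin K (series k^o) (series U) (fun c => (c : K) *: q').
  by move=> c u v; rewrite scalerDl; congr (_ + _); apply/esym; apply: scalerA.
refine (hlift_comp (L := fun c : series k^o => (c : K) *: q')
  (f := fun a b => phi (rho (gam a) *m rho q *m rho b)) _ lc _).
by split=> z; [have : klin ((fun a => phi (rho (gam a) *m rho q *m rho z)) : _ -> K^o) by klin |
   have : klin ((fun a => phi (rho (gam z) *m rho q *m rho a)) : _ -> K^o) by klin].
Qed.

Lemma coad_klin x phi : klin (phi : 'M[K]_n -> K^o) -> klin (coad x phi : _ -> K^o).
Proof.
move=> lphi; have {lphi}lp : @klin K _ (series k^o) phi by [].
suff : @klin K _ (series k^o) (coad x phi) by [].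
refine (klin_hliftp (W := k^o)
  (g := fun m a b => phi (rho (gam a) *m m *m rho b)) (Delta x) _); klin.
Qed.

Lemma coad1 x phi : klin (phi : 'M[K]_n -> K^o) -> coad x phi 1%:M = counith x * phi 1%:M.
Proof.
move=> lphi; have pZ := klinZ lphi.
have {lphi}lp : @klin K _ (series k^o) phi by [].
rewrite /coad.
have -> : hlift (W := k^o) (fun a b => phi (rho (gam a) *m 1%:M *m rho b)) (Delta x) =
          hlift (W := k^o) (fun a b => phi (rho (gam a * b))) (Delta x).
  by apply: eq_hlift => a b; rewrite mulmx1 rhoM.
rewrite -(hlift_comp (W' := k^o) (L := fun z => phi (rho z)) (f := fun a b => gam a * b));
  [|by klin|by klin].
by rewrite antipodel linearZ pZ rho1.
Qed.

Lemma qtr_klin : klin (qtr V : 'M[K]_n -> K^o).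
Proof. by move=> c x y; rewrite linearP. Qed.

Lemma adh_Cel x : adh H x C = counith x *: C.
Proof.
rewrite /Cel adh_reflmap; last exact: qtr_klin.
have -> : coad x (qtr V) = fun m => counith x * qtr V m.
  by apply/funext => m; rewrite /coad qtr_inv.
have r0 : reflmap V (fun=> 0) = 0.
  have := reflmap_linear V (-1) (fun=> 0) (fun=> 0).
  by rewrite mulr0 addr0 scaleN1r addNr.
have := reflmap_linear V (counith x) (qtr V) (fun=> 0); rewrite r0 addr0 => <-.
by congr reflmap; apply/funext => m; rewrite addr0.
Qed.

(** An ad-invariant element is central: x C = ad(x1)(C) x2 = eps(x1) C x2 = C x. *)
Lemma Cel_central x : x * C = C * x.
Proof.
rewrite -(adh_mul_swap H x C).
transitivity (hlift (fun a b => counith a *: (C * b)) (Delta x)).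
  by apply: eq_hlift => a b; rewrite adh_Cel scalerAl.
by rewrite (counit_l H (L := fun z => C * z)) //; klin.
Qed.

End ReflectionMap.

(** * The generators g_h *)

Section Decomposition.
Variables (k : fieldType) (n : nat) (H : qea k n) (V : basic_rep H).
Local Notation g := (sl k n).
Local Notation U := (uenv (@slbr k n)).
Local Notation U2 := (tens U U).
Local Notation U3 := (tens U U2).
Local Notation Uh := (series U).
Local Notation K := (series k).
Local Notation Delta := (comulh H).
Local Notation R := (Rmx H).
Local Notation R21 := (smap (@flip k n) R).
Local Notation Q := (Qmx H).
Local Notation rho := (rho V).
Local Notation C := (Cel V).
Local Notation h := (hvar k).
Local Notation slc := (slice V).

Let lD : klin Delta := comulh_klin H.
Let l12 := @leg12_klin k n.
Let l13 := @leg13_klin k n.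
Let lr : klin rho := rho_klin V.

Lemma entry_klin p q : klin ((fun m : 'M[K]_n => m p q) : _ -> K^o).
Proof. by move=> c x y; rewrite !mxE. Qed.

Local Opaque comulh hlift stens flip leg12 leg13 leg23 Rmx.

(** This is h^-1 (f(phi) - phi(1)), which exists because Q = 1 modulo h. On the functionals
    vanishing at the identity it parametrizes L without any division. *)
Definition ell (phi : 'M[K]_n -> K) : Uh := slc phi (sdrop Q).

Lemma reflmap_ell phi : klin (phi : _ -> K^o) ->
  reflmap V phi = phi 1%:M *: 1 + h *: ell phi.
Proof.
move=> lphi; have ls := slice_klin V lphi.
rewrite reflmapE [Q]sdropE (klinD ls) (klinZ ls) Qmx_0 scst1 -stens1 slice_stens //.
by rewrite rho1.
Qed.

Lemma ell_lin c phi psi : ell (fun m => c * phi m + psi m) = c *: ell phi + ell psi.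
Proof.
rewrite /ell /slice -hlift_linear; apply: eq_hlift => a b.
by rewrite scalerDl -scalerA.
Qed.

Lemma ell0 : ell (fun=> 0) = 0.
Proof.
have := ell_lin (-1) (fun=> 0) (fun=> 0).
by rewrite mulr0 addr0 scaleN1r addNr.
Qed.

Lemma ell_sum (I : Type) (r : seq I) (c : I -> K) (phi : I -> 'M[K]_n -> K) :
  ell (fun m => \sum_(i <- r) c i * phi i m) = \sum_(i <- r) c i *: ell (phi i).
Proof.
elim: r => [|i r IH]; first by rewrite big_nil -ell0; congr ell; apply/funext => m; rewrite big_nil.
rewrite big_cons -IH -ell_lin; congr ell; apply/funext => m.
by rewrite big_cons.
Qed.

Lemma inLP x : inL V x <->
  exists phi : 'M[K]_n -> K, [/\ klin (phi : _ -> K^o), phi 1%:M = 0 & x = ell phi].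
Proof.
split=> [[phi [lphi phi1 e]]|[phi [lphi phi1 ->]]]; exists phi; split=> //.
  by apply: (@hZ_inj k); rewrite e reflmap_ell // phi1 scale0r add0r.
by rewrite reflmap_ell // phi1 scale0r add0r.
Qed.

Lemma Cel_0 : scoef C 0 = 1.
Proof.
rewrite /Cel reflmap_ell; last exact: qtr_klin.
by rewrite qtr1 scale1r scoefD scoef_hZ addr0.
Qed.

Lemma Cel_inv : C * ringinv C = 1 /\ ringinv C * C = 1.
Proof. exact: series_inv Cel_0. Qed.

Lemma ringinv_Cel_central x : x * ringinv C = ringinv C * x.
Proof.
have [CC cC] := Cel_inv.
by rewrite -[LHS]mul1r -cC -mulrA [C * _]mulrA -Cel_central -!mulrA CC mulr1.
Qed.

Lemma adh_inL x y : inL V y -> inL V (adh H x y).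
Proof.
case=> phi [lphi phi1 e]; exists (coad V x phi); split.
- exact: coad_klin.
- by rewrite coad1 // phi1 mulr0.
by rewrite -(klinZ (adh_klinr H x)) e adh_reflmap.
Qed.

Section Coproduct.
Variable phi : 'M[K]_n -> K.
Hypothesis lphi : klin (phi : 'M[K]_n -> K^o).

Let slice3 (X : series U3) : series U2 := hlift (fun a Z => phi (rho a) *: Z) X.
Let slice3_klin : klin slice3. Proof. by rewrite /slice3; klin. Qed.

Lemma comul_slice X : Delta (slc phi X) = slice3 (id_comul Delta X).
Proof.
rewrite /slice3 /id_comul /slice (hlift_comp (L := Delta)) //; last by klin.
rewrite (hlift_comp (L := hlift (fun a Z => phi (rho a) *: Z))); [|by klin|by klin].
apply: eq_hlift => a b; rewrite hlift_stens; last by klin.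
by rewrite (klinZ lD).
Qed.

(* For X = R21 and Y = R, (id (x) Delta)(Q) = R21_12 Q_13 R_12; expanding rho(Q')
   in matrix units gives Delta (f phi), and the trace parts of the matrix entries add up to
   dressing 1 (x) C = f phi (x) C. *)
Definition dressing (X Y : series U2) (m : 'M[K]_n) : Uh :=
  hlift (fun x x' => hlift (fun y y' => phi (rho x *m m *m rho y) *: (x' * y')) Y) X.

Lemma dressing_klin X Y : klin (dressing X Y).
Proof. by rewrite /dressing; klin. Qed.

Lemma dressing1 X Y : dressing X Y 1%:M = slc phi (X * Y).
Proof.
rewrite /slice hliftM; last by klin.
by apply: eq_hlift => x x'; apply: eq_hlift => y y'; rewrite mulmx1 rhoM.
Qed.

Lemma slice3_dressing X Y Z :
  slice3 (smap (@leg12 k n) X * smap (@leg13 k n) Z * smap (@leg12 k n) Y) =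
  \sum_p \sum_q stens (dressing X Y (delta_mx p q)) (slc (fun m => m p q) Z).
Proof.
have l3 := slice3_klin; have le := entry_klin.
have klin_sums (W : algType k) (F : 'I_n -> 'I_n -> series U2 -> series W) :
    (forall p q, klin (F p q)) -> klin (fun X => \sum_p \sum_q F p q X).
  move=> lF c x y; rewrite scaler_sumr -big_split; apply: eq_bigr => p _.
  by rewrite scaler_sumr -big_split; apply: eq_bigr => q _; rewrite lF.
have lsl p q := slice_klin V (le p q).
apply: (tens_eq_lin (F := fun X => slice3 (smap (@leg12 k n) X * _ * _))
  (G := fun X => \sum_p \sum_q stens (dressing X Y (delta_mx p q)) _)) => [||x x'].
- by klin.
- by apply: klin_sums => p q; rewrite /dressing; klin.
apply: (tens_eq_lin (F := fun Y => slice3 (_ * _ * smap (@leg12 k n) Y))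
  (G := fun Y => \sum_p \sum_q stens (dressing _ Y (delta_mx p q)) _)) => [||y y'].
- by klin.
- by apply: klin_sums => p q; rewrite /dressing; klin.
apply: (tens_eq_lin (F := fun Z => slice3 (_ * smap (@leg13 k n) Z * _))
  (G := fun Z => \sum_p \sum_q stens _ (slc (fun m => m p q) Z))) => [||z z'].
- by klin.
- by apply: klin_sums => p q; have l := lsl p q; klin.
rewrite !leg12_stens leg13_stens !stensM /slice3 hlift_stens; last by klin.
rewrite mul1r !mulr1 !rhoM [X in _ *m X *m _]matrix_sum_delta.
rewrite mulmx_sumr mulmx_suml (klin_sum lphi) scaler_suml; apply: eq_bigr => p _.
rewrite mulmx_sumr mulmx_suml (klin_sum lphi) scaler_suml; apply: eq_bigr => q _.
rewrite slice_stens // -scalemxAr -scalemxAl (klinZ lphi).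
have ls (u : Uh) : klin (fun v : Uh => stens u v) by klin.
rewrite (klinZ (ls _)) -[(_ *: _ : K^o)]/(_ * _) -scalerA; congr (_ *: _).
rewrite /dressing hlift_stens; last by klin.
rewrite hlift_stens; last by klin.
have ls' (u : Uh) : klin (fun v : Uh => stens v u) by klin.
by rewrite (klinZ (ls' _)).
Qed.

End Coproduct.

Lemma ldecomp_exists x : inL V x -> exists s : seq (Uh * Uh),
  (forall p, p \in s -> inL V p.2) /\
  Delta x = stens x C + \sum_(p <- s) stens p.1 p.2.
Proof.
case/inLP => phi [lphi phi1 ex].
(* A matrix entry minus the multiple of [qtr] that makes it vanish at the identity, so that f of it
   is h times an element of L. The multiples of [qtr] add up to w(1) (x) C with w(1) = h x, hence
   the whole identity can be divided by h. *)
pose eps p q (m : 'M[K]_n) := m p q - (p == q)%:R * qtr V m.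
have leps p q : klin (eps p q : _ -> K^o).
  apply: (klin_add (entry_klin p q)); apply: klin_opp.
  exact: (klin_scale _ (qtr_klin V)).
have eps1 p q : eps p q 1%:M = 0 by rewrite /eps !mxE qtr1 mulr1 subrr.
have fE p q : slc (fun m => m p q) Q = h *: ell (eps p q) + (p == q)%:R *: C.
  have := reflmap_linear V (p == q)%:R (qtr V) (eps p q).
  rewrite [reflmap V (eps p q)]reflmap_ell // eps1 scale0r add0r -/(Cel V) addrC => <-.
  by rewrite -reflmapE; congr reflmap; apply/funext => m; rewrite /eps addrC subrK.
pose w := dressing phi R21 R.
have lw : klin w by apply: dressing_klin.
exists [seq (w (delta_mx pq.1 pq.2), ell (eps pq.1 pq.2)) | pq <- enum [set: 'I_n * 'I_n]].
split.
  by move=> p /mapP[pq _ ->]; apply/inLP; exists (eps pq.1 pq.2).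
have hx : h *: x = reflmap V phi by rewrite reflmap_ell // phi1 scale0r add0r ex.
have lsl (u : Uh) : klin (fun v : Uh => stens v u) by klin.
have lsr (u : Uh) : klin (fun v : Uh => stens u v) by klin.
apply: (@hZ_inj k); rewrite -(klinZ lD) hx reflmapE comul_slice // id_comul_Q.
rewrite slice3_dressing // -/w scalerDr big_map.
rewrite (eq_bigr (fun p => \sum_q (h *: stens (w (delta_mx p q)) (ell (eps p q)) +
    (p == q)%:R *: stens (w (delta_mx p q)) C))); last first.
  by move=> p _; apply: eq_bigr => q _; rewrite fE (klinD (lsr _)) !(klinZ (lsr _)).
rewrite (eq_bigr (fun p => \sum_q h *: stens (w (delta_mx p q)) (ell (eps p q)) +
    stens (w (delta_mx p p)) C)); last first.
  move=> p _; rewrite big_split /=; congr (_ + _).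
  rewrite (bigD1 p) //= eqxx scale1r big1 ?addr0 // => q; rewrite eq_sym => /negPf ->.
  by rewrite scale0r.
rewrite big_split addrC /=; congr (_ + _); last first.
  have -> : \sum_p stens (w (delta_mx p p)) C = stens (w 1%:M) C.
    transitivity (stens (\sum_p w (delta_mx p p)) C).
      by apply: esym; apply: (klin_sum (lsl C)).
    congr (stens _ C); rewrite -(klin_sum lw); congr w.
    by apply/matrixP => i j; rewrite summxE !mxE (bigD1 i) //= mxE eqxx big1 => [|l];
     rewrite ?addr0 1?eq_sym // => /negPf il; rewrite mxE il.
  have -> : w 1%:M = h *: x by rewrite hx; exact: dressing1.
  by rewrite (klinZ (lsl C)).
rewrite scaler_sumr big_enum pair_big /=; apply: eq_big => [pq|pq _]; last by [].
by rewrite inE.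
Qed.

Lemma ldecompP x : inL V x -> (forall p, p \in ldecomp V x -> inL V p.2) /\
  Delta x = stens x C + \sum_(p <- ldecomp V x) stens p.1 p.2.
Proof.
move=> /ldecomp_exists[s Hs]; rewrite /ldecomp.
by case: xgetP => [s' _ //|/(_ s)]; case.
Qed.

Lemma inL_mul x y : inL V x ->
  x * y = adh H x y * C + \sum_(p <- ldecomp V x) adh H p.1 y * p.2.
Proof.
move=> Lx; rewrite -[LHS](adh_mul_swap H) (ldecompP Lx).2.
have la := adh_klinl H y.
have lf : klin (hlift (fun a b => adh H a y * b)) by klin.
have lh := hlift_stens (f := fun a b => adh H a y * b).
rewrite (klinD lf) (klin_sum lf) lh; last by klin.
by congr (_ + _); apply: eq_bigr => p _; rewrite lh //; klin.
Qed.

End Decomposition.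

(** * Dual bases of sl(n) for a multiple of the trace form *)

Section DualBases.
Variables (k : fieldType) (n d : nat) (c : k) (e f : 'I_d -> sl k n).
Hypothesis ef : dual_bases c e f.
Local Notation g := (sl k n).
Local Notation form x y := (c * \tr ((x : g) *m (y : g))).

Lemma slval_sum (I : Type) (r : seq I) (F : I -> g) :
  slval (\sum_(i <- r) F i) = \sum_(i <- r) slval (F i).
Proof. exact: (big_morph (@slval k n)). Qed.

Lemma form_sym (x y : g) : form x y = form y x.
Proof. by rewrite mxtrace_mulC. Qed.

Lemma form_suml (a : 'I_d -> k) (z : 'I_d -> g) y :
  form (\sum_i a i *: z i) y = \sum_i a i * form (z i) y.
Proof.
rewrite slval_sum mulmx_suml raddf_sum mulr_sumr; apply: eq_bigr => i _.
have -> : slval (a i *: z i) = a i *: slval (z i) by [].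
by rewrite -scalemxAl /= mxtraceZ mulrCA.
Qed.

Lemma dual_expand (x : g) : x = \sum_i form x (f i) *: e i.
Proof. exact: ef.2. Qed.

Lemma form_nondeg (y : g) : (forall j, form y (e j) = 0) -> y = 0.
Proof.
move=> y0; rewrite [y]dual_expand big1 // => i _.
have -> : form y (f i) = 0; last by rewrite scale0r.
rewrite form_sym [f i]dual_expand form_suml big1 // => j _.
by rewrite (form_sym (e j) y) y0 mulr0.
Qed.

(** The definition gives coordinates along [e] only. They make the form nondegenerate, so the
    difference of the two sides vanishes once it pairs to zero with every e_j. *)
Lemma dual_expand' (x : g) : x = \sum_i form x (e i) *: f i.
Proof.
apply/eqP; rewrite -subr_eq0; apply/eqP; apply: form_nondeg => j.
rewrite mulmxBl linearB /= mulrBr form_suml (bigD1 j) //= (form_sym (f j)) ef.1 eqxx mulr1.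
rewrite big1 ?addr0 ?subrr // => i ij.
by rewrite (form_sym (f i)) ef.1 eq_sym (negPf ij) mulr0.
Qed.

Lemma dual_expand_mx (m : 'M[k]_n) : n%:R != 0 :> k ->
  m = (\tr m / n%:R)%:M + \sum_i (c * \tr (m *m e i)) *: slval (f i).
Proof.
move=> n0; pose a := \tr m / n%:R.
have m0 : m - a%:M \in @sl_pred k n.
  by rewrite unfold_in linearB /= mxtrace_scalar -[a *+ n]mulr_natr /a mulfVK // subrr.
have := congr1 (@slval k n) (dual_expand' (Sl m0)).
rewrite slval_sum => /eqP; rewrite subr_eq => /eqP em; rewrite {1}em addrC; congr (_ + _).
apply: eq_bigr => i _; rewrite mulmxBl linearB /= mul_scalar_mx linearZ /=.
by have /eqP -> := valP (e i); rewrite mulr0 subr0.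
Qed.

End DualBases.

Section SeriesScalar.
Variable A : nzRingType.

Lemma nz_scoefD (x y : series A) j : scoef (x + y) j = scoef x j + scoef y j.
Proof. by []. Qed.

Lemma nz_scoef_sum I (r : seq I) (P : pred I) (F : I -> series A) j :
  scoef (\sum_(i <- r | P i) F i) j = \sum_(i <- r | P i) scoef (F i) j.
Proof.
apply: (big_morph (fun x : series A => scoef x j)) => // .
by rewrite /=; case: eqP.
Qed.

Lemma scoefM_cstr (x : series A) a j : scoef (x * scst a) j = scoef x j * a.
Proof.
rewrite /= big_ord_recr /= subnn /= big1 ?add0r // => i _.
by rewrite subn_eq0 leqNgt ltn_ord /= mulr0.
Qed.

Lemma scoefM_cstl (x : series A) a j : scoef (scst a * x) j = a * scoef x j.
Proof.
by rewrite /= big_ord_recl /= subn0 big1 ?addr0 // => i _; rewrite mul0r.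
Qed.

End SeriesScalar.

(** * A basis of g_h and its reduction modulo h *)

Section Basis.
Variables (k : fieldType) (n : nat) (H : qea k n) (V : basic_rep H).
Hypothesis char0 : forall m, m.+1%:R != 0 :> k.
Hypothesis n_gt0 : (0 < n)%N.
Local Notation g := (sl k n).
Local Notation U := (uenv (@slbr k n)).
Local Notation Uh := (series U).
Local Notation K := (series k).
Local Notation iota := (ugen (@slbr k n)).
Local Notation Q := (Qmx H).
Local Notation rho := (rho V).
Local Notation C := (Cel V).
Local Notation h := (hvar k).

Variables (c : k) (d : nat) (e f : 'I_d -> g).
Hypothesis ef : dual_bases c e f.
Hypothesis casE : casimir H = \sum_i tpure (iota (e i)) (iota (f i)).

Definition cmat (m : 'M[k]_n) : 'M[K]_n := map_mx (@scst k) m.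

(** These functionals vanish at the identity because e_i is traceless, and they span all functionals
    that do ([phib_expand]), the coordinates being the values on the constant matrices
    [cmat (f i)]. *)
Definition phib i (m : 'M[K]_n) : K := scst c * \tr (m *m cmat (e i)).

Lemma scoef_phib i m j :
  scoef (phib i m) j = c * \tr (map_mx (fun x : K => scoef x j) m *m e i).
Proof.
rewrite /phib scoefM_cstl /mxtrace nz_scoef_sum; congr (_ * _).
apply: eq_bigr => p _; rewrite !mxE nz_scoef_sum; apply: eq_bigr => q _.
by rewrite !mxE scoefM_cstr.
Qed.

Lemma phib_klin i : klin (phib i : _ -> K^o).
Proof.
move=> a x y; rewrite /phib mulmxDl linearD /= mulrDr -scalemxAl linearZ /=.
by rewrite mulrCA.
Qed.

Lemma phib1 i : phib i 1%:M = 0.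
Proof.
apply/seriesP => j; rewrite scoef_phib.
have -> : map_mx (fun x : K => scoef x j) 1%:M = (j == 0%N)%:R%:M :> 'M[k]_n.
  apply/matrixP => p q; rewrite !mxE; case: (p == q) => /=; last by rewrite if_same.
  by case: eqP.
rewrite mul_scalar_mx linearZ /=; have /eqP -> := valP (e i).
by rewrite !mulr0 /=; case: eqP.
Qed.

Lemma phib_expand (phi : 'M[K]_n -> K) m : klin (phi : _ -> K^o) -> phi 1%:M = 0 ->
  phi m = \sum_i phi (cmat (f i)) * phib i m.
Proof.
move=> lphi phi1.
have n0 : n%:R != 0 :> k by case: n n_gt0.
(* The scalar part of m, found coefficient by coefficient in h; it drops out because [phi] vanishes
   at the identity. *)
pose t : K := Series (fun j => \tr (map_mx (fun x : K => scoef x j) m) / n%:R).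
rewrite {1}(_ : m = t *: 1%:M + \sum_i phib i m *: cmat (f i)); last first.
  apply/matrixP => p q; apply/seriesP => j; rewrite !mxE nz_scoefD.
  have /matrixP/(_ p q) := dual_expand_mx ef (map_mx (fun x : K => scoef x j) m) n0.
  rewrite !mxE => ->; congr (_ + _).
    rewrite [in RHS]mulr_natr; case: (p == q); last by rewrite !mulr0n /=; case: eqP.
    by rewrite !mulr1n.
  rewrite !summxE nz_scoef_sum; apply: eq_bigr => i _.
  by rewrite !mxE scoefM_cstr scoef_phib.
rewrite (klinD lphi) (klinZ lphi) phi1 scaler0 add0r (klin_sum lphi).
by apply: eq_bigr => i _; rewrite (klinZ lphi) mulrC.
Qed.

Definition bL i : Uh := ell V (phib i).

Lemma bL_in i : inL V (bL i).
Proof.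
by apply/inLP; exists (phib i); split; [apply: phib_klin | apply: phib1 |].
Qed.

Lemma inL_span x : inL V x -> exists a : 'I_d -> K, x = \sum_i a i *: bL i.
Proof.
case/inLP => phi [lphi phi1 ->]; exists (fun i => phi (cmat (f i))).
by rewrite -ell_sum; congr ell; apply/funext => m; apply: phib_expand.
Qed.

(** Modulo h, [rho] is the basic representation and [bL i] is the slice of (t + t^21)/2 by the trace
    against c e_i. The Casimir and its flip each give e_i, by the two dual expansions. *)
Lemma bL_0 i : scoef (bL i) 0 = iota (e i).
Proof.
have lphi := phib_klin i; have ls := slice_klin V lphi.
have phix (x : g) : scoef (phib i (rho (scst (iota x)))) 0 = c * \tr (x *m e i).
  rewrite scoef_phib; congr (_ * \tr (_ *m _)).
  by apply/matrixP => p q; rewrite mxE rho0.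
have term (x y : g) : scoef (slice V (phib i) (scst (tpure (iota x) (iota y)))) 0 =
    (c * \tr (x *m e i)) *: iota y.
  by rewrite -stens_cst slice_stens // scoef0Z phix.
rewrite /bL /ell [sdrop Q]sdropE (klinD ls) (klinZ ls) scoefD scoef_hZ addr0.
rewrite (_ : scoef (sdrop Q) 0 = scoef Q 1) // Qmx_1 scstZ (klinZ ls) scoef0Z.
have lfl : klin (@flip k n) := @flip_linear k n.
rewrite scstD (klinD ls) scoefD casE (klin_sum lfl) !scst_sum !(klin_sum ls).
rewrite !scoef_sum.
have -> : \sum_a scoef (slice V (phib i) (scst (tpure (iota (e a)) (iota (f a))))) 0 = iota (e i).
  under eq_bigr => a _ do rewrite term mxtrace_mulC.
  by rewrite [e i in RHS](dual_expand' ef) linear_sum; apply: eq_bigr => a _; rewrite linearZ.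
have -> : \sum_a scoef (slice V (phib i) (scst (flip (tpure (iota (e a)) (iota (f a)))))) 0
   = iota (e i).
  under eq_bigr => a _ do rewrite flip_pure term mxtrace_mulC.
  by rewrite [e i in RHS](dual_expand ef) linear_sum; apply: eq_bigr => a _; rewrite linearZ.
by rewrite -mulr2n -scaler_nat scalerA mulVf ?scale1r //; exact: char0.
Qed.

Definition beta i : Uh := ringinv C * bL i.

Lemma beta_0 i : scoef (beta i) 0 = iota (e i).
Proof. by rewrite /beta scoef0M ringinv_0 ?Cel_0 // mul1r bL_0. Qed.

Lemma gh_predP y : y \in gh_pred V <-> inL V (C * y).
Proof.
have [CC cC] := Cel_inv V; rewrite unfold_in; split=> [/asboolP[x Lx ->]|Ly].
  by rewrite mulrA CC mul1r.
by apply/asboolP; exists (C * y) => //; rewrite mulrA cC mul1r.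
Qed.

Lemma beta_in i : beta i \in gh_pred V.
Proof. by apply/gh_predP; rewrite mulrA (Cel_inv V).1 mul1r; apply: bL_in. Qed.

Definition bgh i : gh V := Gh (beta_in i).

Lemma ghof_in u : u \in gh_pred V -> ghval (ghof V u) = u.
Proof. by move=> gu; rewrite /ghof insubdK. Qed.

Lemma ghval_klin : klin (@ghval k n H V).
Proof. by []. Qed.

Lemma ghval_inj : injective (@ghval k n H V).
Proof. exact: val_inj. Qed.

Lemma gh_span (y : gh V) : exists a : 'I_d -> K, y = \sum_i a i *: bgh i.
Proof.
have /gh_predP/inL_span[a ea] := valP y; exists a; apply: ghval_inj.
rewrite (klin_sum ghval_klin).
rewrite (eq_bigr (fun i => ringinv C * (a i *: bL i))) => [|i _].
  by rewrite -mulr_sumr -ea mulrA (Cel_inv V).2 mul1r.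
by rewrite (klinZ ghval_klin) scalerAr.
Qed.

End Basis.

(** * Straightening and Nakayama *)

Section Span.
Variables (R : comNzRingType) (M : lmodType R).
Implicit Types (G : M -> Prop) (x y : M).

Inductive span G : M -> Prop :=
| Span0 : span G 0
| SpanS c g x : G g -> span G x -> span G (c *: g + x).

Lemma span_add G x y : span G x -> span G y -> span G (x + y).
Proof.
elim=> [|c g z Gg _ IH] Gy; first by rewrite add0r.
by rewrite -addrA; apply: SpanS => //; apply: IH.
Qed.

Lemma span_scale G c x : span G x -> span G (c *: x).
Proof.
elim=> [|a g z Gg _ IH]; first by rewrite scaler0; apply: Span0.
by rewrite scalerDr scalerA; apply: SpanS.
Qed.

Lemma span_gen G g : G g -> span G g.
Proof. by move=> Gg; rewrite -[g]scale1r -[_ *: _]addr0; apply: SpanS => //; apply: Span0. Qed.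

Lemma span_sum G (I : eqType) (r : seq I) (F : I -> M) :
  (forall i, i \in r -> span G (F i)) -> span G (\sum_(i <- r) F i).
Proof.
elim: r => [|i r IH] Fr; first by rewrite big_nil; apply: Span0.
rewrite big_cons; apply: span_add; first by apply: Fr; rewrite mem_head.
by apply: IH => j jr; apply: Fr; rewrite inE jr orbT.
Qed.

Lemma span_trans G G' x : (forall g, G g -> span G' g) -> span G x -> span G' x.
Proof.
move=> GG'; elim=> [|c g y Gg _ IH]; first exact: Span0.
by apply: span_add => //; apply: span_scale; apply: GG'.
Qed.

Definition family (I : eqType) (P : pred I) (e : I -> M) : M -> Prop :=
  fun x => exists2 i, P i & x = e i.

Definition free_family (I : eqType) (P : pred I) (e : I -> M) : Prop :=
  forall (s : seq I) (c : I -> R), uniq s -> all P s ->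
  \sum_(i <- s) c i *: e i = 0 -> forall i, i \in s -> c i = 0.

Lemma span_familyP (I : eqType) (P : pred I) (e : I -> M) x :
  span (family P e) x ->
  exists (s : seq I) (c : I -> R), [/\ uniq s, all P s & x = \sum_(i <- s) c i *: e i].
Proof.
elim=> [|a _ y [i Pi ->] _ [s [c [us Ps ->]]]].
  by exists [::], (fun=> 0); rewrite big_nil.
have [si|nsi] := boolP (i \in s); last first.
  exists (i :: s), (fun j => if j == i then a else c j); rewrite /= nsi us Pi Ps.
  split=> //; rewrite big_cons eqxx; congr (_ + _); apply: eq_big_seq => j js.
  by case: eqP js nsi => // -> ->.
exists s, (fun j => if j == i then a + c i else c j); split=> //.
rewrite !(bigD1_seq i) //= eqxx scalerDl addrA; congr (_ + _).
by apply: eq_bigr => j /negPf ->.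
Qed.

Lemma span_family_sub (I : eqType) (P P' : pred I) (e : I -> M) x :
  {subset P <= P'} -> span (family P e) x -> span (family P' e) x.
Proof.
by move=> PP'; apply: span_trans => _ [i Pi ->]; apply: span_gen; exists i => //; apply: PP'.
Qed.

Lemma span_family_seq (I : eqType) (P : pred I) (e : I -> M) (S : seq I) x :
    uniq S -> P =1 mem S -> span (family P e) x ->
  exists c : I -> R, x = \sum_(i <- S) c i *: e i.
Proof.
move=> uS PS; elim=> [|a _ y [i Pi ->] _ [c ->]].
  by exists (fun=> 0); rewrite big1 // => i _; rewrite scale0r.
exists (fun j => if j == i then a + c j else c j).
have iS : i \in S by rewrite -[_ \in _]PS.
rewrite !(bigD1_seq i) //= eqxx scalerDl addrA; congr (_ + _).
by apply: eq_bigr => j /negPf ->.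
Qed.

Lemma free_family_module (I : choiceType) (P : pred I) (e : I -> M) :
  free_family P e -> (forall x, span (family P e) x) -> free_module M.
Proof.
move=> fe se; exists {i | P i}, (fun i => e (val i)); split.
  move=> m; have [s [c [us /allP Ps ->]]] := span_familyP (se m).
  exists (pmap (fun i => omap (fun j : {i | P i} => (c i, j)) (insub i)) s).
  elim: s us Ps => [|i s IH] /=; first by rewrite !big_nil.
  move=> /andP[_ us] Ps; rewrite big_cons IH // => [|j js]; last first.
    by apply: Ps; rewrite inE js orbT.
  by rewrite insubT ?Ps ?mem_head // => Pi /=; rewrite big_cons.
move=> s c us c0 i si.
pose c' j := if insub j is Some l then c l else 0.
have cc' (j : {i | P i}) : c j = c' (val j) by rewrite /c' valK.
rewrite cc'; apply: (fe (map val s) c'); last by rewrite map_f.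
- by rewrite map_inj_uniq //; apply: val_inj.
- by apply/allP => _ /mapP[j _ ->]; apply: valP.
- by rewrite big_map -[RHS]c0; apply: eq_bigr => j _; rewrite cc'.
Qed.

End Span.

Section Straightening.
Variables (R : comNzRingType) (M : lmodType R) (d : nat).
Local Notation word := (seq 'I_d).
Variables (e : word -> M) (P : M -> Prop) (N : nat).
Hypothesis P0 : P 0.
Hypothesis PD : forall x y, P x -> P y -> P (x + y).
Hypothesis PZ : forall c x, P x -> P (c *: x).
Hypothesis Psorted : forall w, sorted (@ole d) w -> (size w <= N)%N -> P (e w).
Variable b : 'I_d -> 'I_d -> 'I_d -> R.
Hypothesis Pswap : forall u i j v, (size u + size v + 2 <= N)%N ->
  P (e (u ++ i :: j :: v) - e (u ++ j :: i :: v) - \sum_l b i j l *: e (u ++ l :: v)).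

Let PN x : P x -> P (- x).
Proof. by rewrite -scaleN1r; apply: PZ. Qed.
Let Psum (I : Type) (r : seq I) (F : I -> M) :
  (forall i, P (F i)) -> P (\sum_(i <- r) F i).
Proof. by move=> PF; elim/big_rec: _ => // i x _; apply: PD. Qed.

(** Up to [P], exchanging adjacent letters changes [e w] by shorter words, which satisfy [P] by
    induction, so the word may be sorted. [P] is abstract because it serves both for the span of the
    sorted words and for this span modulo h; [N] keeps the words in a finite list. *)
Lemma straightening w : (size w <= N)%N -> P (e w).
Proof.
have [m] := ubnP (size w); elim: m w => // m IH w /ltnSE szw wN.
have eqP_trans y x z : P (x - y) -> P (y - z) -> P (x - z).
  by move=> xy yz; rewrite -(subrKA y); apply: PD.
have swap u i j v : size (u ++ i :: j :: v) = size w ->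
    P (e (u ++ i :: j :: v) - e (u ++ j :: i :: v)).
  rewrite size_cat /= => sz.
  have szN : (size u + size v + 2 <= N)%N by rewrite addn2 -!addnS sz.
  rewrite -[_ - _](subrK (\sum_l b i j l *: e (u ++ l :: v))); apply: PD; first exact: Pswap.
  apply: Psum => l; apply: PZ; apply: IH.
    by rewrite size_cat /=; move: szw; rewrite -sz !addnS.
  by rewrite size_cat /= (leq_trans _ szN) // addn2 addnS.
have move_to_front u a x v : size (u ++ a ++ x :: v) = size w ->
    P (e (u ++ a ++ x :: v) - e (u ++ x :: a ++ v)).
  elim: a u => [|y a IHa] u sz; first by rewrite subrr.
  apply: (eqP_trans (e (u ++ y :: x :: a ++ v))).
    by have := IHa (rcons u y); rewrite !cat_rcons; apply.
  by apply: swap; rewrite -sz !size_cat /= !size_cat /= !addnS.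
have perm w' u s : size (u ++ w') = size w -> perm_eq w' s -> P (e (u ++ w') - e (u ++ s)).
  elim: w' u s => [|x w' IHw] u s sz.
    by rewrite perm_sym => /perm_nilP ->; rewrite subrr.
  move=> ps; have xs : x \in s by rewrite -(perm_mem ps) mem_head.
  case/splitPr: xs ps => a v ps.
  have ps' : perm_eq w' (a ++ v).
    by rewrite -(perm_cons x) (permPl ps) -cat1s perm_catCA.
  apply: (eqP_trans (e (u ++ x :: a ++ v))).
    by have := IHw (rcons u x) (a ++ v); rewrite !cat_rcons; apply.
  rewrite -opprB; apply: PN; apply: move_to_front.
  by rewrite -sz !size_cat /= (perm_size ps') size_cat addnS.
have := perm w [::] (sort (@ole d) w) (erefl _); rewrite perm_sym perm_sort => /(_ (perm_refl _)) /= Pw.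
rewrite -[e w](subrK (e (sort (@ole d) w))); apply: PD => //; apply: Psorted.
  by apply: sort_sorted => i j; apply: leq_total.
by rewrite size_sort.
Qed.

End Straightening.

Section Nakayama.
Variables (k : fieldType) (M : lmodType (series k)) (P : M -> Prop).
Local Notation K := (series k).
Local Notation h := (hvar k).
Hypothesis PD : forall x y, P x -> P y -> P (x + y).
Hypothesis PZ : forall c x, P x -> P (c *: x).
Hypothesis P0 : P 0.

Lemma one_sub_h_inv (b : K) : exists u : K, u * (1 - h * b) = 1.
Proof.
have x0 : scoef (1 - h * b : series k^o) 0 = 1.
  by rewrite /= big_ord1 mul0r oppr0 addr0.
by have [_ e] := series_inv x0; exists (ringinv (1 - h * b : series k^o)).
Qed.

(** Gaussian elimination: 1 - h b is invertible in k[[h]], so the equation of the first generator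
    expresses it by the others, and substituting it leaves a system of the same shape with one
    generator less. *)
Lemma nakayama (I : eqType) (W : seq I) (v : I -> M) :
    (forall w, w \in W -> exists p (b : I -> K),
       P p /\ v w = p + h *: \sum_(w' <- W) b w' *: v w') ->
  forall w, w \in W -> P (v w).
Proof.
elim: W => // w0 W IH HW.
have [p0 [b0 [Pp0]]] := HW w0 (mem_head _ _).
rewrite big_cons scalerDr scalerA addrCA => e0.
have [u uK] := one_sub_h_inv (b0 w0).
have v0 : v w0 = u *: p0 + h *: \sum_(w' <- W) (u * b0 w') *: v w'.
  have e1 : v w0 - (h * b0 w0) *: v w0 = p0 + h *: \sum_(w' <- W) b0 w' *: v w'.
    by rewrite {1}e0 addrAC subrr add0r.
  rewrite -[LHS]scale1r -uK -scalerA scalerBl scale1r e1.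
  rewrite scalerDr; congr (_ + _); rewrite scalerA [u * h]mulrC -scalerA; congr (_ *: _).
  by rewrite scaler_sumr; apply: eq_bigr => w' _; rewrite scalerA.
have PW : forall w, w \in W -> P (v w).
  apply: IH => w wW; have [|p [b [Pp]]] := HW w; first by rewrite inE wW orbT.
  rewrite big_cons {1}v0 => ->.
  exists (p + (h * b w0 * u) *: p0), (fun w' => b w' + b w0 * h * (u * b0 w')).
  split; first by apply: PD => //; apply: PZ.
  set S' := \sum_(w' <- W) (u * _) *: _; set S := \sum_(w' <- W) b w' *: _.
  have -> : \sum_(w' <- W) (b w' + b w0 * h * (u * b0 w')) *: v w' = S + (b w0 * h) *: S'.
    rewrite scaler_sumr -big_split; apply: eq_bigr => w' _ /=.
    by rewrite scalerDl scalerA.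
  by rewrite !scalerDr !scalerA -!addrA !mulrA [_ + h *: S]addrC.
move=> w; rewrite inE => /predU1P[->|]; last exact: PW.
rewrite v0; apply: PD; apply: PZ => //.
rewrite big_seq; elim/big_rec: _ => // i x iW; apply: PD.
by apply: PZ; apply: PW.
Qed.

End Nakayama.

(** * Rees algebras *)

Section FreeModH.
Variables (k : fieldType) (A : algType k) (I : eqType) (P : pred I).
Local Notation K := (series k).
Local Notation h := (hvar k).
Variable m : I -> series A.
Hypothesis m0_free : free_family P (fun i => scoef (m i) 0).

Lemma scoef0_comb (s : seq I) (c : I -> K) :
  scoef (\sum_(i <- s) c i *: m i) 0 = \sum_(i <- s) scoef (c i) 0 *: scoef (m i) 0.
Proof. by rewrite scoef_sum; apply: eq_bigr => i _; rewrite scoef0Z. Qed.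

(** Modulo h the combination is zero, so freeness forces every coefficient to have zero constant
    term; dividing all of them by h expresses u itself. *)
Lemma comb_divh (s : seq I) (c : I -> K) u : uniq s -> all P s ->
    \sum_(i <- s) c i *: m i = h *: u ->
  u = \sum_(i <- s) (sdrop (c i)) *: m i /\ (forall i, i \in s -> scoef (c i) 0 = 0).
Proof.
move=> us Ps e.
have c0 : forall i, i \in s -> scoef (c i) 0 = 0.
  by apply: m0_free => //; rewrite -scoef0_comb e scoef_hZ.
split=> //; apply: (@hZ_inj k); rewrite -e scaler_sumr; apply: eq_big_seq => i si.
rewrite scalerA; congr (_ *: _); rewrite {1}[c i](@sdropE k k^o) (c0 _ si).
exact: add0r.
Qed.

Lemma comb_modhN N (s : seq I) (c : I -> K) u : uniq s -> all P s ->
    \sum_(i <- s) c i *: m i = h ^+ N *: u ->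
  forall i j, i \in s -> (j < N)%N -> scoef (c i) j = 0.
Proof.
move=> us Ps; elim: N c u => // N IH c u; rewrite exprS -scalerA => e i j si.
have [e' c0] := comb_divh us Ps e.
case: j => [|j] ltj; first exact: c0.
by apply: (IH (fun i => sdrop (c i)) u).
Qed.

Lemma free_family_h : free_family P m.
Proof.
move=> s c us Ps e i si; apply/seriesP => j.
rewrite (@comb_modhN j.+1 s c 0 us Ps _ i j si) ?e ?scaler0 //.
by rewrite /=; case: eqP.
Qed.

Lemma span_divh u : span (family P m) (h *: u) -> span (family P m) u.
Proof.
case/span_familyP => s [c [us Ps /esym e]]; have [-> _] := comb_divh us Ps e.
apply: span_sum => i si; apply: span_scale; apply: span_gen.
by exists i => //; apply: (allP Ps).
Qed.

Lemma span_divhN N u : span (family P m) (h ^+ N *: u) -> span (family P m) u.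
Proof.
elim: N => [|N IH]; first by rewrite expr0 scale1r.
by rewrite exprS -scalerA => /span_divh.
Qed.

(** The coefficients of the approximations form h-adic Cauchy sequences by [comb_modhN]; as the
    family is finite, their limits are coefficients for u. *)
Lemma span_hclosed (S0 : seq I) u : uniq S0 -> P =1 mem S0 ->
    (forall N, exists v w, span (family P m) v /\ u = v + h ^+ N *: w) ->
  span (family P m) u.
Proof.
move=> uS PS uN.
have PS0 : all P S0 by apply/allP => i; rewrite PS.
have comb v := @span_family_seq K (series A) I P m S0 v uS PS.
have /choice[c cE] : forall N, exists c : I -> K,
    exists w, u = \sum_(i <- S0) c i *: m i + h ^+ N *: w.
  by move=> N; have [v [w [/comb[c ->] e]]] := uN N; exists c, w.
(* Approximations exact modulo h^(j+1) share their coefficients up to order j, so order j of the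
   limit is read off from approximation j + 1. *)
pose cl i : K := Series (fun j => scoef (c j.+1 i) j).
have ccl N i j : i \in S0 -> (j < N)%N -> scoef (cl i) j = scoef (c N i) j.
  move=> iS ltj; have [w1 e1] := cE j.+1; have [w2 e2] := cE N.
  have e : \sum_(i <- S0) (c j.+1 i - c N i) *: m i = h ^+ j.+1 *: (h ^+ (N - j.+1) *: w2 - w1).
    rewrite scalerBr scalerA -exprD subnKC //.
    have -> : \sum_(i <- S0) (c j.+1 i - c N i) *: m i =
       \sum_(i <- S0) c j.+1 i *: m i - \sum_(i <- S0) c N i *: m i.
      by rewrite -sumrB; apply: eq_bigr => l _; rewrite scalerBl.
    have -> : \sum_(i <- S0) c j.+1 i *: m i = u - h ^+ j.+1 *: w1 by rewrite {1}e1 addrK.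
    have -> : \sum_(i <- S0) c N i *: m i = u - h ^+ N *: w2 by rewrite {1}e2 addrK.
    by rewrite opprB addrC subrKA.
  by have /eqP := comb_modhN uS PS0 e iS (ltnSn j); rewrite subr_eq0 => /eqP.
suff -> : u = \sum_(i <- S0) cl i *: m i.
  apply: span_sum => i si; apply: span_scale; apply: span_gen.
  by exists i => //; apply: (allP PS0).
apply/eqP; rewrite -subr_eq0; apply/eqP; apply: (@h_separated k) => N.
have [w ->] := cE N; rewrite addrAC -sumrB.
have : forall i, exists z : K, i \in S0 -> c N i - cl i = h ^+ N * z.
  move=> i; have [iS|_] := boolP (i \in S0); last by exists 0.
  have [|z e] := @hvarXZP k k^o N (c N i - cl i).
    by move=> j ltj; rewrite scoefD scoefN (ccl N) // subrr.
  by exists z.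
case/choice => z ez; exists (\sum_(i <- S0) z i *: m i + w).
rewrite scalerDr scaler_sumr; congr (_ + _); apply: eq_big_seq => i iS.
by rewrite -scalerBl ez // scalerA.
Qed.

End FreeModH.

(** * Embedding into polynomials, with a Rees algebra as image *)

Section Rees.
Variables (R : comNzRingType) (A : lmodType {poly R}) (B : algType R).
Variables (I : choiceType) (P : pred I) (sz : I -> nat) (e : I -> A) (m : I -> B).
Variable Phi : A -> {poly B}.
Hypothesis PhiD : forall a b, Phi (a + b) = Phi a + Phi b.
Hypothesis PhiZ : forall p a, Phi (p *: a) = map_poly (in_alg B) p * Phi a.
Hypothesis Phi_e : forall i, Phi (e i) = m i *: 'X^(sz i).
Hypothesis A_span : forall a, span (family P e) a.
Hypothesis m_free : free_family P m.

Let Phi0 : Phi 0 = 0.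
Proof. by apply: (addrI (Phi 0)); rewrite -PhiD !addr0. Qed.

Definition Pdeg d : pred I := fun i => P i && (sz i <= d)%N.
Definition filt d : B -> Prop := span (family (Pdeg d) m).

Lemma coef_in_algM (p : {poly R}) (q : {poly B}) j :
  (map_poly (in_alg B) p * q)`_j = \sum_(l < j.+1) p`_l *: q`_(j - l).
Proof.
rewrite coefM; apply: eq_bigr => l _.
by rewrite coef_map /= mulr_algl.
Qed.

Lemma coef_Phi_comb (s : seq I) (c : I -> {poly R}) j :
  (Phi (\sum_(i <- s) c i *: e i))`_j =
    \sum_(i <- s) (if (sz i <= j)%N then (c i)`_(j - sz i) else 0) *: m i.
Proof.
rewrite (big_morph Phi PhiD Phi0) coef_sum; apply: eq_bigr => i _.
rewrite PhiZ Phi_e coef_in_algM; case: leqP => [le_ij|lt_ji].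
  have lt : (j - sz i < j.+1)%N by rewrite ltnS leq_subr.
  rewrite (bigD1 (Ordinal lt)) //= subKn // coefZ coefXn eqxx mulr1 big1 ?addr0 // => l.
  move=> nl; rewrite coefZ coefXn; case: eqP => [el|_]; last by rewrite mulr0 scaler0.
  by case/eqP: nl; apply: val_inj; rewrite /= -el subKn // -ltnS.
rewrite scale0r big1 // => l _; rewrite coefZ coefXn.
rewrite ltn_eqF ?mulr0 ?scaler0 //; apply: leq_ltn_trans lt_ji; exact: leq_subr.
Qed.

Lemma Rees_free : free_family P e.
Proof.
move=> s c us Ps c0 i si; apply/polyP => j; rewrite coef0.
(* In degree j + sz i the element m_i comes exactly with the coefficient of degree j of [c i]. *)
have := congr1 (fun a => (Phi a)`_(j + sz i)) c0.
rewrite coef_Phi_comb Phi0 coef0 => /(m_free us Ps)/(_ i si).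
by rewrite leq_addl addnK.
Qed.

Lemma Rees_inj a : Phi a = 0 -> a = 0.
Proof.
have [s [c [us Ps ->]]] := span_familyP (A_span a) => p0.
rewrite big_seq big1 // => i si; have -> : c i = 0; last by rewrite scale0r.
apply/polyP => j; rewrite coef0.
have := congr1 (fun p : {poly B} => p`_(j + sz i)) p0.
rewrite coef_Phi_comb coef0 => /(m_free us Ps)/(_ i si).
by rewrite leq_addl addnK.
Qed.

(** t^(d - sz i) e_i maps to m_i t^d, so every monomial allowed in degree d is reached; conversely
    degree d only sees the m_i with sz i <= d. *)
Lemma Rees_image p : (exists a, Phi a = p) <-> (forall d, filt d p`_d).
Proof.
split=> [[a <-] d|Fp].
  have [s [c [us /allP Ps ->]]] := span_familyP (A_span a).
  rewrite coef_Phi_comb; apply: span_sum => i si; case: leqP => [le|_].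
    by apply/span_scale/span_gen; exists i => //; rewrite /Pdeg Ps.
  by rewrite scale0r; apply: Span0.
have mon d b : filt d b -> exists a, Phi a = b *: 'X^d.
  elim=> [|c _ x [i /andP[Pi le_id] ->] _ [a ea]].
    by exists 0; rewrite Phi0 scale0r.
  exists ((c *: 'X^(d - sz i)) *: e i + a); rewrite PhiD ea PhiZ Phi_e scalerDl.
  congr (_ + _); rewrite map_polyZ map_polyXn -!mul_polyC -mulrA.
  rewrite [_ * (_%:P * _)]mulrA -(commr_polyXn (m i)%:P) -mulrA -exprD subnK //.
  by rewrite mulrA -polyCM /= mulr_algl.
rewrite -[p]coefK poly_def; elim/big_rec: _ => [|d x _ [a ea]].
  by exists 0.
have [b eb] := mon d _ (Fp d).
by exists (b + a); rewrite PhiD ea eb.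
Qed.

Lemma Rees_free_module : free_module A.
Proof. exact: free_family_module Rees_free A_span. Qed.

End Rees.

(** * Enveloping and symmetric algebras with parameter t *)

Section PolyX.
Variable B : nzRingType.
Implicit Types a b c : B.

Lemma scaleXnM a b i j : (a *: 'X^i) * (b *: 'X^j) = (a * b) *: 'X^(i + j).
Proof.
rewrite -!mul_polyC -mulrA [X in _ * X]mulrA -(commr_polyXn b%:P) -mulrA -exprD.
by rewrite mulrA -polyCM.
Qed.

Lemma scaleXM a b : (a *: 'X) * (b *: 'X) = (a * b) *: 'X^2.
Proof. exact: (scaleXnM a b 1 1). Qed.

Lemma mulX_scaleX c : 'X * (c *: 'X) = c *: 'X^2.
Proof. by have := scaleXM 1 c; rewrite scale1r mul1r. Qed.

Lemma polyX_bracket a b : (a *: 'X) * (b *: 'X) - (b *: 'X) * (a *: 'X)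
  - 'X * ((a * b - b * a) *: 'X) = 0.
Proof. by rewrite !scaleXM mulX_scaleX scalerBl subrr. Qed.

End PolyX.

Section PolyLift.
Variables (k : comNzRingType) (M : lmodType k) (B : algType k) (g : M -> B).
Hypothesis g_lin : linear g.
Local Notation T := (tensalg M).

Definition tkap (c : k) : {poly B} := (c%:A)%:P.
(** Generators are placed in degree 1 in t, so that a commutation relation of [B] becomes its
    homogeneous version, with t in front of the bracket. *)
Definition tgen (x : M) : {poly B} := g x *: 'X.

Lemma tkap_nmod_morphism : nmod_morphism tkap.
Proof.
by split=> [|c d]; rewrite /tkap ?scale0r ?polyC0 // scalerDl polyCD.
Qed.
HB.instance Definition _ := GRing.isNmodMorphism.Build k {poly B} tkap tkap_nmod_morphism.
Lemma tkap_monoid_morphism : monoid_morphism tkap.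
Proof.
split=> [|c d]; rewrite /tkap ?scale1r ?polyC1 //.
by rewrite -polyCM mulr_algl scalerA.
Qed.
HB.instance Definition _ := GRing.isMonoidMorphism.Build k {poly B} tkap tkap_monoid_morphism.

Lemma tkap_comm c (p : {poly B}) : GRing.comm (tkap c) p.
Proof.
apply/polyP => i; rewrite /tkap coefCM coefMC mulr_algl.
by rewrite -[RHS]scalerAr mulr1.
Qed.

Lemma tgen_lin c x y : tgen (c *: x + y) = tkap c * tgen x + tgen y.
Proof.
rewrite /tgen g_lin scalerDl; congr (_ + _).
by rewrite /tkap mul_polyC scalerA mulr_algl.
Qed.

Definition tpol : T -> {poly B} := tens_lift tkap_comm tgen_lin.
HB.instance Definition _ := GRing.RMorphism.on tpol.

Lemma tpol_gen x : tpol (tensgen x) = g x *: 'X.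
Proof. exact: tens_lift_gen. Qed.
Lemma tpolZ c x : tpol (c *: x) = c%:A%:P * tpol x.
Proof. exact: tens_liftZ. Qed.

Lemma tpol_comm : commr_rmorph tpol ('X : {poly B}).
Proof. by move=> x; apply: commr_sym; apply: commr_polyX. Qed.

Definition plift : polyalg T -> {poly B} := horner_morph tpol_comm.
HB.instance Definition _ := GRing.RMorphism.on plift.

Lemma plift_const (x : T) : plift x%:P = tpol x.
Proof. exact: horner_morphC. Qed.

Lemma pliftB (x y : polyalg T) : plift (x - y) = plift x - plift y.
Proof. exact: rmorphB. Qed.

Lemma pliftZ (p : {poly k}) (x : polyalg T) :
  plift (p *: x) = map_poly (in_alg B) p * plift x.
Proof.
rewrite /GRing.scale /= /polyscale [LHS]rmorphM /=; congr (_ * _).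
rewrite /plift /horner_morph -map_poly_comp.
rewrite [X in X.[_]](_ : _ = map_poly polyC (map_poly (in_alg B) p)).
  by have := comp_polyXr (map_poly (in_alg B) p); rewrite /comp_poly.
rewrite -map_poly_comp; apply: eq_map_poly => c /=.
by rewrite tpolZ rmorph1 mulr1.
Qed.

Lemma plift_rel (z : polyalg T) (x y : T) :
  z = x%:P - ('X : {poly k}) *: (y%:P : polyalg T) -> plift z = tpol x - 'X * tpol y.
Proof.
have eC (t : T) : plift (t%:P : polyalg T) = tpol t := plift_const t.
move->; rewrite pliftB pliftZ map_polyX.
exact: (f_equal2 (fun a b => a - 'X * b) (eC x) (eC y)).
Qed.

End PolyLift.

(** * Words in the generators of a quotient of T(M)[t] *)

Section WordSpan.
Variables (k : comNzRingType) (M : lmodType k) (d : nat) (b : 'I_d -> M).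
Hypothesis b_span : forall x : M, exists a : 'I_d -> k, x = \sum_i a i *: b i.
Local Notation T := (tensalg M).
Variables (S : polyalg T -> Prop) (augS : forall s, S s -> aug s = 0).
Local Notation A := (quot augS).

Definition qgen (x : T) : A := qpi augS x%:P.

Lemma qgen_lin c x y : qgen (c *: x + y) = c%:P *: qgen x + qgen y.
Proof.
rewrite /qgen polyCD qpiD; congr (_ + _); rewrite -qpiZ; congr qpi.
by rewrite /GRing.scale /= /polyscale map_polyC /= -polyCM mulr_algl.
Qed.
Lemma qgenD x y : qgen (x + y) = qgen x + qgen y.
Proof. by have := qgen_lin 1 x y; rewrite !scale1r. Qed.
Lemma qgenB x y : qgen (x - y) = qgen x - qgen y.
Proof.
have := qgen_lin (-1) y x; rewrite polyCN scaleNr scale1r scaleN1r => e.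
by rewrite addrC e addrC.
Qed.
Lemma qgen0 : qgen 0 = 0.
Proof. by apply: (addrI (qgen 0)); rewrite -qgenD !addr0. Qed.
Lemma qgenZ c x : qgen (c *: x) = c%:P *: qgen x.
Proof. by have := qgen_lin c x 0; rewrite qgen0 !addr0. Qed.
Lemma qgenM x y : qgen (x * y) = qgen x * qgen y.
Proof. by rewrite /qgen polyCM qpiM. Qed.
Lemma qgen1 : qgen 1 = 1.
Proof. by []. Qed.
Lemma qgen_sum I (r : seq I) (F : I -> T) :
  qgen (\sum_(i <- r) F i) = \sum_(i <- r) qgen (F i).
Proof. exact: (big_morph _ qgenD qgen0). Qed.

Lemma qgen_tsum (c : 'I_d -> k) (t : 'I_d -> T) :
  qgen (\sum_l c l *: t l) = \sum_l (c l)%:P *: qgen (t l).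
Proof. by rewrite qgen_sum; apply: eq_bigr => l _; apply: qgenZ. Qed.

Lemma qgen_rel (x y : T) (z : polyalg T) :
  z = x%:P - ('X : {poly k}) *: (y%:P : polyalg T) -> S z -> qgen x = 'X *: qgen y.
Proof.
move=> ez Sz; have := qpi_gen augS Sz; rewrite ez qpiB qpiZ => /eqP.
by rewrite subr_eq0 => /eqP.
Qed.

Lemma qgen_swap (x y z : T) (w : polyalg T) :
  w = (x * y - y * x)%:P - ('X : {poly k}) *: (z%:P : polyalg T) -> S w ->
  qgen x * qgen y = qgen y * qgen x + 'X *: qgen z.
Proof.
move=> ew Sw; have e1 := qgen_rel ew Sw.
have e2 : qgen (x * y - y * x) = qgen x * qgen y - qgen y * qgen x.
  by rewrite qgenB (qgenM x y) (qgenM y x).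
by rewrite -e1 e2 addrC subrK.
Qed.

Definition qword (w : seq 'I_d) : A := \prod_(i <- w) qgen (tensgen (b i)).

Lemma qword_cat u v : qword (u ++ v) = qword u * qword v.
Proof. exact: big_cat. Qed.
Lemma qword_cons i w : qword (i :: w) = qgen (tensgen (b i)) * qword w.
Proof. exact: big_cons. Qed.

Lemma qword_swap u v i j X :
    qgen (tensgen (b i)) * qgen (tensgen (b j)) =
      qgen (tensgen (b j)) * qgen (tensgen (b i)) + X ->
  qword (u ++ i :: j :: v) - qword (u ++ j :: i :: v) = qword u * (X * qword v).
Proof.
move=> e.
have ring_swap (R : nzRingType) (p q a c x : R) : a * c = c * a + x ->
    p * (a * (c * q)) - p * (c * (a * q)) = p * (x * q).
  move=> ac; rewrite -mulrBr (mulrA a) (mulrA c) ac mulrDl; congr (_ * _).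
  by rewrite addrC addrA addNr add0r.
rewrite (qword_cat u (i :: j :: v)) (qword_cat u (j :: i :: v)).
rewrite (qword_cons i (j :: v)) (qword_cons j (i :: v)) (qword_cons i v) (qword_cons j v).
exact: ring_swap.
Qed.

Lemma qword_insert u v (p : {poly k}) (c : 'I_d -> k) :
  qword u * ((p *: qgen (tensgen (\sum_l c l *: b l))) * qword v) =
  \sum_l (p * (c l)%:P) *: qword (u ++ l :: v).
Proof.
have alg_insert (R : comNzRingType) (B : algType R) (x y : B) (q : R) (a : 'I_d -> R)
    (f : 'I_d -> B) :
    x * ((q *: \sum_l a l *: f l) * y) = \sum_l (q * a l) *: (x * (f l * y)).
  rewrite scaler_sumr mulr_suml mulr_sumr; apply: eq_bigr => l _.
  by rewrite scalerA -scalerAl -scalerAr.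
have -> : qgen (tensgen (\sum_l c l *: b l)) = \sum_l (c l)%:P *: qgen (tensgen (b l)).
  rewrite -qgen_tsum; congr qgen; rewrite linear_sum.
  by apply: eq_bigr => l _; rewrite linearZ.
apply: (etrans (alg_insert _ _ _ _ _ _ _)); apply: eq_bigr => l _; congr (_ *: _).
by rewrite (qword_cat u (l :: v)) (qword_cons l v).
Qed.

Lemma qword_span (a : A) : span (family predT qword) a.
Proof.
have gen t : span (family predT qword) (qgen t).
  elim/tensalg_ind: t => [|c x y Ix Iy|x y Iy].
  - by apply: span_gen; exists [::]; rewrite // /qword big_nil qgen1.
  - by rewrite qgen_lin; apply: span_add => //; apply: span_scale.
  - rewrite qgenM; have [a' ->] := b_span x.
    rewrite linear_sum qgen_sum mulr_suml; apply: span_sum => i _.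
    rewrite linearZ qgenZ -scalerAl; apply: span_scale.
    elim: Iy => [|c _ z [w _ ->] _ IH]; first by rewrite mulr0; apply: Span0.
    rewrite mulrDr -scalerAr -qword_cons; apply: SpanS => //.
    by exists (i :: w).
elim/qind: a => p; rewrite -[p]coefK poly_def.
rewrite (big_morph (qpi augS) (qpiD augS) (erefl _)).
apply: span_sum => i _.
have e : (p : {poly T})`_i *: 'X^i =
    ('X^i : {poly k}) *: (((p : {poly T})`_i)%:P : polyalg T) :> {poly T}.
  transitivity (map_poly (in_alg T) 'X^i * ((p : {poly T})`_i)%:P); last by [].
  by rewrite map_polyXn -mul_polyC commr_polyXn.
by rewrite [X in qpi _ X]e qpiZ; apply: span_scale; apply: gen.
Qed.

End WordSpan.

Section Words.
Variable d : nat.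

Fixpoint words N : seq (seq 'I_d) :=
  if N is N'.+1 then [::] :: [seq i :: w | i <- enum 'I_d, w <- words N'] else [:: [::]].

Lemma mem_words N w : (w \in words N) = (size w <= N)%N.
Proof.
elim: N w => [|N IH] [|i w] //=; rewrite inE /=.
apply/allpairsP/idP => [[[j v] [/= _ vN [_ ->]]]|].
  by rewrite ltnS -IH.
by rewrite ltnS -IH => wN; exists (i, w); rewrite mem_enum.
Qed.

Definition sorted_words N := undup [seq w <- words N | sorted (@ole d) w].

Lemma sorted_words_uniq N : uniq (sorted_words N).
Proof. exact: undup_uniq. Qed.

Lemma mem_sorted_words N :
  Pdeg (sorted (@ole d)) size N =1 mem (sorted_words N).
Proof. by move=> w; rewrite /= mem_undup mem_filter mem_words. Qed.

End Words.

Section SymT.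
Variables (k : fieldType) (n d : nat) (e : 'I_d -> sl k n).
Local Notation g := (sl k n).
Local Notation br := (@slbr k n).
Local Notation U := (uenv br).
Local Notation A := (symtalg br).
Hypothesis e_span : forall x : g, exists a : 'I_d -> k, x = \sum_i a i *: e i.

Let P0 := plift (ugen_linear br).

Lemma plift_symtrel z : symtrel br z -> P0 z = 0.
Proof.
case=> x [y] ez; rewrite /P0 (plift_rel (ugen_linear br) ez).
rewrite rmorphB !rmorphM /= !tpol_gen ugen_br.
exact: polyX_bracket.
Qed.

Definition sPhi : A -> {poly U} := quot_lift (F := P0) plift_symtrel.
HB.instance Definition _ := GRing.RMorphism.on sPhi.

Lemma sPhi_gen x : sPhi (symtgen br x) = ugen br x *: 'X.
Proof. by rewrite /sPhi /symtgen quot_liftE /= /P0 plift_const tpol_gen. Qed.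

Lemma sPhiZ (p : {poly k}) a : sPhi (p *: a) = map_poly (in_alg U) p * sPhi a.
Proof. by elim/qind: a => a; rewrite -qpiZ /sPhi !quot_liftE /= /P0 pliftZ. Qed.

Local Notation sword := (qword e (symtrel_aug (br := br))).

Lemma sPhi_word w : sPhi (sword w) = umon e w *: 'X^(size w).
Proof.
elim: w => [|i w IH]; first by rewrite /qword /umon !big_nil rmorph1 expr0 scale1r.
rewrite qword_cons rmorphM /= IH sPhi_gen /umon big_cons.
exact: (scaleXnM _ _ 1).
Qed.

Lemma symt_swap x y : symtgen br x * symtgen br y =
  symtgen br y * symtgen br x + 'X *: symtgen br (br x y).
Proof.
have S : symtrel br ((tensgen x * tensgen y - tensgen y * tensgen x)%:P
    - ('X : {poly k}) *: ((tensgen (br x y))%:P : polyalg (tensalg g))).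
  by exists x, y.
exact: (qgen_swap (symtrel_aug (br := br)) (erefl _) S).
Qed.

Lemma symt_span (a : A) : span (family (sorted (@ole d)) sword) a.
Proof.
refine (span_trans _ (qword_span e_span a)) => _ [w _ ->].
have /choice[c cE] : forall ij : 'I_d * 'I_d, exists c : 'I_d -> k,
    br (e ij.1) (e ij.2) = \sum_l c l *: e l by move=> ij; apply: e_span.
apply: (@straightening _ A d sword _ (size w) _ _ _ _ (fun i j l => c (i, j) l *: 'X)) => //.
- exact: Span0.
- by move=> *; apply: span_add.
- by move=> *; apply: span_scale.
- by move=> v sv _; apply: span_gen; exists v.
move=> u i j v _.
have es : symtgen br (e i) * symtgen br (e j) =
    symtgen br (e j) * symtgen br (e i) + 'X *: symtgen br (\sum_l c (i, j) l *: e l).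
  by rewrite -(cE (i, j)); apply: symt_swap.
have e1 := qword_swap (augS := symtrel_aug (br := br)) u v es.
have e2 := qword_insert e (symtrel_aug (br := br)) u v 'X (c (i, j)).
rewrite (etrans e1 e2) -sumrB; apply: span_sum => l _.
rewrite -scalerBl mulrC mul_polyC subrr scale0r; exact: Span0.
Qed.

End SymT.

(** * Reduction of (Sg)_t to Sg at t = 0 *)

Section SymAtZero.
Variables (k : comNzRingType) (g : lmodType k) (br : g -> g -> g).
Local Notation T := (tensalg g).
Local Notation St := (symtalg br).
Local Notation S := (symalg g).
Local Notation piS := (qpi (@symrel_aug k g)).
Local Notation piT := (qpi (symtrel_aug (br := br))).

Definition ev0_poly (p : polyalg T) : S := piS ((p : {poly T})`_0).

Lemma ev0_poly_nmod_morphism : nmod_morphism ev0_poly.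
Proof.
split=> [|x y]; rewrite /ev0_poly; first by rewrite coef0.
by rewrite coefD qpiD.
Qed.
HB.instance Definition _ :=
  GRing.isNmodMorphism.Build (polyalg T) S ev0_poly ev0_poly_nmod_morphism.

Lemma ev0_poly_monoid_morphism : monoid_morphism ev0_poly.
Proof.
split=> [|x y]; rewrite /ev0_poly; first by rewrite coef1.
by rewrite coef0M qpiM.
Qed.
HB.instance Definition _ :=
  GRing.isMonoidMorphism.Build (polyalg T) S ev0_poly ev0_poly_monoid_morphism.

Lemma ev0_polyB x y : ev0_poly (x - y) = ev0_poly x - ev0_poly y.
Proof. exact: raddfB. Qed.

Lemma ev0_polyZ (p : {poly k}) (x : polyalg T) : ev0_poly (p *: x) = p`_0 *: ev0_poly x.
Proof.
rewrite /ev0_poly -qpiZ; congr qpi.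
transitivity ((map_poly (in_alg T) p * (x : {poly T}))`_0); first by [].
by rewrite coef0M coef_map /= mulr_algl.
Qed.

Lemma ev0_poly_rel z : symtrel br z -> ev0_poly z = 0.
Proof.
case=> x [y] ez; rewrite ez.
rewrite ev0_polyB ev0_polyZ coefX scale0r subr0 /ev0_poly coefC /=.
by apply: qpi_gen; exists x, y.
Qed.

Definition ev0 : St -> S := quot_lift (F := ev0_poly) ev0_poly_rel.
HB.instance Definition _ := GRing.RMorphism.on ev0.

Lemma ev0_pi x : ev0 (piT x) = ev0_poly x.
Proof. exact: quot_liftE. Qed.

Lemma ev0_gen x : ev0 (symtgen br x) = symgen x.
Proof. by rewrite [LHS]ev0_pi /ev0_poly coefC. Qed.

Lemma ev0Z (p : {poly k}) a : ev0 (p *: a) = p`_0 *: ev0 a.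
Proof. by elim/qind: a => a; rewrite -qpiZ !ev0_pi ev0_polyZ. Qed.

Lemma ev0_surj b : exists a, ev0 a = b.
Proof.
elim/qind: b => t; exists (piT t%:P).
by rewrite ev0_pi /ev0_poly coefC.
Qed.

(** In (Sg)_t a commutator equals t times a bracket, so each generator of the ideal defining Sg
    becomes divisible by t. This determines the kernel of evaluation at t = 0. *)
Lemma symideal_X t : ideal (@symrel k g) t -> exists b : St,
  qgen (symtrel_aug (br := br)) t = 'X *: b.
Proof.
elim=> [|a s b x [y [z es]] _ [c ec]].
  by exists 0; rewrite scaler0 qgen0.
have S1 : symtrel br ((tensgen y * tensgen z - tensgen z * tensgen y)%:P
    - ('X : {poly k}) *: ((tensgen (br y z))%:P : polyalg T)) by exists y, z.
have e1 := qgen_rel (symtrel_aug (br := br)) (erefl _) S1.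
exists (qgen (symtrel_aug (br := br)) a * qgen (symtrel_aug (br := br)) (tensgen (br y z))
  * qgen (symtrel_aug (br := br)) b + c).
rewrite qgenD ec scalerDr; congr (_ + _).
rewrite (qgenM _ (a * s) b) (qgenM _ a s) es e1.
have alg (R : comNzRingType) (B : algType R) (p : R) (u v w : B) :
    u * (p *: v) * w = p *: (u * v * w) by rewrite -scalerAr -scalerAl.
exact: alg.
Qed.

Lemma polyalg_split (p : polyalg T) : exists q : polyalg T,
  p = ((p : {poly T})`_0)%:P + ('X : {poly k}) *: q.
Proof.
exists (\poly_(i < size (p : {poly T})) (p : {poly T})`_i.+1).
transitivity (((p : {poly T})`_0)%:P + map_poly (in_alg T) 'X *
  \poly_(i < size (p : {poly T})) (p : {poly T})`_i.+1); last by [].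
rewrite map_polyX; apply/polyP => -[|i]; rewrite coefD coefC coefXM /= ?addr0 // add0r.
rewrite coef_poly; case: ltnP => // le.
by rewrite nth_default // (leq_trans le) // leqnSn.
Qed.

Lemma ev0_ker a : ev0 a = 0 -> exists b, a = 'X *: b.
Proof.
elim/qind: a => p; rewrite ev0_pi /ev0_poly -(raddf0 piS) => /qpiP; rewrite subr0.
move/symideal_X => [b eb]; have [q eq] := polyalg_split p.
exists (b + piT q); rewrite eq qpiD qpiZ scalerDr; congr (_ + _).
exact: eb.
Qed.

End SymAtZero.

Section DualFunctionals.
Variables (k : fieldType) (n d : nat) (c : k) (e f : 'I_d -> sl k n).
Hypothesis n_gt0 : (0 < n)%N.
Hypothesis char0 : forall m, m.+1%:R != 0 :> k.
Hypothesis ef : dual_bases c e f.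
Local Notation br := (@slbr k n).

(** The functional sends u to c tr(u f_i), u acting by the basic representation: it vanishes at 1
    because f_i is traceless, and duality gives its values on the e_j. *)
Lemma dual_functionals : exists phi : 'I_d -> uenv br -> k^o,
  [/\ forall i, linear (phi i), forall i, phi i 1 = 0 &
      forall i j, phi i (ugen br (e j)) = (i == j)%:R].
Proof.
case: n n_gt0 e f ef => // m _ e' f' ef'.
have s_lin : linear (fun x : sl k m.+1 => slval x) by [].
have s_br (x y : sl k m.+1) : slval (slbr x y) = slval x * slval y - slval y * slval x.
  by [].
exists (fun i u => c * \tr (uliftr s_lin s_br u *m f' i)); split.
- move=> i a x y; rewrite linearP mulmxDl linearD /= mulrDr -scalemxAl linearZ /=.
  by rewrite mulrCA.
- move=> i; rewrite rmorph1 mul1mx; have /eqP -> := valP (f' i).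
  by rewrite mulr0.
- by move=> i j; rewrite uliftr_gen ef'.1 eq_sym.
Qed.

Lemma umon_free : free_family (sorted (@ole d)) (umon e).
Proof.
have [phi [phi_lin phi1 phi_gen]] := dual_functionals.
by move=> s a us sS /(pbw_free char0 phi_lin phi1 phi_gen us sS).
Qed.

End DualFunctionals.

(* An algebra over K[t], regarded as a module over the constants K. *)
Definition cres (K : comNzRingType) (A : lmodType {poly K}) : Type := A.

Section RestrictScalars.
Variables (K : comNzRingType) (A : lmodType {poly K}).
HB.instance Definition _ := GRing.Zmodule.on (cres A).

Definition cres_scale (c : K) (a : cres A) : cres A := c%:P *: (a : A).

Lemma cres_scaleA a b v : cres_scale a (cres_scale b v) = cres_scale (a * b) v.
Proof. by rewrite /cres_scale scalerA polyCM. Qed.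
Lemma cres_scale1 : left_id 1 cres_scale.
Proof. by move=> v; rewrite /cres_scale scale1r. Qed.
Lemma cres_scaleDr : right_distributive cres_scale +%R.
Proof. by move=> c x y; rewrite /cres_scale -scalerDr. Qed.
Lemma cres_scaleDl v : {morph cres_scale^~ v : a b / a + b}.
Proof. by move=> a b; rewrite /cres_scale polyCD scalerDl. Qed.
HB.instance Definition _ := GRing.Zmodule_isLmodule.Build K (cres A)
  cres_scaleA cres_scale1 cres_scaleDr cres_scaleDl.

Lemma cresZ c (a : A) : c *: (a : cres A) = (c%:P *: a : A).
Proof. by []. Qed.

End RestrictScalars.

(** * Straightening when the generators commute only modulo t and h *)

Section FlatStraightening.
Variables (k : fieldType) (d : nat) (A : algType {poly (series k)}) (gen : 'I_d -> A).
Local Notation K := (series k).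
Local Notation h := (hvar k).
Local Notation word := (seq 'I_d).
Variables (b : 'I_d -> 'I_d -> 'I_d -> K) (s : 'I_d -> 'I_d -> 'I_d -> 'I_d -> K).
Hypothesis gen_swap : forall i j, gen i * gen j = gen j * gen i
  + 'X *: (\sum_l (b i j l)%:P *: gen l)
  + h%:P *: (\sum_l \sum_l' (s i j l l')%:P *: (gen l * gen l')).

Definition gword (w : word) : A := \prod_(i <- w) gen i.

Lemma gword_cat u v : gword (u ++ v) = gword u * gword v.
Proof. exact: big_cat. Qed.
Lemma gword_cons i v : gword (i :: v) = gen i * gword v.
Proof. exact: big_cons. Qed.

(* The words of total degree N, where t has degree 1. *)
Let M N (w : word) : A := 'X^(N - size w) *: gword w.

Let M_swap N u i j v : (size u + size v + 2 <= N)%N ->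
  M N (u ++ i :: j :: v) - M N (u ++ j :: i :: v)
    - \sum_l (b i j l)%:P *: M N (u ++ l :: v) =
  h%:P *: \sum_l \sum_l' (s i j l l')%:P *: M N (u ++ l :: l' :: v).
Proof.
move=> le_N; pose N2 := (N - (size u + size v + 2))%N.
have e2 l l' : (N - size (u ++ l :: l' :: v))%N = N2.
  by rewrite size_cat /= /N2 addn2 !addnS.
have e1 l : (N - size (u ++ l :: v))%N = N2.+1.
  rewrite size_cat /= /N2; move: le_N; rewrite addn2 !addnS => le_N.
  by rewrite -subSn // subSS.
rewrite /M !e2 !gword_cat !gword_cons -scalerBr -mulrBr.
rewrite (mulrA (gen i)) (mulrA (gen j)) -mulrBl gen_swap.
have cancel (V : zmodType) (x y z : V) : x + y + z - x = y + z.
  by rewrite addrAC [x + y - x]addrAC subrr add0r.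
rewrite cancel mulrDl mulrDr scalerDr.
have -> : \sum_l (b i j l)%:P *: ('X^(N - size (u ++ l :: v)) *: gword (u ++ l :: v)) =
    'X^N2 *: (gword u * ('X *: (\sum_l (b i j l)%:P *: gen l) * gword v)).
  rewrite -scalerAl -scalerAr mulr_suml mulr_sumr !scaler_sumr; apply: eq_bigr => l _.
  rewrite -scalerAl -scalerAr e1 gword_cat gword_cons !scalerA.
  by rewrite exprSr mulrC -mulrA.
rewrite [LHS]addrAC subrr add0r -scalerAl -scalerAr mulr_suml mulr_sumr !scaler_sumr.
apply: eq_bigr => l _; rewrite mulr_suml mulr_sumr !scaler_sumr; apply: eq_bigr => l' _.
rewrite -scalerAl -scalerAr e2 gword_cat !gword_cons !scalerA -mulrA.
congr (_ *: _); last by rewrite !mulrA.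
by rewrite mulrC -!mulrA.
Qed.

(** Nakayama's lemma needs finitely many generators over k[[h]], so scalars are restricted to k[[h]]
    and each word of length at most N is multiplied by the power of t that brings it to degree N.
    The relations are homogeneous for this degree, so straightening modulo h stays inside a finite
    set. *)
Lemma flat_straightening w : span (family (sorted (@ole d)) gword) (gword w).
Proof.
pose N := size w; pose Mc : word -> cres A := M N.
pose Ps : cres A -> Prop := span (family (Pdeg (sorted (@ole d)) size N) Mc).
have PsD x y : Ps x -> Ps y -> Ps (x + y) by apply: span_add.
have PsZ a x : Ps x -> Ps (a *: x) by apply: span_scale.
have Ps0 : Ps 0 by apply: Span0.
have words_sum (v : cres A) : span (family (fun w => size w <= N)%N Mc) v ->
    exists a : word -> K, v = \sum_(w <- undup (words d N)) a w *: Mc w.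
  apply: span_family_seq; first exact: undup_uniq.
  by move=> w'; rewrite /= mem_undup mem_words.
(* Membership in the sorted span modulo h times the span of all words of degree N: [straightening]
   propagates it, and it is the hypothesis of [nakayama]. *)
pose P1 (x : cres A) := exists p q, [/\ Ps p,
  span (family (fun w => size w <= N)%N Mc) q & x = p + h *: q].
have st : forall w', (size w' <= N)%N -> P1 (Mc w').
  apply: (@straightening _ _ d Mc P1 N _ _ _ _ b).
  - by exists 0, 0; split; rewrite ?scaler0 ?addr0 //; apply: Span0.
  - move=> x y [p [q [Pp Qq ->]]] [p' [q' [Pp' Qq' ->]]].
    exists (p + p'), (q + q'); split; [exact: PsD|exact: span_add|].
    by rewrite scalerDr addrACA.
  - move=> a x [p [q [Pp Qq ->]]]; exists (a *: p), (a *: q).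
    split; [exact: PsZ|exact: span_scale|].
    by rewrite scalerDr !scalerA mulrC.
  - move=> w' sw' wN; exists (Mc w'), 0; split; last by rewrite scaler0 addr0.
      by apply: span_gen; exists w' => //; rewrite /Pdeg sw'.
    exact: Span0.
  - move=> u i j v le_N.
    exists 0, (\sum_l \sum_l' s i j l l' *: Mc (u ++ l :: l' :: v)); split=> //.
      apply: span_sum => l _; apply: span_sum => l' _; apply: span_scale.
      apply: span_gen; exists (u ++ l :: l' :: v) => //.
      by rewrite size_cat /=; move: le_N; rewrite addn2 !addnS.
    rewrite add0r; exact: (M_swap i j le_N).
have Nak : Ps (Mc w).
  apply: (@nakayama k (cres A) Ps PsD PsZ Ps0 word (undup (words d N)) Mc).
    move=> w'; rewrite mem_undup mem_words => /st[p [q [Pp /words_sum[a ->] ->]]].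
    by exists p, a.
  by rewrite mem_undup mem_words.
have eM : gword w = Mc w by rewrite /Mc /M subnn expr0 scale1r.
rewrite eM; move: Nak; rewrite /Ps.
elim=> [|a _ x [w' /andP[sw' _] ->] _ IH]; first exact: Span0.
apply: (@span_add _ A) => //; rewrite cresZ; apply: span_scale; apply: span_scale.
by apply: span_gen; exists w'.
Qed.

End FlatStraightening.

(** * The reflection algebra and its embedding in U_h[t] *)

Section ReflectionAlgebra.
Variables (k : fieldType) (n : nat) (H : qea k n) (V : basic_rep H).
Hypothesis char0 : forall m, m.+1%:R != 0 :> k.
Hypothesis n_gt0 : (0 < n)%N.
Local Notation g := (sl k n).
Local Notation U := (uenv (@slbr k n)).
Local Notation Uh := (series U).
Local Notation K := (series k).
Local Notation iota := (ugen (@slbr k n)).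
Local Notation C := (Cel V).
Local Notation Ci := (ringinv (Cel V)).
Local Notation h := (hvar k).
Local Notation Delta := (comulh H).
Local Notation T := (tensalg (gh V)).

Variables (c : k) (d : nat) (e f : 'I_d -> g).
Hypothesis ef : dual_bases c e f.
Hypothesis casE : casimir H = \sum_i tpure (iota (e i)) (iota (f i)).

Local Notation bet := (bgh V c e).

Lemma brhE (x y : gh V) : ghval (brh x y) = Ci * adh H (C * x) (C * y).
Proof.
apply: ghof_in; apply/gh_predP; rewrite mulrA (Cel_inv V).1 mul1r.
by apply: adh_inL; apply/gh_predP; apply: (valP y).
Qed.

Lemma gh_inL (x : gh V) : inL V (C * ghval x).
Proof. by apply/gh_predP; apply: (valP x). Qed.

Lemma Ci_adh_in (w : Uh) (y : gh V) : Ci * adh H w (C * ghval y) \in gh_pred V.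
Proof.
apply/gh_predP; rewrite mulrA (Cel_inv V).1 mul1r.
by apply: adh_inL; apply: gh_inL.
Qed.

Lemma Ci_inL_in x : inL V x -> Ci * x \in gh_pred V.
Proof. by move=> Lx; apply/gh_predP; rewrite mulrA (Cel_inv V).1 mul1r. Qed.

(** [inL_mul] for C x and C y is multiplied by C^-2, and centrality of C puts each factor in its
    place. The outcome is the relation of [Jt] at t = 1. *)
Lemma gh_mul (x y : gh V) : ghval x * ghval y =
  \sum_(p <- ldecomp V (C * x)) (Ci * adh H p.1 (C * y)) * (Ci * p.2)
  + Ci * adh H (C * x) (C * y).
Proof.
have [CC cC] := Cel_inv V.
have cCi z : z * Ci = Ci * z := ringinv_Cel_central V z.
have := inL_mul (C * ghval y) (gh_inL x).
move/(congr1 (fun z => Ci * (Ci * z))).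
have cancel (R : nzRingType) (ci cc u v : R) : ci * cc = 1 -> u * cc = cc * u ->
    ci * (ci * (cc * u * (cc * v))) = u * v.
  move=> ic uc; rewrite -(mulrA cc u) (mulrA ci cc) ic mul1r (mulrA u cc) uc.
  by rewrite -(mulrA cc) (mulrA ci) ic mul1r.
rewrite (cancel _ _ _ (ghval x) (ghval y) cC (Cel_central V (ghval x))) => ->.
rewrite !mulrDr addrC; congr (_ + _).
  rewrite !mulr_sumr; apply: eq_bigr => p _.
  by rewrite -[RHS]mulrA [in RHS](mulrA _ Ci) cCi -(mulrA Ci).
by rewrite Cel_central (mulrA Ci C) cC mul1r.
Qed.

Let iota_ghval_lin : linear (@ghval k n H V). Proof. by []. Qed.

Lemma plift_Jt z : @Jt k n H V z -> plift iota_ghval_lin z = 0.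
Proof.
case=> x [y] ez; rewrite (plift_rel iota_ghval_lin ez).
rewrite rmorphB rmorphM /= !tpol_gen.
have -> : tpol iota_ghval_lin (sigmah x y) = \sum_(p <- ldecomp V (C * x))
    ((Ci * adh H p.1 (C * y)) * (Ci * p.2)) *: 'X^2.
  rewrite /sigmah rmorph_sum /=; apply: eq_big_seq => p ps.
  have Lp : inL V p.2 by apply: (ldecompP (gh_inL x)).1.
  rewrite rmorphM /= !tpol_gen scaleXM; congr (_ * _ *: _); apply: ghof_in.
    exact: Ci_adh_in.
  exact: Ci_inL_in.
rewrite scaleXM mulX_scaleX -scaler_suml brhE gh_mul -!scalerBl.
by rewrite -addrA -opprD subrr scale0r.
Qed.

Definition hPhi : Sth V -> {poly Uh} := quot_lift (F := plift iota_ghval_lin) plift_Jt.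
HB.instance Definition _ := GRing.RMorphism.on hPhi.

Local Notation hword := (qword bet (@Jt_aug k n H V)).
Local Notation qg := (qgen (@Jt_aug k n H V)).

Lemma hPhi_gen x : hPhi (sthgen x) = ghval x *: 'X.
Proof. by rewrite /hPhi /sthgen quot_liftE /= plift_const tpol_gen. Qed.

Lemma hPhiZ (p : {poly K}) a : hPhi (p *: a) = map_poly (in_alg Uh) p * hPhi a.
Proof. by elim/qind: a => a; rewrite -qpiZ /hPhi !quot_liftE /= pliftZ. Qed.

Definition bmon (w : seq 'I_d) : Uh := \prod_(i <- w) beta V c e i.

Lemma hPhi_word w : hPhi (hword w) = bmon w *: 'X^(size w).
Proof.
elim: w => [|i w IH]; first by rewrite /qword /bmon !big_nil rmorph1 expr0 scale1r.
rewrite qword_cons rmorphM /= IH hPhi_gen /bmon big_cons.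
exact: (scaleXnM _ _ 1).
Qed.

Lemma bmon_0 w : scoef (bmon w) 0 = umon e w.
Proof.
elim: w => [|i w IH]; rewrite /bmon /umon ?big_nil // !big_cons scoef0M.
by rewrite (beta_0 V char0 ef casE); congr (_ * _); apply: IH.
Qed.

Lemma bmon_free0 : free_family (sorted (@ole d)) (fun w => scoef (bmon w) 0).
Proof.
have := umon_free n_gt0 char0 ef.
by rewrite (_ : umon e = fun w => scoef (bmon w) 0) //; apply/funext => w; rewrite bmon_0.
Qed.

Lemma bmon_free : free_family (sorted (@ole d)) bmon.
Proof. exact: free_family_h bmon_free0. Qed.

Lemma Sth_rel (x y : gh V) : qg (tensgen x) * qg (tensgen y) =
  qg (sigmah x y) + 'X *: qg (tensgen (brh x y)).
Proof.
have S1 : Jt ((tensgen x * tensgen y - sigmah x y)%:P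
    - ('X : {poly K}) *: ((tensgen (brh x y))%:P : polyalg T)) by exists x, y.
have e1 := qgen_rel (@Jt_aug k n H V) (erefl _) S1.
have e2 := qgenB (@Jt_aug k n H V) (tensgen x * tensgen y) (sigmah x y).
rewrite -(qgenM _ (tensgen x) (tensgen y)) -e1 e2 addrC subrK.
by [].
Qed.

(** This is the sense in which sigma_h is the flip modulo h. The decomposition behind [sigmah] is an
    arbitrary choice, so only its sum is known; expanding the second legs in the basis [bL] makes it
    comparable with the coproduct at h = 0. *)
Lemma sigmah_beta i (y : gh V) : exists w : 'I_d -> gh V,
  sigmah (bet i) y = tensgen y * tensgen (bet i) + h *: \sum_l tensgen (w l) * tensgen (bet l).
Proof.
pose x := bet i; pose s := ldecomp V (C * ghval x).
have [Ls Ds] := ldecompP (gh_inL x); rewrite -/s in Ls Ds.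
have /choice[kap kapE] : forall p : Uh * Uh, exists a : 'I_d -> K,
    p \in s -> p.2 = \sum_l a l *: bL V c e l.
  move=> p; have [/Ls/(inL_span char0 n_gt0 ef)[a ea]|ps] := boolP (p \in s).
    by exists a.
  by exists (fun=> 0).
pose w l := \sum_(p <- s) kap p l *: p.1.
have [Y YE Yval] : exists2 Y : Uh -> gh V,
    forall z, Y z = ghof V (Ci * adh H z (C * ghval y)) &
    forall z, ghval (Y z) = Ci * adh H z (C * ghval y).
  exists (fun z => ghof V (Ci * adh H z (C * ghval y))) => // z.
  by apply: ghof_in; apply: Ci_adh_in.
have lY : klin Y.
  move=> a u v; apply: ghval_inj; have lg := @ghval_klin k n H V.
  have e1 := etrans (klinD lg (a *: Y u) (Y v)) (congr1 (fun z => z + _) (klinZ lg a (Y u))).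
  rewrite e1 (Yval u) (Yval v) (Yval (a *: u + v)).
  by rewrite (klinD (adh_klinl H _)) (klinZ (adh_klinl H _)) mulrDr scalerAr.
have Y1 : Y 1 = y.
  by apply: ghval_inj; rewrite Yval adh1 mulrA (Cel_inv V).2 mul1r.
have lt : klin (@tensgen K (gh V)) by move=> *; apply: tensgen_linear.
have sE : sigmah x y = \sum_l tensgen (Y (w l)) * tensgen (bet l).
  rewrite /sigmah -/s.
  transitivity (\sum_(p <- s) \sum_l tensgen (Y (kap p l *: p.1)) * tensgen (bet l)).
    apply: eq_big_seq => p ps.
    have -> : ghof V (Ci * p.2) = \sum_l kap p l *: bet l.
      apply: ghval_inj; rewrite ghof_in; last by apply: Ci_inL_in; apply: Ls.
      rewrite (kapE p ps) mulr_sumr (klin_sum (@ghval_klin k n H V)).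
      by apply: eq_bigr => l _; rewrite (klinZ (@ghval_klin k n H V)) scalerAr.
    rewrite (klin_sum lt) mulr_sumr; apply: eq_bigr => l _.
    by rewrite -YE (klinZ lY) !(klinZ lt) -scalerAr scalerAl.
  rewrite exchange_big; apply: eq_bigr => l _ /=.
  by rewrite /w (klin_sum lY) (klin_sum lt) mulr_suml.
have [phi [phi_lin phi1 phi_gen]] := dual_functionals n_gt0 ef.
(* At h = 0 the term x (x) C is e_i (x) 1, which cancels against the first half of the primitive
   coproduct; applying [phi l] to the second leg of the rest isolates the constant term of [w l]. *)
have w0 l : scoef (w l) 0 = (l == i)%:R *: 1.
  have := congr1 (fun z => scoef z 0) Ds.
  rewrite comulh_0 scoefD scoef_sum scoef_stens big_ord1 subn0 scoef0M Cel_0 mul1r.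
  rewrite (beta_0 V char0 ef casE) comul0_gen => /addrI e1.
  have bt : tbilin (fun a b : U => phi l b *: a).
    split=> a u v z; first by rewrite scalerDr !scalerA mulrC.
    by rewrite phi_lin scalerDl -scalerA.
  have ltl : @klin k _ _ (tlift (fun a b : U => phi l b *: a)).
    by move=> a u v; apply: tlift_linear.
  have := congr1 (tlift (fun a b : U => phi l b *: a)) e1.
  rewrite (tlift_pure bt) phi_gen => ->; rewrite (klin_sum ltl).
  rewrite (eq_big_seq (fun p => \sum_j scoef (kap p j) 0 *:
      (phi l (iota (e j)) *: scoef p.1 0))); last first.
    move=> p ps; rewrite scoef_stens big_ord1 subn0 (tlift_pure bt) (kapE p ps) scoef_sum.
    have lp : @klin k _ k^o (phi l) := phi_lin l.
    rewrite (klin_sum lp) scaler_suml; apply: eq_bigr => j _.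
    by rewrite scoef0Z (bL_0 V char0 ef casE) (klinZ lp) -scalerA.
  rewrite /w scoef_sum; apply: eq_bigr => p _; rewrite scoef0Z (bigD1 l) //= phi_gen eqxx scale1r.
  rewrite big1 ?addr0 // => j jl.
  by rewrite phi_gen eq_sym (negPf jl) scale0r scaler0.
have /choice[w' w'E] : forall l, exists z, w l = (l == i)%:R *: 1 + h *: z.
  move=> l; exists (sdrop (w l)); rewrite {1}[w l]sdropE w0; congr (_ + _).
  by rewrite scstZ; congr (_ *: _); case: eqP.
exists (fun l => Y (w' l)).
rewrite -/x sE (eq_bigr (fun l => (l == i)%:R *: (tensgen y * tensgen (bet l)) +
    h *: (tensgen (Y (w' l)) * tensgen (bet l)))); last first.
  move=> l _; rewrite w'E (klinD lY) !(klinZ lY) Y1 (klinD lt) !(klinZ lt) mulrDl.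
  by rewrite -!scalerAl.
rewrite big_split -scaler_sumr /= (bigD1 i) //= eqxx scale1r big1 ?addr0 // => l.
by move=> /negPf ->; rewrite scale0r.
Qed.

End ReflectionAlgebra.

Section SeriesConstantTerm.
Variables (A : nzRingType).

Definition sc0 (x : series A) : A := scoef x 0.

Lemma sc0_nmod_morphism : nmod_morphism sc0.
Proof. by []. Qed.
HB.instance Definition _ := GRing.isNmodMorphism.Build (series A) A sc0 sc0_nmod_morphism.
Lemma sc0_monoid_morphism : monoid_morphism sc0.
Proof. by split=> // x y; rewrite /sc0 /= big_ord1. Qed.
HB.instance Definition _ := GRing.isMonoidMorphism.Build (series A) A sc0 sc0_monoid_morphism.

End SeriesConstantTerm.

(** * The image of (Sg)_{t,h} in U_h(g)[t] and its stability under ad *)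

Section DoubleQuantization.
Variables (k : fieldType) (n : nat) (H : qea k n) (V : basic_rep H).
Hypothesis char0 : forall m, m.+1%:R != 0 :> k.
Hypothesis n_gt0 : (0 < n)%N.
Local Notation g := (sl k n).
Local Notation br := (@slbr k n).
Local Notation U := (uenv br).
Local Notation Uh := (series U).
Local Notation K := (series k).
Local Notation iota := (ugen br).
Local Notation C := (Cel V).
Local Notation h := (hvar k).
Local Notation Delta := (comulh H).
Local Notation gam := (antipode H).
Local Notation T := (tensalg (gh V)).
Local Notation A := (Sth V).
Local Notation St := (symtalg br).

Variables (c : k) (d : nat) (e f : 'I_d -> g).
Hypothesis ef : dual_bases c e f.
Hypothesis casE : casimir H = \sum_i tpure (iota (e i)) (iota (f i)).

Local Notation bet := (bgh V c e).
Local Notation qg := (qgen (@Jt_aug k n H V)).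
Local Notation hword := (qword bet (@Jt_aug k n H V)).
Local Notation sword := (qword e (symtrel_aug (br := br))).
Local Notation bm := (bmon V c e).
Local Notation srt := (sorted (@ole d)).
Local Notation hP := (@hPhi k n H V).
Local Notation sP := (@sPhi k n).

Lemma adh_Cmul x y : adh H x (C * y) = C * adh H x y.
Proof.
rewrite /adh; have lD := comulh_klin H.
rewrite (hlift_comp (L := fun z => C * z)); [|by klin|by klin].
by apply: eq_hlift => a b; rewrite !mulrA Cel_central.
Qed.

Lemma adh_one x : adh H x 1 = counith x *: 1.
Proof.
have lD := comulh_klin H; rewrite -(antipode_mulr H (L := fun z => z)); last by klin.
by apply: eq_hlift => a b; rewrite mulr1.
Qed.

Lemma adh_in x (y : gh V) : adh H x (ghval y) \in gh_pred V.
Proof. by apply/gh_predP; rewrite -adh_Cmul; apply: adh_inL; apply: gh_inL. Qed.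

Lemma Sth_swap : exists (b : 'I_d -> 'I_d -> 'I_d -> K)
    (s : 'I_d -> 'I_d -> 'I_d -> 'I_d -> K), forall i j,
  qg (tensgen (bet i)) * qg (tensgen (bet j)) = qg (tensgen (bet j)) * qg (tensgen (bet i))
  + 'X *: (\sum_l (b i j l)%:P *: qg (tensgen (bet l)))
  + h%:P *: (\sum_l \sum_l' (s i j l l')%:P *:
       (qg (tensgen (bet l)) * qg (tensgen (bet l')))).
Proof.
have span1 (y : gh V) := gh_span char0 n_gt0 ef y.
have lt : klin (@tensgen K (gh V)) by move=> *; apply: tensgen_linear.
have qsum (a : 'I_d -> K) : qg (tensgen (\sum_l a l *: bet l)) =
    \sum_l (a l)%:P *: qg (tensgen (bet l)).
  rewrite -qgen_tsum; congr (qg _); rewrite (klin_sum lt).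
  by apply: eq_bigr => l _; rewrite (klinZ lt).
have /choice[bs bsE] : forall ij : 'I_d * 'I_d,
    exists bs : ('I_d -> K) * ('I_d -> 'I_d -> K),
  qg (tensgen (bet ij.1)) * qg (tensgen (bet ij.2)) =
    qg (tensgen (bet ij.2)) * qg (tensgen (bet ij.1))
  + 'X *: (\sum_l (bs.1 l)%:P *: qg (tensgen (bet l)))
  + h%:P *: (\sum_l \sum_l' (bs.2 l l')%:P *:
       (qg (tensgen (bet l)) * qg (tensgen (bet l')))).
  move=> [i j] /=; have [w we] := sigmah_beta char0 n_gt0 ef casE i (bet j).
  have [b be] := span1 (brh (bet i) (bet j)).
  have /choice[a ae] : forall l, exists a : 'I_d -> K, w l = \sum_l' a l' *: bet l'.
    by move=> l; apply: span1.
  exists (b, fun l' l => a l l') => /=.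
  have e2 : qg (sigmah (bet i) (bet j)) = qg (tensgen (bet j)) * qg (tensgen (bet i))
      + h%:P *: \sum_l qg (tensgen (w l)) * qg (tensgen (bet l)).
    apply: etrans (congr1 qg we) _; apply: etrans (qgenD _ _ _) _; congr (_ + _).
      exact: qgenM.
    apply: etrans (qgenZ _ _ _) _; congr (_ *: _).
    by apply: etrans (qgen_sum _ _ _) _; apply: eq_bigr => l _; apply: qgenM.
  have e3 : qg (tensgen (brh (bet i) (bet j))) = \sum_l (b l)%:P *: qg (tensgen (bet l)).
    exact: etrans (congr1 (fun z => qg (tensgen z)) be) (qsum b).
  have e4 l : qg (tensgen (w l)) * qg (tensgen (bet l)) =
      \sum_l' (a l l')%:P *: (qg (tensgen (bet l')) * qg (tensgen (bet l))).
    have -> : qg (tensgen (w l)) = \sum_l' (a l l')%:P *: qg (tensgen (bet l')).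
      exact: etrans (congr1 (fun z => qg (tensgen z)) (ae l)) (qsum (a l)).
    by rewrite mulr_suml; apply: eq_bigr => l' _; rewrite scalerAl.
  apply: etrans (Sth_rel _ _) _.
  apply: etrans (f_equal2 (fun x y => x + 'X *: y) e2 e3) _.
  rewrite addrAC; congr (_ + _); congr (_ *: _).
  by rewrite exchange_big; apply: eq_bigr => l _; apply: e4.
by exists (fun i j => (bs (i, j)).1), (fun i j => (bs (i, j)).2) => i j; apply: bsE (i, j).
Qed.

Lemma Sth_span (a : A) : span (family srt hword) a.
Proof.
have [b [s sw]] := Sth_swap.
refine (span_trans _ (qword_span (gh_span char0 n_gt0 ef) a)) => _ [w _ ->].
exact: (flat_straightening sw w).
Qed.

Lemma hPD a b : hP (a + b) = hP a + hP b. Proof. exact: rmorphD. Qed.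
Lemma hPB a b : hP (a - b) = hP a - hP b. Proof. exact: rmorphB. Qed.
Lemma hPM a b : hP (a * b) = hP a * hP b. Proof. exact: rmorphM. Qed.
Lemma hP0 : hP 0 = 0. Proof. exact: rmorph0. Qed.
Lemma hP_sum I (r : seq I) (F : I -> A) : hP (\sum_(i <- r) F i) = \sum_(i <- r) hP (F i).
Proof. exact: (big_morph _ hPD hP0). Qed.

Lemma coef_hPZ p a j : (hP (p *: a))`_j = \sum_(l < j.+1) p`_l *: (hP a)`_(j - l).
Proof. by rewrite hPhiZ coef_in_algM. Qed.

Lemma coef_hPZC (x : K) a j : (hP (x%:P *: a))`_j = x *: (hP a)`_j.
Proof. by rewrite hPhiZ map_polyC /= coefCM mulr_algl. Qed.

Lemma hP_word w : hP (hword w) = bm w *: 'X^(size w).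
Proof. exact: hPhi_word. Qed.

Lemma hP_inj a b : hP a = hP b -> a = b.
Proof.
move=> ab; apply/eqP; rewrite -subr_eq0; apply/eqP.
apply: (Rees_inj hPD (@hPhiZ k n H V) hP_word Sth_span (bmon_free (V := V) char0 n_gt0 ef casE)).
by rewrite hPB ab subrr.
Qed.

Lemma Sth_free : free_module A.
Proof.
exact: (Rees_free_module hPD (@hPhiZ k n H V) hP_word Sth_span (bmon_free (V := V) char0 n_gt0 ef casE)).
Qed.

Local Notation hfilt := (filt srt size bm).

Lemma hP_image p : (exists a, hP a = p) <-> (forall j, hfilt j p`_j).
Proof. exact: (Rees_image hPD (@hPhiZ k n H V) hP_word Sth_span). Qed.

Lemma hfilt_word w N : (size w <= N)%N -> hfilt N (bm w).
Proof.
move=> wN; have /hP_image/(_ N) : exists a, hP a = bm w *: 'X^N.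
  exists ('X^(N - size w) *: hword w); rewrite hPhiZ hP_word map_polyXn.
  by have := scaleXnM 1 (bm w) (N - size w) (size w); rewrite scale1r mul1r subnK.
by rewrite coefZ coefXn eqxx mulr1.
Qed.

Lemma hfilt_divhN N j u : hfilt j (h ^+ N *: u) -> hfilt j u.
Proof.
apply: span_divhN; have := bmon_free0 (V := V) char0 n_gt0 ef casE.
move=> fr s a us /allP Ps; apply: fr => //; apply/allP => w /Ps.
by case/andP.
Qed.

Lemma hfilt_closed j u :
  (forall N, exists v w, hfilt j v /\ u = v + h ^+ N *: w) -> hfilt j u.
Proof.
have fr : free_family (Pdeg srt size j) (fun w => scoef (bm w) 0).
  have fr := bmon_free0 (V := V) char0 n_gt0 ef casE.
  move=> s a us /allP Ps; apply: fr => //; apply/allP => w /Ps.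
  by case/andP.
exact: (span_hclosed fr (sorted_words_uniq d j) (@mem_sorted_words d j)).
Qed.

Lemma hfilt_mul i j u v : hfilt i u -> hfilt j v -> hfilt (i + j) (u * v).
Proof.
move=> Fu Fv; elim: Fu => [|a _ x [w /andP[_ wi] ->] _ IHu].
  by rewrite mul0r; apply: Span0.
rewrite mulrDl -scalerAl; apply: span_add IHu; apply: span_scale.
elim: Fv => [|b _ y [w' /andP[_ wj] ->] _ IHv]; first by rewrite mulr0; apply: Span0.
rewrite mulrDr -scalerAr; apply: span_add IHv; apply: span_scale.
rewrite (_ : bm w * bm w' = bm (w ++ w')); last first.
  by rewrite /bmon big_cat.
by apply: hfilt_word; rewrite size_cat leq_add.
Qed.

Lemma hfilt_gh (y : gh V) : hfilt 1 (ghval y).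
Proof.
have [a ->] := gh_span char0 n_gt0 ef y; have lg := @ghval_klin k n H V.
rewrite (klin_sum lg); apply: span_sum => i _; rewrite (klinZ lg); apply: span_scale.
by have := @hfilt_word [:: i] 1 isT; rewrite /bmon big_seq1.
Qed.

(** ad(x) of a product is computed through Delta(x), an infinite h-adic sum whose terms all lie in
    the filtration piece. Truncating at every order N and using [hfilt_closed] gives the limit. *)
Lemma hfilt_adh x j u : hfilt j u -> hfilt j (adh H x u).
Proof.
have ladh := adh_klinr H; have ladl := adh_klinl H.
elim=> [|a _ y [w /andP[_ wj] ->] _ IH]; first by rewrite (klin0 (ladh x)); apply: Span0.
rewrite (klinD (ladh x)) (klinZ (ladh x)); apply: span_add IH; apply: span_scale.
suff {a y} Hw : forall x, hfilt (size w) (adh H x (bm w)).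
  apply: (span_family_sub _ (Hw x)) => w' /andP[sw' le]; rewrite unfold_in /Pdeg sw' /=.
  exact: leq_trans le wj.
elim: w {wj} => [|i w IH] {}x.
  have b1 : bm [::] = 1 by rewrite /bmon big_nil.
  have -> : adh H x (bm [::]) = counith x *: bm [::] by rewrite b1 adh_one.
  by apply: span_scale; apply: hfilt_word.
have -> : bm (i :: w) = beta V c e i * bm w by rewrite /bmon big_cons.
rewrite adh_mul.
apply: hfilt_closed => N; have [z ->] := hlift_trunc
  (fun a b => adh H a (beta V c e i) * adh H b (bm w)) (Delta x) N.
exists (\sum_(l < N) h ^+ l *: tlift (fun a b =>
  adh H (scst a) (beta V c e i) * adh H (scst b) (bm w)) (scoef (Delta x) l)), z.
split=> //; apply: span_sum => l _; apply: span_scale; rewrite /tlift.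
apply: span_sum => p _; apply: (@hfilt_mul 1 (size w)) (IH _).
by have := hfilt_gh (ghof V (adh H (scst p.1) (bet i))); rewrite ghof_in //; apply: adh_in.
Qed.

(** Divided by h^N, the coefficients stay in their filtration pieces by saturation, hence come from
    an element of the algebra, which injectivity of [hPhi] identifies. *)
Lemma hP_div N a : (forall j, exists y, (hP a)`_j = h ^+ N *: y) ->
  exists b, a = (h ^+ N)%:P *: b.
Proof.
case/choice => y ay.
have [b hb] : exists b, hP b = \poly_(j < size (hP a)) y j.
  apply/hP_image => j; rewrite coef_poly; case: ifP => _; last exact: Span0.
  apply: (@hfilt_divhN N); rewrite -ay.
  by have /hP_image/(_ j) : exists a', hP a' = hP a by exists a.
exists b; apply: hP_inj; apply/polyP => j.
apply: etrans (esym (coef_hPZC (h ^+ N) b j)); rewrite hb coef_poly.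
case: ltnP => [_|le]; first exact: ay.
by rewrite scaler0 nth_default.
Qed.

End DoubleQuantization.

(** * The double quantization *)

Section Assembly.
Variables (k : fieldType) (n : nat) (H : qea k n) (V : basic_rep H).
Hypothesis char0 : forall m, m.+1%:R != 0 :> k.
Hypothesis n_gt0 : (0 < n)%N.
Local Notation g := (sl k n).
Local Notation br := (@slbr k n).
Local Notation U := (uenv br).
Local Notation Uh := (series U).
Local Notation K := (series k).
Local Notation iota := (ugen br).
Local Notation h := (hvar k).
Local Notation Delta := (comulh H).
Local Notation gam := (antipode H).
Local Notation A := (Sth V).
Local Notation St := (symtalg br).

Variables (c : k) (d : nat) (e f : 'I_d -> g).
Hypothesis ef : dual_bases c e f.
Hypothesis casE : casimir H = \sum_i tpure (iota (e i)) (iota (f i)).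

Local Notation bet := (bgh V c e).
Local Notation hword := (qword bet (@Jt_aug k n H V)).
Local Notation sword := (qword e (symtrel_aug (br := br))).
Local Notation bm := (bmon V c e).
Local Notation srt := (sorted (@ole d)).
Local Notation hP := (@hPhi k n H V).
Local Notation sP := (@sPhi k n).
Local Notation rdK := (map_poly (fun x : K => scoef x 0)).

Let hI := hP_inj (V := V) char0 n_gt0 ef casE.
Let ladl := adh_klinl H.
Let ladr := adh_klinr H.

Lemma e_span (x : g) : exists a : 'I_d -> k, x = \sum_i a i *: e i.
Proof. by eexists; apply: (dual_expand ef). Qed.

Lemma sPD a b : sP (a + b) = sP a + sP b. Proof. exact: rmorphD. Qed.
Lemma sPB a b : sP (a - b) = sP a - sP b. Proof. exact: rmorphB. Qed.
Lemma sPM a b : sP (a * b) = sP a * sP b. Proof. exact: rmorphM. Qed.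
Lemma sP0 : sP 0 = 0. Proof. exact: rmorph0. Qed.
Lemma sP1 : sP 1 = 1. Proof. exact: rmorph1. Qed.

Lemma sP_inj a b : sP a = sP b -> a = b.
Proof.
move=> ab; apply/eqP; rewrite -subr_eq0; apply/eqP.
apply: (Rees_inj sPD (@sPhiZ k n) (sPhi_word e) (symt_span e_span) (umon_free n_gt0 char0 ef)).
by rewrite sPB ab subrr.
Qed.

Definition rd : {poly Uh} -> {poly U} := map_poly (@sc0 U).

Lemma coef_rd p j : (rd p)`_j = scoef p`_j 0.
Proof. exact: coef_map_id0. Qed.
Lemma rdD p q : rd (p + q) = rd p + rd q. Proof. exact: rmorphD. Qed.
Lemma rdM p q : rd (p * q) = rd p * rd q. Proof. exact: rmorphM. Qed.
Lemma rd0 : rd 0 = 0. Proof. exact: rmorph0. Qed.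
Lemma rd1 : rd 1 = 1. Proof. exact: rmorph1. Qed.

Lemma coef_rdK p j : (rdK p)`_j = scoef p`_j 0.
Proof. exact: coef_map_id0. Qed.

Lemma rd_in_alg (p : {poly K}) : rd (map_poly (in_alg Uh) p) = map_poly (in_alg U) (rdK p).
Proof.
apply/polyP => j; rewrite coef_rd (coef_map (in_alg Uh)) (coef_map (in_alg U)) coef_rdK.
exact: scoef0Z.
Qed.

Lemma rd_mono u j : rd (u *: 'X^j) = scoef u 0 *: 'X^j.
Proof.
apply/polyP => i; rewrite coef_rd !coefZ !coefXn scoef0M; congr (_ * _).
by case: (i == j).
Qed.

Lemma h0_exists a : exists s, sP s = rd (hP a).
Proof.
elim: (Sth_span char0 n_gt0 ef casE a) => [|p _ x [w _ ->] _ [s es]].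
  by exists 0; rewrite sP0 hP0 rd0.
exists (rdK p *: sword w + s).
rewrite sPD es (hPD (p *: hword w) x) rdD; congr (_ + _).
rewrite (sPhiZ (rdK p) (sword w)) (hPhiZ p (hword w)) rdM rd_in_alg; congr (_ * _).
rewrite (sPhi_word e w) hPhi_word rd_mono; congr (_ *: _).
by rewrite (bmon_0 V char0 ef casE).
Qed.

(** Defined by transport rather than on generators: it is the element of (Sg)_t with the prescribed
    image in U(g)[t], unique by [sP_inj]. Its multiplicativity and linearity can then be checked on
    polynomials; by [h0_exists] the default 0 never stands in for a missing value. *)
Definition h0 (a : A) : St := xget 0 [set s | sP s = rd (hP a)]%classic.

Lemma h0P a : sP (h0 a) = rd (hP a).
Proof.
have [s es] := h0_exists a; rewrite /h0.
by case: xgetP => [s' _ //|/(_ s)]; case.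
Qed.

Lemma h0_eq a s : sP s = rd (hP a) -> h0 a = s.
Proof. by move=> es; apply: sP_inj; rewrite h0P es. Qed.

Lemma h0_nmod_morphism : nmod_morphism h0.
Proof.
split=> [|a b]; apply: h0_eq; first by rewrite hP0 rd0 sP0.
have sum_rd := etrans (sPD (h0 a) (h0 b)) (f_equal2 +%R (h0P a) (h0P b)).
exact: etrans sum_rd (etrans (esym (rdD _ _)) (congr1 rd (esym (hPD a b)))).
Qed.
HB.instance Definition _ := GRing.isNmodMorphism.Build A St h0 h0_nmod_morphism.

Lemma h0_monoid_morphism : monoid_morphism h0.
Proof.
split=> [|a b]; apply: h0_eq; first by rewrite sP1 (rmorph1 hP) rd1.
have mul_rd := etrans (sPM (h0 a) (h0 b)) (f_equal2 *%R (h0P a) (h0P b)).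
exact: etrans mul_rd (etrans (esym (rdM _ _)) (congr1 rd (esym (hPM a b)))).
Qed.
HB.instance Definition _ := GRing.isMonoidMorphism.Build A St h0 h0_monoid_morphism.

Lemma h0Z (p : {poly K}) a : h0 (p *: a) = rdK p *: h0 a.
Proof.
apply: h0_eq; have eh := etrans (congr1 rd (hPhiZ p a)) (rdM _ _).
have es := etrans (sPhiZ (rdK p) (h0 a)) (f_equal2 *%R (esym (rd_in_alg p)) (h0P a)).
exact: etrans es (esym eh).
Qed.

Lemma h0_surj b : exists a, h0 a = b.
Proof.
elim: (symt_span e_span b) => [|p _ x [w _ ->] _ [a ea]].
  by exists 0; apply: h0_eq; rewrite sP0 hP0 rd0.
pose q := map_poly (@scst k) p.
have eq : rdK q = p.
  by apply/polyP => j; rewrite coef_rdK /q coef_map_id0 //.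
exists (q *: hword w + a).
have -> : h0 (q *: hword w + a) = h0 (q *: hword w) + h0 a by exact: rmorphD.
rewrite ea (h0Z q (hword w)) eq; congr (_ *: _ + _).
apply: h0_eq; rewrite (sPhi_word e w) hPhi_word rd_mono; congr (_ *: _).
by rewrite (bmon_0 V char0 ef casE).
Qed.

Lemma h0_ker a : h0 a = 0 <-> exists b, a = h%:P *: b.
Proof.
split=> [a0|[b ->]]; last first.
  rewrite (h0Z h%:P b) (_ : rdK h%:P = 0) ?scale0r //.
  by apply/polyP => j; rewrite coef_rdK coefC coef0; case: eqP.
have [|b eb] := @hP_div k n H V char0 n_gt0 c d e f ef casE 1 a; last by exists b; rewrite {1}eb expr1.
move=> j; rewrite expr1; apply: hmod0P.
by rewrite -coef_rd -h0P a0 sP0 coef0.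
Qed.

Lemma act_exists x a : exists b, hP b = map_poly (adh H x) (hP a).
Proof.
apply/(hP_image V char0 n_gt0 ef casE) => j.
rewrite coef_map_id0; last exact: (klin0 (ladr x)).
apply: (hfilt_adh (V := V) char0 n_gt0 ef casE).
by have /(hP_image V char0 n_gt0 ef casE)/(_ j) : exists a', hP a' = hP a by exists a.
Qed.

(** The adjoint action on each coefficient in t, pulled back along the embedding [hPhi];
    [act_exists] guarantees the preimage. *)
Definition act (x : Uh) (a : A) : A := xget 0 [set b | hP b = map_poly (adh H x) (hP a)]%classic.

Lemma coef_act x a j : (hP (act x a))`_j = adh H x (hP a)`_j.
Proof.
rewrite -(coef_map_id0 _ _ (klin0 (ladr x))).
have -> // : hP (act x a) = map_poly (adh H x) (hP a).
have [b eb] := act_exists x a; rewrite /act.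
by case: xgetP => [b' _ //|/(_ b)]; case.
Qed.

Lemma act_eq x a b : (forall j, (hP b)`_j = adh H x (hP a)`_j) -> act x a = b.
Proof.
move=> ab; apply: hI; apply/polyP => j.
exact: etrans (coef_act x a j) (esym (ab j)).
Qed.

Lemma coef_hPD a b j : (hP (a + b))`_j = (hP a)`_j + (hP b)`_j.
Proof. exact: etrans (congr1 (fun p : {poly Uh} => p`_j) (hPD a b)) (coefD _ _ _). Qed.

Lemma act_linear x : linear (act x).
Proof.
move=> p a b; apply: act_eq => j.
apply: etrans (coef_hPD (p *: act x a) (act x b) j) _.
apply: etrans (f_equal2 +%R (coef_hPZ p (act x a) j) (coef_act x b j)) _.
apply: esym; apply: etrans (congr1 (adh H x) (coef_hPD (p *: a) b j)) _.
apply: etrans (congr1 (fun z => adh H x (z + _)) (coef_hPZ p a j)) _.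
rewrite (klinD (ladr x)) (klin_sum (ladr x)); congr (_ + _); apply: eq_bigr => l _.
rewrite (klinZ (ladr x)); congr (_ *: _); apply: esym; exact: coef_act.
Qed.

Lemma act_linearl (a : K) x y z : act (a *: x + y) z = a%:P *: act x z + act y z.
Proof.
apply: act_eq => j; apply: etrans (coef_hPD (a%:P *: act x z) (act y z) j) _.
have e1 := etrans (coef_hPZC a (act x z) j) (congr1 ( *:%R a) (coef_act x z j)).
apply: etrans (f_equal2 +%R e1 (coef_act y z j)) _.
by rewrite (klinD (ladl _)) (klinZ (ladl _)).
Qed.

Lemma act1 a : act 1 a = a.
Proof. by apply: act_eq => j; rewrite adh1. Qed.

Lemma actM x y a : act (x * y) a = act x (act y a).
Proof. apply: act_eq => j; apply: etrans (coef_act x (act y a) j) _.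
by apply: etrans (congr1 (adh H x) (coef_act y a j)) _; rewrite adhM. Qed.

(** [adh_mul], truncated at order N for each pair of coefficients, leaves remainders divisible by
    h^N in U_h(g)[t]; [hP_div] brings the division back into the algebra. *)
Lemma act_inv x a b N : exists z, act x (a * b) =
  \sum_(i < N) (h ^+ i)%:P *:
    tlift (fun u v => act (scst u) a * act (scst v) b) (scoef (Delta x) i)
  + (h ^+ N)%:P *: z.
Proof.
set S := \sum_(i < N) _.
have [|z ez] := @hP_div k n H V char0 n_gt0 c d e f ef casE N (act x (a * b) - S); last first.
  by exists z; rewrite -ez addrC subrK.
move=> j.
have eS : (hP S)`_j = \sum_(l < j.+1) \sum_(i < N) h ^+ i *:
    tlift (fun u v => adh H (scst u) (hP a)`_l * adh H (scst v) (hP b)`_(j - l))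
      (scoef (Delta x) i).
  rewrite /S hP_sum coef_sum exchange_big /=; apply: eq_bigr => i _.
  apply: etrans (coef_hPZC _ _ j) _; rewrite -scaler_sumr; congr (_ *: _).
  rewrite /tlift hP_sum coef_sum exchange_big /=; apply: eq_bigr => p _.
  apply: etrans (congr1 (fun q : {poly Uh} => q`_j)
    (hPM (act (scst p.1) a) (act (scst p.2) b))) _.
  rewrite coefM; apply: eq_bigr => l _.
  exact: (f_equal2 *%R (coef_act (scst p.1) a l) (coef_act (scst p.2) b (j - l))).
have eL : (hP (act x (a * b)))`_j = \sum_(l < j.+1) adh H x ((hP a)`_l * (hP b)`_(j - l)).
  apply: etrans (coef_act x (a * b) j) _.
  apply: etrans (congr1 (fun q : {poly Uh} => adh H x q`_j) (hPM a b)) _.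
  by rewrite coefM (klin_sum (ladr x)).
have /choice[y yE] : forall l : 'I_j.+1, exists y,
    adh H x ((hP a)`_l * (hP b)`_(j - l)) = \sum_(i < N) h ^+ i *:
    tlift (fun u v => adh H (scst u) (hP a)`_l * adh H (scst v) (hP b)`_(j - l))
      (scoef (Delta x) i) + h ^+ N *: y.
  move=> l; have [y ey] := hlift_trunc
    (fun u v => adh H u (hP a)`_l * adh H v (hP b)`_(j - l)) (Delta x) N.
  by exists y; rewrite adh_mul ey.
exists (\sum_l y l).
apply: etrans (congr1 (fun q : {poly Uh} => q`_j) (hPB (act x (a * b)) S)) _.
apply: etrans (coefB _ _ j) _; apply: etrans (f_equal2 (fun p q => p - q) eL eS) _.
rewrite -sumrB scaler_sumr; apply: eq_bigr => l _.
by rewrite yE addrAC subrr add0r.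
Qed.

Let gam1_0 (w : Uh) : scoef (w * gam (scst 1)) 0 = scoef w 0.
Proof.
exact: (congr1 (fun z => scoef z 0) (etrans (congr1 ( *%R w) (antipode1 H)) (mulr1 w))).
Qed.
Let one_mul_0 (w : Uh) : scoef (scst 1 * w) 0 = scoef w 0.
Proof. exact: (congr1 (fun z => scoef z 0) (mul1r w)). Qed.

(** Of the antipode only the axioms are known. At h = 0, on the primitive element x, the axiom x1
    gamma(x2) = eps(x) reads x + gamma(x) = 0. *)
Lemma antipode_gen_0 (x : g) : scoef (gam (scst (iota x))) 0 = - iota x.
Proof.
have lD := comulh_klin H.
have := antipoder H (scst (iota x)).
move/(congr1 (fun z => scoef z 0)); rewrite hlift_cst0; last by klin.
rewrite comulh_0 comul0_gen.
have -> : tlift (fun a b => scoef (scst a * gam (scst b)) 0) (tpure (iota x) 1 + tpure 1 (iota x))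
   = iota x + scoef (gam (scst (iota x))) 0.
  have bt : tbilin (fun a b : U => scoef (scst a * gam (scst b)) 0).
    split=> a u v w; rewrite scst_is_linear.
      by rewrite mulrDl -scalerAl scoefD scoefZ_cst.
    by rewrite linearP mulrDr -scalerAr scoefD scoefZ_cst.
  have := tlift_linear bt 1 (tpure (iota x) 1) (tpure 1 (iota x)); rewrite !scale1r => el.
  apply: (etrans el).
  apply: (etrans (f_equal2 +%R (tlift_pure bt (iota x) 1) (tlift_pure bt 1 (iota x)))).
  exact: (f_equal2 +%R (gam1_0 (scst (iota x))) (one_mul_0 (gam (scst (iota x))))).
have -> : scoef ((counith (scst (iota x)))%:A : Uh) 0 = 0.
  rewrite scoef0Z (_ : scoef (counith _) 0 = aug (iota x)) //.
  suff -> : aug (iota x) = 0 by rewrite scale0r.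
  by rewrite /ugen [LHS]qaugE tensgen_aug.
by move/eqP; rewrite addrC addr_eq0 => /eqP.
Qed.

Lemma adh_gen_0 (x : g) u :
  scoef (adh H (scst (iota x)) u) 0 = iota x * scoef u 0 - scoef u 0 * iota x.
Proof.
have bt : tbilin (fun a b : U => scoef (scst a * u * gam (scst b)) 0).
  split=> a y v w; rewrite scst_is_linear.
    by rewrite !mulrDl -!scalerAl scoefD scoefZ_cst.
  by rewrite linearP mulrDr -scalerAr scoefD scoefZ_cst.
rewrite /adh hlift_cst0; last by klin.
rewrite comulh_0 comul0_gen.
have := tlift_linear bt 1 (tpure (iota x) 1) (tpure 1 (iota x)); rewrite !scale1r => el.
apply: (etrans el).
apply: (etrans (f_equal2 +%R (tlift_pure bt (iota x) 1) (tlift_pure bt 1 (iota x)))).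
have e1 := etrans (gam1_0 (scst (iota x) * u)) (scoef0M (scst (iota x)) u).
have e2 := scoef0M (scst 1 * u) (gam (scst (iota x))).
have e3 := etrans e2 (f_equal2 *%R (one_mul_0 u) (antipode_gen_0 x)).
apply: (etrans (f_equal2 +%R e1 e3)).
by rewrite mulrN.
Qed.

(** At h = 0 the action becomes the commutator with x in U(g)[t]. The commutator preserves the image
    of (Sg)_t because each of its elements lifts along [h0] and the action upstairs stays in the
    algebra; choosing preimages then defines the derivation. *)
Lemma h0_act : exists2 D, standard_action (@symtgen k g br) D &
  forall (x : g) a, h0 (act (scst (iota x)) a) = D x (h0 a).
Proof.
pose ad (x : g) (p : {poly U}) := (iota x)%:P * p - p * (iota x)%:P.
have adE x p j : (ad x p)`_j = iota x * p`_j - p`_j * iota x.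
  by rewrite coefB coefCM coefMC.
have act_ad x a : sP (h0 (act (scst (iota x)) a)) = ad x (sP (h0 a)).
  apply: (etrans (h0P (act (scst (iota x)) a))); apply/polyP => j.
  apply: (etrans (coef_rd (hP (act (scst (iota x)) a)) j)).
  apply: (etrans (congr1 (fun u : Uh => scoef u 0) (coef_act (scst (iota x)) a j))).
  apply: (etrans (adh_gen_0 x _)); apply: esym; apply: (etrans (adE x (sP (h0 a)) j)).
  have e0 : (sP (h0 a))`_j = scoef (hP a)`_j 0.
    exact: etrans (congr1 (fun p : {poly U} => p`_j) (h0P a)) (coef_rd (hP a) j).
  by rewrite e0.
have /choice[D DE] : forall xs : g * St, exists s, sP s = ad xs.1 (sP xs.2).
  move=> [x s]; have [a <-] := h0_surj s.
  by exists (h0 (act (scst (iota x)) a)); apply: act_ad.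
have DE' x s : sP (D (x, s)) = ad x (sP s) := DE (x, s).
exists (fun x s => D (x, s)); last first.
  by move=> x a; apply: sP_inj; exact: etrans (act_ad x a) (esym (DE' x (h0 a))).
have adZ x (p : {poly k}) q :
    ad x (map_poly (in_alg U) p * q) = map_poly (in_alg U) p * ad x q.
  rewrite /ad mulrBr mulrA; congr (_ - _); last by rewrite mulrA.
  rewrite !mulrA; congr (_ * _); apply/polyP => j; rewrite coefCM coefMC coef_map /=.
  by rewrite mulr_algl -scalerAr mulr1.
have adD x p q : ad x (p + q) = ad x p + ad x q.
  by rewrite /ad mulrDl mulrDr opprD addrACA.
have adM x p q : ad x (p * q) = ad x p * q + p * ad x q.
  by rewrite /ad mulrBl mulrBr !mulrA addrA subrK.
have bracketX (R : nzRingType) (a y : R) :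
    a%:P * (y *: 'X) - (y *: 'X) * a%:P = (a * y - y * a) *: 'X.
  by rewrite -!mul_polyC polyCB !polyCM mulrBl -!mulrA -(commr_polyX a%:P).
have adX x y : ad x (y *: 'X) = (iota x * y - y * iota x) *: 'X by apply: bracketX.
split.
- move=> x p s t; apply: sP_inj.
  have e1 := etrans (sPD (p *: s) t) (congr1 (fun z => z + sP t) (sPhiZ p s)).
  have e2 := etrans (DE' x (p *: s + t)) (congr1 (ad x) e1).
  have e3 := etrans (sPhiZ p (D (x, s))) (congr1 (fun z => _ * z) (DE' x s)).
  have e4 := etrans (sPD (p *: D (x, s)) (D (x, t))) (f_equal2 +%R e3 (DE' x t)).
  apply: (etrans e2); apply: esym; apply: (etrans e4).
  by rewrite adD adZ.
- move=> x a b; apply: sP_inj.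
  have e1 := etrans (DE' x (a * b)) (congr1 (ad x) (sPM a b)).
  have e2 := etrans (sPM (D (x, a)) b) (congr1 (fun z => z * sP b) (DE' x a)).
  have e3 := etrans (sPM a (D (x, b))) (congr1 (fun z => sP a * z) (DE' x b)).
  have e4 := etrans (sPD (D (x, a) * b) (a * D (x, b))) (f_equal2 +%R e2 e3).
  apply: (etrans e1); apply: esym; apply: (etrans e4).
  by rewrite adM.
- move=> x y; apply: sP_inj.
  have e1 := etrans (DE' x (symtgen br y)) (congr1 (ad x) (sPhi_gen y)).
  have e2 := etrans (sPhi_gen (slbr x y)) (congr1 (fun z => z *: 'X) (ugen_br br x y)).
  exact: etrans e1 (etrans (adX x _) (esym e2)).
Qed.

Definition th0 (a : A) := ev0 (h0 a).

Lemma th0_nmod_morphism : nmod_morphism th0.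
Proof.
split=> [|a b]; first by rewrite /th0 (raddf0 h0) raddf0.
by rewrite /th0 (rmorphD h0 a b) rmorphD.
Qed.
HB.instance Definition _ := GRing.isNmodMorphism.Build A (symalg g) th0 th0_nmod_morphism.

Lemma th0_monoid_morphism : monoid_morphism th0.
Proof.
split=> [|a b]; first by rewrite /th0 (rmorph1 h0) rmorph1.
by rewrite /th0 (rmorphM h0 a b) rmorphM.
Qed.
HB.instance Definition _ := GRing.isMonoidMorphism.Build A (symalg g) th0 th0_monoid_morphism.

Lemma th0Z (p : {poly K}) a : th0 (p *: a) = scoef p.[0] 0 *: th0 a.
Proof. by rewrite /th0 (h0Z p a) ev0Z coef_rdK horner_coef0. Qed.

Lemma th0_surj b : exists a, th0 a = b.
Proof.
have [s <-] := ev0_surj br b; have [a <-] := h0_surj s.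
by exists a.
Qed.

(** If the total reduction kills a, then [h0 a] is divisible by t; lifting the quotient and
    subtracting t times it leaves an element of the kernel of [h0], a multiple of h. *)
Lemma th0_ker a : th0 a = 0 <-> exists b z, a = 'X *: b + h%:P *: z.
Proof.
have hX (b : A) : h0 ('X *: b) = 'X *: h0 b.
  rewrite (h0Z 'X b); congr (_ *: _); apply/polyP => j.
  by rewrite coef_rdK !coefX; case: eqP.
split=> [/ev0_ker[s es]|[b [z ->]]].
  have [b eb] := h0_surj s.
  have e1 : h0 a = h0 ('X *: b) by apply: (etrans es); rewrite -eb; apply: esym (hX b).
  have /h0_ker[z ez] : h0 (a - 'X *: b) = 0.
    apply: (etrans (rmorphB h0 a ('X *: b))); apply: (etrans (congr1 (fun w => w - _) e1)).
    exact: subrr.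
  by exists b, z; rewrite -ez addrC subrK.
have e1 : h0 (h%:P *: z) = 0 by apply/h0_ker; exists z.
have e2 := etrans (rmorphD h0 ('X *: b) (h%:P *: z)) (f_equal2 +%R (hX b) e1).
apply: (etrans (congr1 (@ev0 k g br) (etrans e2 (addr0 _)))).
by apply: (etrans (ev0Z 'X (h0 b))); rewrite coefX scale0r.
Qed.

Lemma h0_sthgen (x : gh V) (z : g) : scoef (ghval x) 0 = iota z -> h0 (sthgen x) = symtgen br z.
Proof.
move=> xz; apply: h0_eq.
have e1 := etrans (sPhi_gen z) (congr1 (fun u : U => u *: 'X) (esym xz)).
have e2 : rd (ghval x *: 'X) = scoef (ghval x) 0 *: 'X := rd_mono (ghval x) 1.
exact: etrans e1 (etrans (esym e2) (congr1 rd (esym (hPhi_gen x)))).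
Qed.

Lemma act_sthgen x (y : gh V) : act x (sthgen y) = sthgen (ghof V (adh H x (ghval y))).
Proof.
apply: act_eq => j.
have gE := ghof_in (adh_in x y).
have e1 := etrans (hPhi_gen (ghof V (adh H x y))) (congr1 (fun u => u *: 'X) gE).
apply: (etrans (congr1 (fun p : {poly Uh} => p`_j) e1)); apply: esym.
apply: (etrans (congr1 (fun p : {poly Uh} => adh H x p`_j) (hPhi_gen y))).
rewrite !coefZ coefX; case: eqP => _; first by rewrite !mulr1.
by rewrite !mulr0 (klin0 (ladr x)).
Qed.

(** The three clauses fix the action and both reductions on the generators. By [gh_span] and
    [beta_0] the constant term of an element of g_h always comes from g, so the last two clauses
    reach every generator. *)
Lemma double_quantization_Sth : exists Q : double_quantization H A,
  [/\ forall x (y : gh V), dq_act Q x (sthgen y) = sthgen (ghof V (adh H x (ghval y))),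
      forall (x : gh V) (z : g),
        scoef (ghval x) 0 = iota z -> dq_h0 Q (sthgen x) = symtgen br z
    & forall (x : gh V) (z : g),
        scoef (ghval x) 0 = iota z -> dq_th0 Q (sthgen x) = symgen z].
Proof.
exists (@DoubleQuantization k n H A act act_linear act_linearl act1 actM act_inv
  (Sth_free V char0 n_gt0 ef casE) h0 h0Z h0_surj h0_ker h0_act th0 th0Z th0_surj th0_ker).
split=> [x y|x z xz|x z xz] /=.
- exact: act_sthgen.
- exact: h0_sthgen.
- by rewrite /th0 (h0_sthgen xz) ev0_gen.
Qed.

End Assembly.

Theorem proposition3p2 (R : realType) (n : nat) (n_gt1 : (1 < n)%N)
    (H : qea R[i] n) (V : basic_rep H) :
  exists Q : double_quantization H (Sth V),
    [/\ forall (x : series (uenv (@slbr R[i] n))) (y : gh V),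
          dq_act Q x (sthgen y) = sthgen (ghof V (adh H x (ghval y))),
        forall (x : gh V) (z : sl R[i] n),
          scoef (ghval x) 0 = ugen (@slbr R[i] n) z ->
          dq_h0 Q (sthgen x) = symtgen (@slbr R[i] n) z
      & forall (x : gh V) (z : sl R[i] n),
          scoef (ghval x) 0 = ugen (@slbr R[i] n) z ->
          dq_th0 Q (sthgen x) = symgen z].
Proof.
have char0 m : m.+1%:R != 0 :> R[i] by rewrite Num.Theory.pnatr_eq0.
have [c [d [e [f [_ ef casE]]]]] := casimirP H.
exact: (double_quantization_Sth V char0 (ltnW n_gt1) ef casE).
Qed.
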